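(* Let $n\ge1$, $\alpha\in\mathbb{R}\setminus\pi\mathbb{Z}$, let $\phi,\psi$ be two wavelets satisfying $$\int_{\mathbb{R}_{0}^n}\left|\left(\mathfrak{F}_\alpha\left\{e^{-\frac{i}{2}\|\cdot\|^2\cot\alpha}\phi(\cdot)\right\}\right)(u)\right|\left|\left(\mathfrak{F}_\alpha\left\{e^{-\frac{i}{2}\|\cdot\|^2\cot\alpha}\psi(\cdot)\right\}\right)(u)\right|\frac{1}{|u|_{p}}\,du<\infty ,$$ and suppose that $$C_{\phi,\psi,\alpha}=\int_{\mathbb{R}_{0}^n}\overline{\left(\mathfrak{F}_\alpha\left\{e^{-\frac{i}{2}\|\cdot\|^2\cot\alpha}\phi(\cdot)\right\}\right)(u)}\left(\mathfrak{F}_\alpha\left\{e^{-\frac{i}{2}\|\cdot\|^2\cot\alpha}\psi(\cdot)\right\}\right)(u)\frac{1}{|u|_{p}}\,du$$ is non-zero. Let $F:\mathbb{R}^n\times\mathbb{R}_0^n\to\mathbb{C}$ be a function in $L^2\left(\mathbb{R}^n\times\mathbb{R}_{0}^n,\frac{db\,da}{|a|^2_{p}}\right)$. Then $F=W_{\psi,\alpha}f$ for some $f\in L^2(\mathbb{R}^n)$ if and only if for every $(b_0,a_0)\in\mathbb{R}^n\times\mathbb{R}_0^n$ $$F(b_{0},a_{0})=\int_{\mathbb{R}_{0}^n}\int_{\mathbb{R}^n}F(b,a)\,K_{\phi,\psi,\alpha}(b_{0},a_{0};b,a)\,\frac{db\,da}{|a|^2_{p}},$$ where $K_{\phi,\psi,\alpha}$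 is the reproducing kernel $$K_{\phi,\psi,\alpha}(b_{0},a_{0};b,a)=\frac{|C_{\alpha}|^2}{\overline{C_{\phi,\psi,\alpha}}}\int_{\mathbb{R}^n}\phi_{a,b,\alpha}(t)\,\overline{\psi_{a_{0},b_{0},\alpha}(t)}\,dt.$$
   Context: For $x,y\in\mathbb{R}^n$: $\|x\|$ is the Euclidean norm, $\langle x,y\rangle$ the Euclidean inner product, $|x|_p=|x_1x_2\cdots x_n|$, and $\mathbb{R}_0^n=\{x\in\mathbb{R}^n:|x|_p\ne 0\}$. For $y\in\mathbb{R}^n_0$, $\frac{x}{y}=(x_1/y_1,\dots,x_n/y_n)$. $\langle f,g\rangle_{L^2(\mathbb{R}^n)}=\int_{\mathbb{R}^n} f\overline{g}$. For $\alpha\in\mathbb{R}\setminus\pi\mathbb{Z}$ let $C_\alpha=\left(\frac{1-i\cot\alpha}{2\pi}\right)^{n/2}$ (principal branch) and $K_\alpha(t,\xi)=C_\alpha e^{\frac{i}{2}(\|t\|^2+\|\xi\|^2)\cot\alpha-i\langle t,\xi\rangle\csc\alpha}$. The fractional Fourier transform (FrFT) of $f\in L^1(\mathbb{R}^n)$ is $(\mathfrak{F}_\alpha f)(\xi)=\int_{\mathbb{R}^n}f(t)K_\alpha(t,\xi)\,dt$. For $f\in L^2(\mathbb{R}^n)$, $\mathfrak{F}_\alpha f\in L^2(\mathbb{R}^n)$ is the $L^2$-limit of $\mathfrak{F}_\alpha f_k$ for any sequence $f_k\in L^1\cap L^2$ converging to $f$ in $L^2(\mathbb{R}^n)$. For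 $\psi\in L^2(\mathbb{R}^n)$, $a\in\mathbb{R}^n_0$, $b\in\mathbb{R}^n$: $\psi_{a,b,\alpha}(t)=\frac{1}{\sqrt{|a|_p}}\psi\left(\frac{t-b}{a}\right)e^{-\frac{i}{2}(\|t\|^2-\|b\|^2)\cot\alpha}$. A non-zero $\psi\in L^2(\mathbb{R}^n)$ is a wavelet (wavelet admissible) if $\int_{\mathbb{R}_0^n}\int_{\mathbb{R}^n}|\langle\psi_{a,b,\alpha},\psi\rangle_{L^2(\mathbb{R}^n)}|^2\frac{db\,da}{|a|_p^2}<\infty$. The continuous fractional wavelet transform (CFrWT) of $f$ with respect to $\psi$ is the function $(W_{\psi,\alpha}f)(b,a)=\int_{\mathbb{R}^n}f(t)\overline{\psi_{a,b,\alpha}(t)}\,dt$, $(b,a)\in\mathbb{R}^n\times\mathbb{R}_0^n$. *)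

(* Defs.v *)
From HB Require Import structures.
From mathcomp Require Import all_boot all_order all_algebra.
From mathcomp Require Import all_classical all_reals all_analysis.
From mathcomp.real_closed Require Export complex.

Set Implicit Arguments.
Unset Strict Implicit.
Unset Printing Implicit Defensive.
Import Order.TTheory GRing.Theory Num.Theory.
Import numFieldNormedType.Exports.

Local Open Scope classical_set_scope.
Local Open Scope ring_scope.
Local Open Scope complex_scope.

(* Points of R^n are n.-tuple R, which the library equips with the Borel
   (product) sigma-algebra; complex numbers are R[i]. *)

Section lebesgue_measure_tuple.
Variable R : realType.
Local Open Scope ereal_scope.

Definition tcons n (p : measurableTypeR R * n.-tuple R) : n.+1.-tuple R :=
  [tuple of p.1 :: p.2].

Lemma measurable_tcons n : measurable_fun setT (@tcons n).
Proof.
exact: (@measurable_cons _ _ _ _ (fst : measurableTypeR R * n.-tuple R -> R)).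
Qed.

Definition tuncons n (t : n.+1.-tuple R) : measurableTypeR R * n.-tuple R :=
  (thead t, [tuple of behead t]).

Lemma tuncons_tcons n (p : measurableTypeR R * n.-tuple R) :
  tuncons (tcons p) = p.
Proof. by case: p => x t; congr pair; exact: val_inj. Qed.

Lemma measurable_tuncons n : measurable_fun setT (@tuncons n).
Proof.
apply/measurable_fun_pair; last exact: measurable_behead.
exact: (@measurable_tnth _ R).
Qed.

Section step.
Variables (n : nat) (mu : {sigma_finite_measure set (n.-tuple R) -> \bar R}).

Definition lebnS := pushforward (@lebesgue_measure R \x mu) (@tcons n).

Let lebnS0 : lebnS set0 = 0.
Proof. by rewrite /lebnS /pushforward preimage_set0 measure0. Qed.

Let lebnS_ge0 A : 0 <= lebnS A.
Proof. exact: (measure_ge0 (@lebesgue_measure R \x mu)). Qed.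

Let measurable_preimage (A : set (n.+1.-tuple R)) :
  measurable A -> measurable (@tcons n @^-1` A).
Proof. by move=> mA; rewrite -[X in measurable X]setTI;
  exact: measurable_tcons. Qed.

Let lebnS_sigma_additive : semi_sigma_additive lebnS.
Proof.
move=> F mF tF mUF; rewrite /lebnS /pushforward preimage_bigcup.
apply: measure_semi_sigma_additive.
- by move=> k; exact: measurable_preimage.
- apply/trivIsetP => i j _ _ ij; rewrite -preimage_setI.
  by move/trivIsetP : tF => /(_ _ _ _ _ ij) ->//; rewrite preimage_set0.
- by rewrite -preimage_bigcup; exact: measurable_preimage.
Qed.

HB.instance Definition _ := isMeasure.Build _ _ _ lebnS
  lebnS0 lebnS_ge0 lebnS_sigma_additive.

Let lebnS_sigma_finite : sigma_finite setT lebnS.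
Proof.
have /sigma_finiteP[F [FT ndF Foo]] := sigma_finiteT (@lebesgue_measure R).
have /sigma_finiteP[G [GT ndG Goo]] := sigma_finiteT mu.
exists (fun k => @tuncons n @^-1` (F k `*` G k)).
  rewrite -preimage_bigcup; apply/esym/seteqP; split=> // t _.
  have [i _ Fi] : (\bigcup_k F k) (tuncons t).1 by rewrite -FT.
  have [j _ Gj] : (\bigcup_k G k) (tuncons t).2 by rewrite -GT.
  exists (maxn i j) => //; split.
  - by move: Fi; exact/subsetPset/ndF/leq_maxl.
  - by move: Gj; exact/subsetPset/ndG/leq_maxr.
move=> k; have [mF Fk] := Foo k; have [mG Gk] := Goo k; split.
  by rewrite -[X in measurable X]setTI; apply: measurable_tuncons => //;
  exact: measurableX.
rewrite /lebnS /pushforward -comp_preimage (_ : _ \o _ = id); last first.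
  by apply/funext => p; exact: tuncons_tcons.
by rewrite preimage_id product_measure1E// lte_mul_pinfty// ge0_fin_numE.
Qed.

HB.instance Definition _ := Measure_isSigmaFinite.Build _ _ _ lebnS
  lebnS_sigma_finite.

End step.

(* Lebesgue measure on R^n, restricted to Borel sets. *)
Fixpoint lebn n : {sigma_finite_measure set (n.-tuple R) -> \bar R} :=
  if n is m.+1 then lebnS (lebn m)
  else \d_([tuple] : 0.-tuple R).

Lemma lebn_box n (A : 'I_n -> set R) : (forall i, measurable (A i)) ->
  lebn n [set t | forall i, A i (tnth t i)] =
  \prod_(i < n) lebesgue_measure (A i).
Proof.
elim: n A => [|n IH] A mA.
  by rewrite big_ord0 /= diracE mem_set// => -[].
have mB : measurable
    [set t : n.-tuple R | forall i, A (lift ord0 i) (tnth t i)].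
  rewrite (_ : mkset _ =
    \bigcap_(i in [set: 'I_n]) (@tnth n R ^~ i) @^-1` A (lift ord0 i)).
    apply: fin_bigcap_measurable => // i _; rewrite -[X in measurable X]setTI.
    exact: (@measurable_tnth _ R).
  by apply/seteqP; split => t H i; [move=> _ |]; exact: H.
rewrite big_ord_recl -IH// -(product_measure1E (@lebesgue_measure R)) //=.
rewrite /lebnS /pushforward; congr (_ _).
apply/seteqP; split=> [[x t] H|[x t] [H0 H] i] /=.
  split; first exact: (H ord0).
  by move=> i; have := H (lift ord0 i); rewrite tnthS.
by case: (unliftP ord0 i) => [j|] ->; rewrite ?tnthS//; exact: H.
exact: (mA ord0).
Qed.
End lebesgue_measure_tuple.

(* normc is the modulus as an element of R; the library norm `|z| lives in
   R[i]. *)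
Notation normc := ComplexField.Normc.normc.

Section complex_functions.
Variable R : realType.

Definition cis (x : R) : R[i] := cos x +i* sin x.

(* Principal argument, in ]-pi, pi] for z != 0. *)
Definition carg (z : R[i]) : R :=
  if 0 <= complex.Im z then acos (complex.Re z / normc z)
  else - acos (complex.Re z / normc z).

(* Principal branch of z ^ s, for z != 0. *)
Definition cpowR (z : R[i]) (s : R) : R[i] :=
  (normc z `^ s)%:C * cis (s * carg z).

Definition cot (x : R) : R := cos x / sin x.
Definition csc (x : R) : R := (sin x)^-1.

Context d (T : measurableType d).
Implicit Types (mu : {measure set T -> \bar R}) (D : set T) (f : T -> R[i]).

Definition cmeasurable_fun D f :=
  measurable_fun D (fun x => complex.Re (f x)) /\
  measurable_fun D (fun x => complex.Im (f x)).

Definition cintegral mu D f : R[i] :=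
  (\int[mu]_(x in D) complex.Re (f x)) +i* (\int[mu]_(x in D) complex.Im (f x)).

Definition L1 mu f :=
  cmeasurable_fun setT f /\ (\int[mu]_x (normc (f x))%:E < +oo)%E.

Definition L2 mu f :=
  cmeasurable_fun setT f /\ (\int[mu]_x (normc (f x) ^+ 2)%:E < +oo)%E.

Definition L2_cvg mu (f_ : nat -> T -> R[i]) f :=
  (\int[mu]_x (normc (f_ k x - f x) ^+ 2)%:E)%E @[k --> \oo] --> 0%E.

End complex_functions.

Section fractional_wavelet.
Variables (R : realType) (n : nat).
Local Notation Rn := (n.-tuple R).
Local Notation leb := (lebn R n).
Implicit Types (alpha : R) (t u xi a b : Rn) (f g phi psi : Rn -> R[i]).

Definition sqnorm t : R := \sum_(i < n) tnth t i ^+ 2.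
Definition inner t u : R := \sum_(i < n) tnth t i * tnth u i.
Definition absp t : R := `|\prod_(i < n) tnth t i|.
Definition R0 : set Rn := [set a | absp a != 0].
Definition tsub t u : Rn := [tuple tnth t i - tnth u i | i < n].
Definition tdiv t u : Rn := [tuple tnth t i / tnth u i | i < n].

Definition L2dot f g : R[i] := cintegral leb setT (fun t => f t * conjc (g t)).

Definition Calpha alpha : R[i] :=
  cpowR ((1 -i* cot alpha) / (2 * pi)%:C) (n%:R / 2).

Definition Kalpha alpha t xi : R[i] :=
  Calpha alpha *
  cis (2^-1 * (sqnorm t + sqnorm xi) * cot alpha - inner t xi * csc alpha).

Definition frft1 alpha f xi : R[i] :=
  cintegral leb setT (fun t => f t * Kalpha alpha t xi).

(* The L^2 extension is unique only almost everywhere; frft2 picks a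
   representative. *)
Definition is_frft2 alpha f g :=
  L2 leb g /\
  forall f_ : nat -> Rn -> R[i],
    (forall k, L1 leb (f_ k) /\ L2 leb (f_ k)) ->
    L2_cvg leb f_ f -> L2_cvg leb (fun k => frft1 alpha (f_ k)) g.

Definition frft2 alpha f : Rn -> R[i] := xget (cst 0) (is_frft2 alpha f).

Definition chirp alpha f t : R[i] := cis (- (2^-1 * sqnorm t * cot alpha)) * f t.

(* daughter alpha psi a b is psi_{a,b,alpha}. *)
Definition daughter alpha psi a b t : R[i] :=
  ((Num.sqrt (absp a))^-1)%:C * psi (tdiv (tsub t b) a) *
  cis (- (2^-1 * (sqnorm t - sqnorm b) * cot alpha)).

Definition wavelet alpha psi :=
  [/\ L2 leb psi, ~ {ae leb, forall t, psi t = 0} &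
   (\int[leb]_(a in R0) \int[leb]_b
      (normc (L2dot (daughter alpha psi a b) psi) ^+ 2 / absp a ^+ 2)%:E
    < +oo)%E].

Definition cfrwt alpha psi f b a : R[i] :=
  cintegral leb setT (fun t => f t * conjc (daughter alpha psi a b t)).

Definition Cpair alpha phi psi : R[i] :=
  cintegral leb R0 (fun u =>
    conjc (frft2 alpha (chirp alpha phi) u) * frft2 alpha (chirp alpha psi) u *
    ((absp u)^-1)%:C).

Definition reproducing_kernel alpha phi psi b0 a0 b a : R[i] :=
  (normc (Calpha alpha) ^+ 2)%:C / conjc (Cpair alpha phi psi) *
  cintegral leb setT (fun t =>
    daughter alpha phi a b t * conjc (daughter alpha psi a0 b0 t)).

(* L^2(R^n x R_0^n, db da / |a|_p^2); the values of F off R^n x R_0^n are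
   irrelevant. *)
Definition L2_transform_space (F : Rn * Rn -> R[i]) :=
  cmeasurable_fun (setT `*` R0) F /\
  (\int[leb \x leb]_(p in setT `*` R0)
     (normc (F p) ^+ 2 / absp p.2 ^+ 2)%:E < +oo)%E.

End fractional_wavelet.

Arguments R0 {R n}.

(* Main.v *)
Require Import Defs.
From mathcomp Require Import all_boot all_order all_algebra.
From mathcomp Require Import all_classical all_reals all_analysis.
From mathcomp Require Import measurable_realfun zify ring lra.

(** Up to a constant [k0] the kernel operator is [W_psi] composed with the adjoint of [W_phi], and
    [k0] times that adjoint is a left inverse of [W_psi]. So the operator fixes every transform, and
    whatever it fixes is a transform.

    Since the density [1 / |a|^2] is a square, a function [F] of the transform space is recorded as the
    square integrable function [F / |a|] ([weighted]), and likewise a transform as [W f / |a|]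
    ([fcwt]). The [t]-integral inside the kernel is the conjugate of a value of [W_phi h], so the
    iterated integral at [(b0, a0)] is [k0] times the inner product of [weighted F] with
    [fcwt phi h]; here [h] is the daughter of [psi] at [(b0, a0)] and [k0 = |C_alpha|^2 / conj C]
    ([reproducing_integral]). The value [W_psi f (b0, a0)] is by definition the inner product of [f]
    with the same [h]. Orthogonality ([fcwt_orthogonality]) says
    [<W_psi f, W_phi h> = <Phi/|u|^1/2, Psi/|u|^1/2> <f, h>] with [Phi], [Psi] the Fourier transforms
    of [phi], [psi], and the constant on the right is the inverse of [k0] ([CpairE]). Hence a
    transform satisfies the reproducing formula. Conversely [h |-> <F, W_phi h>] is a bounded
    conjugate linear functional on [L2], so it is [<f, h>] for some [f] ([riesz_representation]), and
    the reproducing formula reads [F = W_psi (k0 f)].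

    Orthogonality itself is the Calderon computation. The factor [cis] of the fractional daughter only
    modulates, so [fcwt] is, up to a unimodular factor, the ordinary wavelet transform of the
    unchirped function. By Parseval, the ordinary coefficient of [g] at [(b, a)] is, as a function of
    [b], a Fourier integral of [Psi (a w) conj (Gam w)]; Plancherel in [b], Tonelli, and the
    invariance of [da / |a|] under dilation give
    [int |<psi_ab, g>|^2 db da / |a|^2 = (int |Psi|^2 / |u|) |g|^2] ([cwt_plancherel]).
    Two polarizations turn this into orthogonality. The same identity for the unchirped wavelet [g]
    shows that admissibility makes [int |Psi|^2 / |u|] finite ([wavelet_wgt]).

    Plancherel is proved on the line by damping with [exp (- eps |x|)], whose transform is an
    approximate identity, and is carried to [R^n] one coordinate at a time ([plancherel]). The
    fractional transform of a chirped function is a dilated and modulated ordinary Fourier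
    transform, first for integrable functions ([frft1E]) and then, by density, for the chosen [L2]
    representative ([frft2_chirp]); this is what identifies the constant of the statement. *)

Set Implicit Arguments.
Unset Strict Implicit.
Unset Printing Implicit Defensive.
Import Order.TTheory GRing.Theory Num.Theory.
Import numFieldNormedType.Exports.

Local Open Scope classical_set_scope.
Local Open Scope ring_scope.
Local Open Scope complex_scope.

(** * Complex modulus and complex measurability *)

Section normc_theory.
Variable R : realType.
Implicit Types (z w : R[i]) (x y : R).

Lemma normc_sqr z : normc z ^+ 2 = complex.Re z ^+ 2 + complex.Im z ^+ 2.
Proof. by case: z => a b /=; rewrite sqr_sqrtr// addr_ge0 ?sqr_ge0. Qed.

Lemma normc_ge0 z : 0 <= normc z.
Proof. by case: z => a b /=; exact: sqrtr_ge0. Qed.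

Lemma normcM z w : normc (z * w) = normc z * normc w.
Proof. exact: ComplexField.Normc.normcM. Qed.

Lemma normc_conj z : normc (conjc z) = normc z.
Proof. by case: z => a b /=; rewrite sqrrN. Qed.

Lemma normcN z : normc (- z) = normc z.
Proof. by case: z => a b /=; rewrite !sqrrN. Qed.

Lemma normc_real x : normc x%:C = `|x|.
Proof. by rewrite /= expr0n addr0 sqrtr_sqr. Qed.

Lemma normc0 : normc (0 : R[i]) = 0.
Proof. exact: ComplexField.Normc.normc0. Qed.

Lemma normc_eq0 z : (normc z == 0) = (z == 0).
Proof.
by apply/eqP/eqP => [|->]; [exact: ComplexField.Normc.eq0_normc|exact: normc0].
Qed.

Lemma le_Re_normc z : `|complex.Re z| <= normc z.
Proof.
case: z => a b /=; rewrite -sqrtr_sqr ler_sqrt; first by rewrite lerDl sqr_ge0.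
by rewrite addr_ge0 ?sqr_ge0.
Qed.

Lemma le_Im_normc z : `|complex.Im z| <= normc z.
Proof.
case: z => a b /=; rewrite -sqrtr_sqr ler_sqrt; first by rewrite lerDr sqr_ge0.
by rewrite addr_ge0 ?sqr_ge0.
Qed.

Lemma ler_normcD z w : normc (z + w) <= normc z + normc w.
Proof.
have := @ler_normD _ R[i] z w.
have e (v : R[i]) : `|v| = (normc v)%:C by [].
by rewrite !e -rmorphD lecR.
Qed.

Lemma ler_normcB z w : normc (z - w) <= normc z + normc w.
Proof. by rewrite -(normcN w) ler_normcD. Qed.

Lemma normcC z w : normc (z - w) = normc (w - z).
Proof. by rewrite -normcN opprB. Qed.

Lemma normc_le_ReIm z : normc z <= `|complex.Re z| + `|complex.Im z|.
Proof.
rewrite -(@ler_pXn2r _ 2)// ?nnegrE ?addr_ge0 ?normc_ge0//.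
rewrite normc_sqr sqrrD !real_normK ?num_real// -addrA lerD2l lerDr.
by rewrite mulrn_wge0// mulr_ge0.
Qed.

Lemma normc_cis x : normc (cis x) = 1.
Proof. by rewrite /cis /= cos2Dsin2 sqrtr1. Qed.

Lemma cisD x y : cis (x + y) = cis x * cis y.
Proof. by rewrite /cis cosD sinD; simpc; congr (_ +i* _); ring. Qed.

Lemma cis0 : cis (0 : R) = 1.
Proof. by rewrite /cis cos0 sin0. Qed.

Lemma conj_cis x : conjc (cis x) = cis (- x).
Proof. by rewrite /cis cosN sinN. Qed.

Lemma mul_conjc z : z * conjc z = (normc z ^+ 2)%:C.
Proof. by rewrite normc_sqr; case: z => a b; simpc; congr (_ +i* _) => /=; ring. Qed.

Lemma cisVK x : cis x * cis (- x) = 1.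
Proof. by rewrite -cisD subrr cis0. Qed.

Lemma normc_mul_le z w : normc z * normc w <= 2^-1 * (normc z ^+ 2 + normc w ^+ 2).
Proof. by have := sqr_ge0 (normc z - normc w); nra. Qed.

Lemma normc_sqrD z w : normc (z + w) ^+ 2 <= 2 * normc z ^+ 2 + 2 * normc w ^+ 2.
Proof.
have h := ler_normcD z w; have := sqr_ge0 (normc z - normc w).
by have := normc_ge0 (z + w); have := normc_ge0 z; have := normc_ge0 w; nra.
Qed.

Lemma conjcM z w : conjc (z * w) = conjc z * conjc w.
Proof. exact: rmorphM. Qed.

Lemma realCM x y : (x * y)%:C = x%:C * y%:C.
Proof. exact: rmorphM. Qed.
Lemma cReD z w : complex.Re (z + w) = complex.Re z + complex.Re w.
Proof. by case: z; case: w. Qed.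
Lemma cImD z w : complex.Im (z + w) = complex.Im z + complex.Im w.
Proof. by case: z; case: w. Qed.
Lemma cReN z : complex.Re (- z) = - complex.Re z.
Proof. by case: z. Qed.
Lemma cImN z : complex.Im (- z) = - complex.Im z.
Proof. by case: z. Qed.
Lemma cReM z w : complex.Re (z * w) =
  complex.Re z * complex.Re w - complex.Im z * complex.Im w.
Proof. by case: z; case: w. Qed.
Lemma cImM z w : complex.Im (z * w) =
  complex.Re z * complex.Im w + complex.Im z * complex.Re w.
Proof. by case: z; case: w. Qed.
Lemma cRe_conj z : complex.Re (conjc z) = complex.Re z.
Proof. by case: z. Qed.
Lemma cIm_conj z : complex.Im (conjc z) = - complex.Im z.
Proof. by case: z. Qed.

End normc_theory.

Section cmeasurable.
Context (R : realType) d (T : measurableType d).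
Implicit Types (f g : T -> R[i]).
Local Notation cmeas := (cmeasurable_fun setT).

Lemma cmeas_cst (z : R[i]) : cmeas (fun _ : T => z).
Proof. by split; exact: measurable_cst. Qed.

Lemma cmeasD f g : cmeas f -> cmeas g -> cmeas (fun x => f x + g x).
Proof.
move=> [f1 f2] [g1 g2]; split.
  by under eq_fun do rewrite cReD; exact: measurable_funD.
by under eq_fun do rewrite cImD; exact: measurable_funD.
Qed.

Lemma cmeasN f : cmeas f -> cmeas (fun x => - f x).
Proof.
move=> [f1 f2]; split.
  by under eq_fun do rewrite cReN; exact: measurableT_comp.
by under eq_fun do rewrite cImN; exact: measurableT_comp.
Qed.

Lemma cmeasB f g : cmeas f -> cmeas g -> cmeas (fun x => f x - g x).
Proof. by move=> mf mg; apply: cmeasD => //; exact: cmeasN. Qed.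

Lemma cmeasM f g : cmeas f -> cmeas g -> cmeas (fun x => f x * g x).
Proof.
move=> [f1 f2] [g1 g2]; split.
  by under eq_fun do rewrite cReM; apply: measurable_funB; exact: measurable_funM.
by under eq_fun do rewrite cImM; apply: measurable_funD; exact: measurable_funM.
Qed.

Lemma cmeas_conj f : cmeas f -> cmeas (fun x => conjc (f x)).
Proof.
move=> [f1 f2]; split.
  by under eq_fun do rewrite cRe_conj.
by under eq_fun do rewrite cIm_conj; exact: measurableT_comp.
Qed.

Lemma cmeas_real (h : T -> R) : measurable_fun setT h ->
  cmeas (fun x => (h x)%:C).
Proof. by move=> mh; split => //=; exact: measurable_cst. Qed.

Lemma cmeas_cis (h : T -> R) : measurable_fun setT h -> cmeas (fun x => cis (h x)).
Proof.
move=> mh; split => /=; apply: measurableT_comp => //;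
  apply: continuous_measurable_fun; [exact: continuous_cos|exact: continuous_sin].
Qed.

Lemma cmeas_comp d' (T' : measurableType d') (k : T' -> T) f :
  measurable_fun setT k -> cmeas f -> cmeasurable_fun setT (f \o k).
Proof. by move=> mk [f1 f2]; split; [exact: (measurableT_comp f1)|exact: (measurableT_comp f2)]. Qed.

Lemma meas_normc2 f : cmeas f -> measurable_fun setT (fun x => normc (f x) ^+ 2).
Proof.
move=> [f1 f2]; under eq_fun do rewrite normc_sqr.
by apply: measurable_funD; exact: measurable_funX.
Qed.

Lemma meas_normc f : cmeas f -> measurable_fun setT (fun x => normc (f x)).
Proof.
move=> mf.
rewrite (_ : (fun x => _) = Num.sqrt \o (fun x => normc (f x) ^+ 2)).
  apply: measurableT_comp; last exact: meas_normc2.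
  by apply: continuous_measurable_fun; exact: sqrt_continuous.
by apply/funext => x /=; rewrite sqrtr_sqr ger0_norm// normc_ge0.
Qed.

End cmeasurable.

(** * Complex integrals *)

Section L1_theory.
Context (R : realType) d (T : measurableType d).
Variable mu : {measure set T -> \bar R}.
Implicit Types (f g : T -> R[i]) (h : T -> R).
Local Notation cmeas := (cmeasurable_fun setT).
Local Notation cint := (cintegral mu setT).

Lemma L1_meas f : L1 mu f -> cmeas f. Proof. by case. Qed.

Lemma L1_normc f : L1 mu f ->
  mu.-integrable setT (fun x => (normc (f x))%:E).
Proof.
move=> [mf fin]; apply/integrableP; split.
  by apply/measurable_EFinP; exact: meas_normc.
under eq_integral do rewrite abse_EFin ger0_norm ?normc_ge0//.
exact: fin.
Qed.

Lemma L1_le f h : cmeas f -> mu.-integrable setT (EFin \o h) ->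
  (forall x, normc (f x) <= h x) -> L1 mu f.
Proof.
move=> mf ih fh; split => //.
have mh : measurable_fun setT h by move/measurable_int : ih => /measurable_EFinP.
apply: le_lt_trans (integrableP _ _ _ ih).2 => /=.
apply: ge0_le_integral => //=.
- by move=> x _; rewrite lee_fin normc_ge0.
- by apply/measurable_EFinP; exact: meas_normc.
- by apply/measurable_EFinP; exact: measurableT_comp.
- by move=> x _; rewrite lee_fin; exact: le_trans (fh x) (ler_norm _).
Qed.

Lemma L1_Re f : L1 mu f -> mu.-integrable setT (fun x => (complex.Re (f x))%:E).
Proof.
move=> lf; have [[mr mi] _] := lf; apply: le_integrable (L1_normc lf) => //.
  exact/measurable_EFinP.
by move=> x _; rewrite /= lee_fin (le_trans (le_Re_normc _))// ler_norm.
Qed.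

Lemma L1_Im f : L1 mu f -> mu.-integrable setT (fun x => (complex.Im (f x))%:E).
Proof.
move=> lf; have [[mr mi] _] := lf; apply: le_integrable (L1_normc lf) => //.
  exact/measurable_EFinP.
by move=> x _; rewrite /= lee_fin (le_trans (le_Im_normc _))// ler_norm.
Qed.

Lemma L1D f g : L1 mu f -> L1 mu g -> L1 mu (fun x => f x + g x).
Proof.
move=> lf lg; apply: (@L1_le _ (fun x => normc (f x) + normc (g x))).
- by apply: cmeasD; [case: lf|case: lg].
- have := integrableD measurableT (L1_normc lf) (L1_normc lg).
  by apply: eq_integrable.
- by move=> x; exact: ler_normcD.
Qed.

Lemma L1M f (b : T -> R[i]) (M : R) : L1 mu f -> cmeas b -> (forall x, normc (b x) <= M) ->
  L1 mu (fun x => f x * b x).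
Proof.
move=> lf mb bM; apply: (@L1_le _ (fun x => M * normc (f x))).
- by apply: cmeasM => //; case: lf.
- have := integrableZl measurableT M (L1_normc lf).
  by apply: eq_integrable.
- by move=> x; rewrite normcM mulrC ler_wpM2r ?normc_ge0.
Qed.

Lemma L1Zl z f : L1 mu f -> L1 mu (fun x => z * f x).
Proof.
move=> lf; under eq_fun do rewrite mulrC.
exact: (L1M lf (cmeas_cst _ z) (fun=> lexx (normc z))).
Qed.

Lemma L1N f : L1 mu f -> L1 mu (fun x => - f x).
Proof.
by move=> lf; under eq_fun do rewrite -mulN1r; exact: L1Zl.
Qed.

Lemma L1B f g : L1 mu f -> L1 mu g -> L1 mu (fun x => f x - g x).
Proof. by move=> lf lg; apply: L1D => //; exact: L1N. Qed.

Lemma L1_conj f : L1 mu f -> L1 mu (fun x => conjc (f x)).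
Proof.
move=> [mf fin]; split; first exact: cmeas_conj.
by under eq_integral do rewrite normc_conj; exact: fin.
Qed.

Lemma L1_eq_normc f g : cmeas f -> L1 mu g -> (forall x, normc (f x) = normc (g x)) -> L1 mu f.
Proof.
move=> mf [_ fin] fg; split => //.
by under eq_integral do rewrite fg; exact: fin.
Qed.

Lemma cintD f g : L1 mu f -> L1 mu g ->
  cint (fun x => f x + g x) = cint f + cint g.
Proof.
move=> lf lg; rewrite /cintegral; simpc; congr (_ +i* _).
  under eq_Rintegral do rewrite cReD.
  by rewrite RintegralD//; exact: L1_Re.
under eq_Rintegral do rewrite cImD.
by rewrite RintegralD//; exact: L1_Im.
Qed.

Lemma cintZl z f : L1 mu f -> cint (fun x => z * f x) = z * cint f.
Proof.
move=> lf; rewrite /cintegral; case: z => a b; simpc.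
have ir := L1_Re lf; have ii := L1_Im lf.
congr (_ +i* _).
  under eq_Rintegral do rewrite cReM/=.
  rewrite RintegralB//; first by rewrite !RintegralZl.
    by apply: eq_integrable (integrableZl measurableT a ir).
  by apply: eq_integrable (integrableZl measurableT b ii).
under eq_Rintegral do rewrite cImM/=.
rewrite RintegralD//; first by rewrite !RintegralZl.
  by apply: eq_integrable (integrableZl measurableT a ii).
by apply: eq_integrable (integrableZl measurableT b ir).
Qed.

Lemma cintZr z f : L1 mu f -> cint (fun x => f x * z) = cint f * z.
Proof. by move=> lf; under eq_fun do rewrite mulrC; rewrite cintZl// mulrC. Qed.

Lemma cintN f : L1 mu f -> cint (fun x => - f x) = - cint f.
Proof. by move=> lf; under eq_fun do rewrite -mulN1r; rewrite cintZl// mulN1r. Qed.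

Lemma cintB f g : L1 mu f -> L1 mu g ->
  cint (fun x => f x - g x) = cint f - cint g.
Proof. by move=> lf lg; rewrite cintD ?cintN//; exact: L1N. Qed.

Lemma cint_conj f : L1 mu f -> cint (fun x => conjc (f x)) = conjc (cint f).
Proof.
move=> lf; rewrite /cintegral; simpc; congr (_ +i* _).
  by under eq_Rintegral do rewrite cRe_conj.
under eq_Rintegral do rewrite cIm_conj -mulN1r.
by rewrite RintegralZl ?mulN1r//; exact: L1_Im.
Qed.

Lemma cint_real h : cint (fun x => (h x)%:C) = (\int[mu]_x h x)%:C.
Proof. by rewrite /cintegral /= Rintegral_cst// mul0r. Qed.

Lemma eq_cint f g : f =1 g -> cint f = cint g.
Proof. by move=> /funext ->. Qed.

Lemma eq_cint_ae f g : cmeas f -> cmeas g -> {ae mu, forall x, f x = g x} ->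
  cint f = cint g.
Proof.
move=> [f1 f2] [g1 g2] fg; rewrite /cintegral; congr (_ +i* _); congr fine.
  apply: ae_eq_integral => //; [exact/measurable_EFinP|exact/measurable_EFinP|].
  by apply: filterS fg => x /= ->.
apply: ae_eq_integral => //; [exact/measurable_EFinP|exact/measurable_EFinP|].
by apply: filterS fg => x /= ->.
Qed.

(** Rotating by [conj z], with [z] the integral, reduces the triangle inequality for complex
    integrals to the real one. *)
Lemma normc_cint_le f : L1 mu f -> normc (cint f) <= \int[mu]_x normc (f x).
Proof.
move=> lf; set z := cint f.
have [z0|z0] := eqVneq z 0.
  by rewrite z0 normc0; apply: Rintegral_ge0 => x _; exact: normc_ge0.
have zp : 0 < normc z by rewrite lt_neqAle normc_ge0 andbT eq_sym normc_eq0.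
rewrite -(ler_pM2l zp) -expr2.
have lz := L1Zl (conjc z) lf.
have -> : normc z ^+ 2 = complex.Re (cint (fun x => conjc z * f x)).
  by rewrite cintZl// -/z mulrC mul_conjc.
rewrite -RintegralZl//; last exact: L1_normc.
apply: le_Rintegral => //; first exact: L1_Re.
  by apply: eq_integrable (integrableZl measurableT (normc z) (L1_normc lf)).
move=> x _; apply: le_trans (ler_norm _) _.
by apply: le_trans (le_Re_normc _) _; rewrite normcM normc_conj.
Qed.

Lemma Rdct0 (h_ : nat -> T -> R) (g : T -> R) :
  (forall k, measurable_fun setT (h_ k)) -> (forall k x, 0 <= h_ k x) ->
  mu.-integrable setT (EFin \o g) ->
  {ae mu, forall x, forall k, h_ k x <= g x} ->
  {ae mu, forall x, h_ k x @[k --> \oo] --> 0} ->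
  (\int[mu]_x (h_ k x)%:E)%E @[k --> \oo] --> 0%E.
Proof.
move=> mh h0 ig hg hc.
have := @dominated_convergence _ _ _ mu setT measurableT
  (fun k x => (h_ k x)%:E) (cst 0%E) (EFin \o g).
case=> //.
- by move=> k; exact/measurable_EFinP.
- by apply: filterS hc => x hx _; apply: cvg_EFin => //; exact: nearW.
- by apply: filterS hg => x hx k _ /=; rewrite lee_fin ger0_norm.
- by move=> _ _ /=; rewrite integral0.
Qed.

Lemma cint_dct (f_ : nat -> T -> R[i]) f (g : T -> R) :
  (forall k, cmeas (f_ k)) -> cmeas f ->
  mu.-integrable setT (EFin \o g) ->
  (forall k x, normc (f_ k x) <= g x) -> (forall x, normc (f x) <= g x) ->
  {ae mu, forall x, normc (f_ k x - f x) @[k --> \oo] --> 0} ->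
  normc (cint (f_ k) - cint f) @[k --> \oo] --> 0.
Proof.
move=> mf_ mf ig fg fg' fc.
have lf_ k : L1 mu (f_ k) by exact: L1_le ig (fg k).
have lf : L1 mu f by exact: L1_le ig fg'.
have lB k : L1 mu (fun x => f_ k x - f x) by exact: L1B.
have H : (\int[mu]_x (normc (f_ k x - f x))%:E)%E @[k --> \oo] --> 0%E.
  apply: (@Rdct0 _ (fun x => 2 * g x)) => //.
  - by move=> k; apply: meas_normc; apply: cmeasB.
  - by move=> *; exact: normc_ge0.
  - by apply: eq_integrable (integrableZl measurableT 2 ig).
  - apply: aeW => x k; apply: le_trans (ler_normcB _ _) _.
    by have := fg k x; have := fg' x; lra.
apply: (@squeeze_cvgr _ _ _ _ (fun=> 0) (fun k => \int[mu]_x normc (f_ k x - f x))).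
- near=> k; rewrite normc_ge0 -cintB//=; exact: normc_cint_le.
- exact: cvg_cst.
- exact: (fine_cvg H).
Unshelve. all: by end_near. Qed.

Lemma cintegral_mkcond (D : set T) f :
  cintegral mu D f = cint (fun x => f x * (\1_D x)%:C).
Proof.
rewrite /cintegral !(Rintegral_mkcond _ D); congr (_ +i* _); apply: eq_Rintegral => x _;
  rewrite /restrict /= indicE; case: ifPn => _ /=; rewrite ?(cReM,cImM)/= ?mulr1 ?mulr0 ?subr0 ?addr0//.
by rewrite add0r.
Qed.

End L1_theory.

Section fubini_complex.
Context (R : realType) d1 d2 (T1 : measurableType d1) (T2 : measurableType d2).
Variables (m1 : {sigma_finite_measure set T1 -> \bar R})
          (m2 : {sigma_finite_measure set T2 -> \bar R}).
Implicit Types (f : T1 * T2 -> R[i]) (h : T1 * T2 -> R).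

Lemma meas_Rintegral2 h : measurable_fun setT h ->
  measurable_fun setT (fun x => \int[m2]_y h (x, y)).
Proof.
move=> mh; apply: (measurableT_comp (fine_measurable measurableT)).
have mE : measurable_fun setT (EFin \o h) by exact/measurable_EFinP.
rewrite (_ : (fun x => _) = ((fun x => \int[m2]_y ((EFin \o h)^\+ (x, y)))
  \- (fun x => \int[m2]_y ((EFin \o h)^\- (x, y))))%E); last first.
  apply/funext => x; rewrite integralE /=; congr (_ - _)%E; apply: eq_integral => y _.
    exact: (congr1 (@^~ y) (funepos_comp (EFin \o h) (pair x))).
  exact: (congr1 (@^~ y) (funeneg_comp (EFin \o h) (pair x))).
apply: emeasurable_funB.
  by apply: (measurable_fun_fubini_tonelli_F ((EFin \o h)^\+)%E) => //; exact: measurable_funepos.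
by apply: (measurable_fun_fubini_tonelli_F ((EFin \o h)^\-)%E) => //; exact: measurable_funeneg.
Qed.

(** The inner integrals of an integrable function are finite almost everywhere; the others are sent
    to 0 by [Rintegral], which changes the outer integrand on a null set only. *)
Lemma Rfubini1 h : (m1 \x m2)%E.-integrable setT (EFin \o h) ->
  \int[(m1 \x m2)%E]_p h p = \int[m1]_x \int[m2]_y h (x, y).
Proof.
move=> ih; have mh := measurable_int _ ih; congr fine.
rewrite -integral12_prod_meas1//; apply: ae_eq_integral => //.
- exact: (@measurable_fubini_F _ _ _ _ _ m1 m2 _ ih).
- apply/measurable_EFinP; apply: meas_Rintegral2; exact/measurable_EFinP.
- have := ae_integrable1 ih; apply: filterS => x ihx _.
  by rewrite /fubini_F /Rintegral fineK//; exact: integrable_fin_num.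
Qed.

Lemma cint_fubini1 f : L1 (m1 \x m2)%E f ->
  cintegral (m1 \x m2)%E setT f =
  cintegral m1 setT (fun x => cintegral m2 setT (fun y => f (x, y))).
Proof.
move=> lf; rewrite /cintegral/=; congr (_ +i* _).
  exact: Rfubini1 (L1_Re lf).
exact: Rfubini1 (L1_Im lf).
Qed.

Lemma cmeas_cint2 f : cmeasurable_fun setT f ->
  cmeasurable_fun setT (fun x => cintegral m2 setT (fun y => f (x, y))).
Proof. by move=> [f1 f2]; split; [exact: (meas_Rintegral2 f1)|exact: (meas_Rintegral2 f2)]. Qed.

End fubini_complex.

Section fubini_swap.
Context (R : realType) d1 d2 (T1 : measurableType d1) (T2 : measurableType d2).
Variables (m1 : {sigma_finite_measure set T1 -> \bar R})
          (m2 : {sigma_finite_measure set T2 -> \bar R}).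
Implicit Types (f : T1 * T2 -> R[i]) (h : T1 * T2 -> R).

Lemma meas_Rintegral1 h : measurable_fun setT h ->
  measurable_fun setT (fun y => \int[m1]_x h (x, y)).
Proof.
move=> mh; apply: (measurableT_comp (fine_measurable measurableT)).
have mE : measurable_fun setT (EFin \o h) by exact/measurable_EFinP.
rewrite (_ : (fun x => _) = ((fun y => \int[m1]_x ((EFin \o h)^\+ (x, y)))
  \- (fun y => \int[m1]_x ((EFin \o h)^\- (x, y))))%E); last first.
  apply/funext => y; rewrite integralE /=; congr (_ - _)%E; apply: eq_integral => x _.
    exact: (congr1 (@^~ x) (funepos_comp (EFin \o h) (fun x => (x, y)))).
  exact: (congr1 (@^~ x) (funeneg_comp (EFin \o h) (fun x => (x, y)))).
apply: emeasurable_funB.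
  by apply: (measurable_fun_fubini_tonelli_G ((EFin \o h)^\+)%E) => //; exact: measurable_funepos.
by apply: (measurable_fun_fubini_tonelli_G ((EFin \o h)^\-)%E) => //; exact: measurable_funeneg.
Qed.

Lemma Rfubini2 h : (m1 \x m2)%E.-integrable setT (EFin \o h) ->
  \int[(m1 \x m2)%E]_p h p = \int[m2]_y \int[m1]_x h (x, y).
Proof.
move=> ih; have mh := measurable_int _ ih; congr fine.
rewrite -integral21_prod_meas1//; apply: ae_eq_integral => //.
- exact: (@measurable_fubini_G _ _ _ _ _ m1 m2 _ ih).
- apply/measurable_EFinP; apply: meas_Rintegral1; exact/measurable_EFinP.
- have := ae_integrable2 ih; apply: filterS => x ihx _.
  by rewrite /fubini_G /Rintegral fineK//; exact: integrable_fin_num.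
Qed.

Lemma cint_fubini2 f : L1 (m1 \x m2)%E f ->
  cintegral (m1 \x m2)%E setT f =
  cintegral m2 setT (fun y => cintegral m1 setT (fun x => f (x, y))).
Proof.
move=> lf; rewrite /cintegral/=; congr (_ +i* _).
  exact: Rfubini2 (L1_Re lf).
exact: Rfubini2 (L1_Im lf).
Qed.

Lemma cmeas_cint1 f : cmeasurable_fun setT f ->
  cmeasurable_fun setT (fun y => cintegral m1 setT (fun x => f (x, y))).
Proof. by move=> [f1 f2]; split; [exact: (meas_Rintegral1 f1)|exact: (meas_Rintegral1 f2)]. Qed.

Lemma L1_tonelli1 f : cmeasurable_fun setT f ->
  (\int[m1]_x \int[m2]_y (normc (f (x, y)))%:E < +oo)%E -> L1 (m1 \x m2)%E f.
Proof.
move=> mf fin; split => //; rewrite fubini_tonelli1//.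
- by apply/measurable_EFinP; exact: meas_normc.
- by move=> p; rewrite lee_fin normc_ge0.
Qed.

Lemma cmeas_fst (u : T1 -> R[i]) : cmeasurable_fun setT u ->
  cmeasurable_fun setT (fun p : T1 * T2 => u p.1).
Proof. by move=> mu; apply: (cmeas_comp measurable_fst mu). Qed.

Lemma cmeas_snd (u : T2 -> R[i]) : cmeasurable_fun setT u ->
  cmeasurable_fun setT (fun p : T1 * T2 => u p.2).
Proof. by move=> mu; apply: (cmeas_comp measurable_snd mu). Qed.

(** Tonelli factors the integral of [|u x| |w y|], and the bounded factor costs only a constant. *)
Lemma L1_prod (u : T1 -> R[i]) (w : T2 -> R[i]) (b : T1 * T2 -> R[i]) (M : R) :
  L1 m1 u -> L1 m2 w -> cmeasurable_fun setT b -> (forall p, normc (b p) <= M) ->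
  L1 (m1 \x m2)%E (fun p => u p.1 * b p * w p.2).
Proof.
move=> lu lw mb bM; under eq_fun do rewrite mulrAC.
apply: (L1M (M := M) _ mb bM).
apply: L1_tonelli1; first by apply: cmeasM; [apply: cmeas_fst; case: lu|apply: cmeas_snd; case: lw].
under eq_integral => x _.
  under eq_integral do rewrite /= normcM EFinM.
  rewrite ge0_integralZl_EFin ?normc_ge0//; last 2 first.
  - by move=> y _; rewrite lee_fin normc_ge0.
  - by apply/measurable_EFinP; apply: meas_normc; case: lw.
  over.
rewrite ge0_integralZr//; last 3 first.
- by apply/measurable_EFinP; apply: meas_normc; case: lu.
- by move=> y _; rewrite lee_fin normc_ge0.
- by apply: integral_ge0 => y _; rewrite lee_fin normc_ge0.
have n0 d (T : measurableType d) (mu : {measure set T -> \bar R}) (f : T -> R[i]) :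
    (0 <= \int[mu]_x (normc (f x))%:E)%E.
  by apply: integral_ge0 => y _; rewrite lee_fin normc_ge0.
apply: lte_mul_pinfty; first exact: n0.
  by rewrite ge0_fin_numE; [case: lu|exact: n0].
by case: lw.
Qed.

(** The multiplication formula: boundedness of the kernel makes the triple product integrable, and
    Fubini moves the kernel across the pairing. *)
Lemma cint_swap (u : T1 -> R[i]) (w : T2 -> R[i]) (b : T1 * T2 -> R[i]) (M : R) :
  L1 m1 u -> L1 m2 w -> cmeasurable_fun setT b -> (forall p, normc (b p) <= M) ->
  cintegral m2 setT (fun y => cintegral m1 setT (fun x => u x * b (x, y)) * w y) =
  cintegral m1 setT (fun x => u x * cintegral m2 setT (fun y => b (x, y) * w y)).
Proof.
move=> lu lw mb bM; have lp := L1_prod lu lw mb bM.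
transitivity (cintegral (m1 \x m2)%E setT (fun p => u p.1 * b p * w p.2)).
  rewrite cint_fubini2//; apply: eq_cint => y /=.
  rewrite cintZr//; apply: (L1M (M := M) lu) => //.
  by apply: (cmeas_comp _ mb); exact: pair2_measurable.
rewrite cint_fubini1//; apply: eq_cint => x /=.
under eq_fun do rewrite -mulrA.
rewrite cintZl//; under eq_fun do rewrite mulrC; apply: (L1M (M := M) lw) => //.
by apply: (cmeas_comp _ mb); exact: pair1_measurable.
Qed.

End fubini_swap.

(** * Square integrable functions *)

Section L2_theory.
Context (R : realType) d (T : measurableType d).
Variable mu : {measure set T -> \bar R}.
Implicit Types (f g h : T -> R[i]).
Local Notation cmeas := (cmeasurable_fun setT).
Local Notation cint := (cintegral mu setT).

Definition L2sq f : R := \int[mu]_x (normc (f x) ^+ 2).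
Definition cdot f g : R[i] := cint (fun x => f x * conjc (g x)).

Lemma L2_meas f : L2 mu f -> cmeas f. Proof. by case. Qed.

Lemma L2_sq_int f : L2 mu f ->
  mu.-integrable setT (fun x => (normc (f x) ^+ 2)%:E).
Proof.
move=> [mf fin]; apply/integrableP; split.
  by apply/measurable_EFinP; exact: meas_normc2.
under eq_integral do rewrite abse_EFin ger0_norm ?sqr_ge0//.
exact: fin.
Qed.

Lemma L2sq_ge0 f : 0 <= L2sq f.
Proof. by apply: Rintegral_ge0 => x _; exact: sqr_ge0. Qed.

Lemma L2sqE f : L2 mu f -> (\int[mu]_x (normc (f x) ^+ 2)%:E)%E = (L2sq f)%:E.
Proof. by move=> /L2_sq_int lf; rewrite /L2sq /Rintegral fineK//; exact: integrable_fin_num. Qed.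

Lemma L2_le f (k : T -> R) : cmeas f -> mu.-integrable setT (EFin \o k) ->
  (forall x, normc (f x) ^+ 2 <= k x) -> L2 mu f.
Proof.
move=> mf ik fk; split => //.
have mk : measurable_fun setT k by move/measurable_int : ik => /measurable_EFinP.
apply: le_lt_trans (integrableP _ _ _ ik).2 => /=.
apply: ge0_le_integral => //=.
- by move=> x _; rewrite lee_fin sqr_ge0.
- by apply/measurable_EFinP; exact: meas_normc2.
- by apply/measurable_EFinP; exact: measurableT_comp.
- by move=> x _; rewrite lee_fin; exact: le_trans (fk x) (ler_norm _).
Qed.

Lemma L2D f g : L2 mu f -> L2 mu g -> L2 mu (fun x => f x + g x).
Proof.
move=> lf lg.
apply: (@L2_le _ (fun x => 2 * normc (f x) ^+ 2 + 2 * normc (g x) ^+ 2)).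
- by apply: cmeasD; [case: lf|case: lg].
- apply: eq_integrable (integrableD measurableT
    (integrableZl measurableT 2 (L2_sq_int lf)) (integrableZl measurableT 2 (L2_sq_int lg))) => //.
- by move=> x; exact: normc_sqrD.
Qed.

Lemma L2M f (b : T -> R[i]) (M : R) : L2 mu f -> cmeas b -> (forall x, normc (b x) <= M) ->
  L2 mu (fun x => f x * b x).
Proof.
move=> lf mb bM; apply: (@L2_le _ (fun x => M ^+ 2 * normc (f x) ^+ 2)).
- by apply: cmeasM => //; case: lf.
- by apply: eq_integrable (integrableZl measurableT (M ^+ 2) (L2_sq_int lf)).
- move=> x; rewrite normcM exprMn mulrC ler_wpM2r ?sqr_ge0//.
  by rewrite lerXn2r ?nnegrE ?normc_ge0// (le_trans (normc_ge0 (b x))).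
Qed.

Lemma L2Zl z f : L2 mu f -> L2 mu (fun x => z * f x).
Proof.
move=> lf; under eq_fun do rewrite mulrC.
exact: (L2M lf (cmeas_cst _ z) (fun=> lexx (normc z))).
Qed.

Lemma L2N f : L2 mu f -> L2 mu (fun x => - f x).
Proof. by move=> lf; under eq_fun do rewrite -mulN1r; exact: L2Zl. Qed.

Lemma L2B f g : L2 mu f -> L2 mu g -> L2 mu (fun x => f x - g x).
Proof. by move=> lf lg; apply: L2D => //; exact: L2N. Qed.

Lemma L2_eq_normc f g : cmeas f -> L2 mu g -> (forall x, normc (f x) = normc (g x)) -> L2 mu f.
Proof.
move=> mf [_ fin] fg; split => //.
by under eq_integral do rewrite fg; exact: fin.
Qed.

Lemma L2_conj f : L2 mu f -> L2 mu (fun x => conjc (f x)).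
Proof.
move=> lf; apply: (L2_eq_normc (cmeas_conj (L2_meas lf)) lf) => x; exact: normc_conj.
Qed.

Lemma L2_mul f g : L2 mu f -> L2 mu g -> L1 mu (fun x => f x * g x).
Proof.
move=> lf lg.
apply: (@L1_le _ _ _ _ _ (fun x => 2^-1 * (normc (f x) ^+ 2 + normc (g x) ^+ 2))).
- by apply: cmeasM; [case: lf|case: lg].
- by apply: eq_integrable (integrableZl measurableT 2^-1 (integrableD measurableT (L2_sq_int lf) (L2_sq_int lg))).
- by move=> x; rewrite normcM; exact: normc_mul_le.
Qed.

Lemma L2_mulc f g : L2 mu f -> L2 mu g -> L1 mu (fun x => f x * conjc (g x)).
Proof. by move=> lf lg; apply: L2_mul => //; exact: L2_conj. Qed.

Lemma cdotC f g : L2 mu f -> L2 mu g -> cdot g f = conjc (cdot f g).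
Proof.
move=> lf lg; rewrite /cdot -cint_conj; last exact: L2_mulc.
by apply: eq_cint => x; rewrite rmorphM/= conjcK mulrC.
Qed.

Lemma cdotDl f g h : L2 mu f -> L2 mu g -> L2 mu h ->
  cdot (fun x => f x + g x) h = cdot f h + cdot g h.
Proof.
move=> lf lg lh; rewrite /cdot -cintD; [|exact: L2_mulc|exact: L2_mulc].
by apply: eq_cint => x; rewrite mulrDl.
Qed.

Lemma cdotZl z f g : L2 mu f -> L2 mu g ->
  cdot (fun x => z * f x) g = z * cdot f g.
Proof.
move=> lf lg; rewrite /cdot -cintZl; last exact: L2_mulc.
by apply: eq_cint => x; rewrite mulrA.
Qed.

Lemma cdotDr f g h : L2 mu f -> L2 mu g -> L2 mu h ->
  cdot f (fun x => g x + h x) = cdot f g + cdot f h.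
Proof.
move=> lf lg lh; rewrite /cdot -cintD; [|exact: L2_mulc|exact: L2_mulc].
by apply: eq_cint => x; rewrite rmorphD mulrDr.
Qed.

Lemma cdotZr z f g : L2 mu f -> L2 mu g ->
  cdot f (fun x => z * g x) = conjc z * cdot f g.
Proof.
move=> lf lg; rewrite /cdot -cintZl; last exact: L2_mulc.
by apply: eq_cint => x; rewrite rmorphM/= mulrCA.
Qed.

Lemma cdotBl f g h : L2 mu f -> L2 mu g -> L2 mu h ->
  cdot (fun x => f x - g x) h = cdot f h - cdot g h.
Proof.
move=> lf lg lh; rewrite cdotDl//; last exact: L2N.
congr (_ + _); under [X in cdot X _]eq_fun do rewrite -mulN1r.
by rewrite cdotZl// mulN1r.
Qed.

Lemma cdotff f : cdot f f = (L2sq f)%:C.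
Proof. by rewrite /cdot -cint_real; apply: eq_cint => x; rewrite mul_conjc. Qed.

Lemma L2sqZ z f : L2 mu f -> L2sq (fun x => z * f x) = normc z ^+ 2 * L2sq f.
Proof.
move=> lf; apply: complexI; rewrite -cdotff cdotZl ?cdotZr//; last exact: L2Zl.
by rewrite mulrA mul_conjc cdotff -rmorphM.
Qed.

Lemma L2sqD f g : L2 mu f -> L2 mu g ->
  L2sq (fun x => f x + g x) = L2sq f + L2sq g + 2 * complex.Re (cdot f g).
Proof.
move=> lf lg; have lfg := L2D lf lg.
apply: complexI; rewrite -cdotff cdotDl// !cdotDr// !cdotff (@cdotC f g)//.
by case: (cdot f g) => a b; simpc; congr (_ +i* _) => /=; ring.
Qed.

Lemma L2sqN f : L2sq (fun x => - f x) = L2sq f.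
Proof. by apply: eq_Rintegral => x _; rewrite normcN. Qed.

Lemma L2sqC f g : L2sq (fun x => f x - g x) = L2sq (fun x => g x - f x).
Proof. by apply: eq_Rintegral => x _; rewrite normcC. Qed.

Lemma L2sqB f g : L2 mu f -> L2 mu g ->
  L2sq (fun x => f x - g x) = L2sq f + L2sq g - 2 * complex.Re (cdot f g).
Proof.
move=> lf lg; rewrite L2sqD//; last exact: L2N.
rewrite L2sqN; under [X in cdot _ X]eq_fun do rewrite -mulN1r.
rewrite cdotZr// rmorphN rmorph1 mulN1r cReN mulrN; ring.
Qed.

Lemma parallelogram f g : L2 mu f -> L2 mu g ->
  L2sq (fun x => f x + g x) + L2sq (fun x => f x - g x) = 2 * L2sq f + 2 * L2sq g.
Proof. by move=> lf lg; rewrite L2sqD// L2sqB//; ring. Qed.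

Lemma L2sqD_le f g : L2 mu f -> L2 mu g ->
  L2sq (fun x => f x + g x) <= 2 * L2sq f + 2 * L2sq g.
Proof. by move=> lf lg; rewrite -parallelogram// lerDl L2sq_ge0. Qed.

(** Cauchy-Schwarz from expanding the square of [|g|^2 f - <f,g> g]. *)
Lemma cauchy_schwarz f g : L2 mu f -> L2 mu g ->
  normc (cdot f g) ^+ 2 <= L2sq f * L2sq g.
Proof.
move=> lf lg; set z := cdot f g.
have H (s t : R) : 0 <= s ^+ 2 * L2sq f + t ^+ 2 * normc z ^+ 2 * L2sq g - 2 * s * t * normc z ^+ 2.
  have := L2sq_ge0 (fun x => s%:C * f x - (t%:C * z) * g x).
  rewrite L2sqB ?L2sqZ ?cdotZl ?cdotZr//; try exact: L2Zl.
  rewrite -/z !normcM !normc_real !exprMn !real_normK ?num_real// rmorphM/=.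
  suff -> : 2 * complex.Re (s%:C * ((t -i* 0) * conjc z * z)) = 2 * s * t * normc z ^+ 2 by [].
  by rewrite normc_sqr; case: z => a b; simpc => /=; ring.
have g0 := L2sq_ge0 g; have f0 := L2sq_ge0 f; have z0 := sqr_ge0 (normc z).
(* When [|g| = 0] the bound is linear in [t], which is impossible for large [t] unless [<f,g> = 0].
   *)
have [gz|gz] := eqVneq (L2sq g) 0.
  have [->|nz] := eqVneq (normc z ^+ 2) 0; first by rewrite gz mulr0.
  have := H 1 ((L2sq f + 1) / normc z ^+ 2); rewrite gz !mulr0 addr0 mulr1.
  by rewrite expr1n mul1r -mulrA divfK//; lra.
have gp : 0 < L2sq g by rewrite lt_neqAle eq_sym gz.
rewrite -(ler_pM2l gp); have := H (L2sq g) 1; rewrite expr1n mul1r mulr1; nra.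
Qed.

Lemma polar_re f g : L2 mu f -> L2 mu g ->
  complex.Re (cdot f g) = 2^-1 * (L2sq (fun x => f x + g x) - L2sq f - L2sq g).
Proof. by move=> lf lg; rewrite L2sqD//; field. Qed.

Lemma polar_im f g : L2 mu f -> L2 mu g ->
  complex.Im (cdot f g) = 2^-1 * (L2sq (fun x => f x + 'i * g x) - L2sq f - L2sq g).
Proof.
move=> lf lg; have := polar_re lf (L2Zl 'i lg).
rewrite cdotZr// L2sqZ//= expr0n expr1n add0r sqrtr1 expr1n mul1r => <-.
by case: (cdot f g) => a b; simpc.
Qed.

(** Fatou for an almost everywhere limit: it bounds the limit by the common bound of the
    approximants, without knowing that the limit is integrable. *)
Lemma fatou_bound (k_ : nat -> T -> R) (k : T -> R) (C : \bar R) :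
  (forall j, measurable_fun setT (k_ j)) -> measurable_fun setT k ->
  (forall j x, 0 <= k_ j x) -> (forall x, 0 <= k x) ->
  {ae mu, forall x, k_ j x @[j --> \oo] --> k x} ->
  (forall j, (\int[mu]_x (k_ j x)%:E <= C)%E) ->
  (\int[mu]_x (k x)%:E <= C)%E.
Proof.
move=> mk_ mk k_0 k0 kc kC.
have mE j : measurable_fun setT (fun x => (k_ j x)%:E) by exact/measurable_EFinP.
apply: (@le_trans _ _ (\int[mu]_x limn_einf (fun j => (k_ j x)%:E))%E); last first.
  apply: le_trans (fatou mu measurableT mE _) _; first by move=> j x _; rewrite lee_fin.
  rewrite limn_einf_lim; apply: lime_le; first exact: is_cvg_einfs.
  apply: nearW => j; apply: le_trans (kC j).
  by apply: ereal_inf_lbound; exists j => //=.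
apply: ae_ge0_le_integral => //.
- by move=> x _; rewrite lee_fin.
- exact/measurable_EFinP.
- move=> x _; rewrite limn_einf_lim; apply: lime_ge; first exact: is_cvg_einfs.
  by apply: nearW => j; apply: le_ereal_inf_tmp => _ [i _ <-]; rewrite lee_fin.
- rewrite (_ : (fun x => _) = (fun x => - limn_esup (fun j => - (k_ j x)%:E))%E); last first.
    by apply/funext => x; rewrite -[RHS]/(- limn_esup (-%E \o (fun j => (k_ j x)%:E)))%E limn_esupN oppeK.
  apply: measurableT_comp => //; apply: measurable_fun_limn_esup => j.
  exact: measurableT_comp.
- apply: filterS kc => x kx _.
  have H : (k_ j x)%:E @[j --> \oo] --> (k x)%:E by apply: cvg_EFin => //; exact: nearW.
  by rewrite is_cvg_limn_einfE; [rewrite (cvg_lim _ H)|apply/cvg_ex; exists (k x)%:E].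
Qed.

End L2_theory.

Lemma cvgn_eq (R : realType) (u : nat -> R) (a b : R) :
  a = b -> u @ \oo --> a -> u @ \oo --> b.
Proof. by move=> ->. Qed.

Section L2_limits.
Context (R : realType) d (T : measurableType d).
Variable mu : {measure set T -> \bar R}.
Implicit Types (f g h : T -> R[i]).
Local Notation cmeas := (cmeasurable_fun setT).
Local Notation cint := (cintegral mu setT).
Local Notation L2sq := (L2sq mu).
Local Notation cdot := (cdot mu).

Lemma L2_cvgP (f_ : nat -> T -> R[i]) f : (forall k, L2 mu (f_ k)) -> L2 mu f ->
  L2_cvg mu f_ f <-> L2sq (fun x => f_ k x - f x) @[k --> \oo] --> 0.
Proof.
move=> lf_ lf.
have E : (fun k => (\int[mu]_x (normc (f_ k x - f x) ^+ 2)%:E)%E) =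
   EFin \o (fun k => L2sq (fun x => f_ k x - f x)).
  by apply/funext => k /=; rewrite -L2sqE//; exact: L2B.
rewrite /L2_cvg E; split => [H|H]; first exact: (fine_cvg H).
by apply: cvg_EFin => //; exact: nearW.
Qed.

Lemma cdot_cvgl (f_ : nat -> T -> R[i]) f g : (forall k, L2 mu (f_ k)) -> L2 mu f ->
  L2 mu g -> L2sq (fun x => f_ k x - f x) @[k --> \oo] --> 0 ->
  normc (cdot (f_ k) g - cdot f g) @[k --> \oo] --> 0.
Proof.
move=> lf_ lf lg fc.
apply: (@squeeze_cvgr _ _ _ _ (fun=> 0) (fun k => Num.sqrt (L2sq (fun x => f_ k x - f x) * L2sq g))).
- near=> k; rewrite normc_ge0 -cdotBl//=.
  rewrite -[leLHS]ger0_norm ?normc_ge0// -sqrtr_sqr ler_wsqrtr//.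
  by apply: cauchy_schwarz => //; exact: L2B.
- exact: cvg_cst.
- rewrite -(sqrtr0 R) -(mul0r (L2sq g)); apply: continuous_cvg; first exact: sqrt_continuous.
  by apply: cvgM => //; exact: cvg_cst.
Unshelve. all: by end_near. Qed.

Lemma normc_cvg_Re (z_ : nat -> R[i]) z : normc (z_ k - z) @[k --> \oo] --> 0 ->
  complex.Re (z_ k) @[k --> \oo] --> complex.Re z.
Proof.
move=> zc; apply/subr_cvg0/norm_cvg0P => /=.
apply: (@squeeze_cvgr _ _ _ _ (fun=> 0) (fun k => normc (z_ k - z))) => //; last exact: cvg_cst.
near=> k; rewrite normr_ge0/=.
by apply: le_trans (le_Re_normc _); rewrite cReD cReN.
Unshelve. all: by end_near. Qed.

(** Writing [|f_k|^2] through [<f_k, f>] and [|f_k - f|^2] reduces continuity of the norm to that of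
    the inner product. *)
Lemma L2sq_cvg (f_ : nat -> T -> R[i]) f : (forall k, L2 mu (f_ k)) -> L2 mu f ->
  L2sq (fun x => f_ k x - f x) @[k --> \oo] --> 0 ->
  L2sq (f_ k) @[k --> \oo] --> L2sq f.
Proof.
move=> lf_ lf fc.
have E k : L2sq (f_ k) = 2 * complex.Re (cdot (f_ k) f) - L2sq f + L2sq (fun x => f_ k x - f x).
  by rewrite L2sqB//; ring.
under eq_fun do rewrite E.
apply: (@cvgn_eq _ _ (2 * complex.Re (cdot f f) - L2sq f + 0)).
  by rewrite cdotff/=; ring.
apply: cvgD => //; apply: cvgB; last exact: cvg_cst.
by apply: cvgM; [exact: cvg_cst|apply: normc_cvg_Re; exact: cdot_cvgl].
Qed.

Lemma L2sq_eq0_ae f : L2 mu f -> L2sq f = 0 -> {ae mu, forall x, f x = 0}.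
Proof.
move=> lf f0.
have H : (\int[mu]_x `|(normc (f x) ^+ 2)%:E| = 0)%E.
  under eq_integral do rewrite abse_EFin ger0_norm ?sqr_ge0//.
  by rewrite L2sqE// f0.
have mf : measurable_fun setT (fun x => (normc (f x) ^+ 2)%:E).
  by apply/measurable_EFinP; apply: meas_normc2; case: lf.
move/(ae_eq_integral_abs mu measurableT mf) : H; apply: filterS => x /(_ I)[] /eqP.
by rewrite sqrf_eq0 normc_eq0 => /eqP.
Qed.

(** Two limits are at distance 0 by the triangle inequality, hence equal almost everywhere. *)
Lemma L2_cvg_unique (f_ : nat -> T -> R[i]) f g : (forall k, L2 mu (f_ k)) ->
  L2 mu f -> L2 mu g -> L2_cvg mu f_ f -> L2_cvg mu f_ g ->
  {ae mu, forall x, f x = g x}.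
Proof.
move=> lf_ lf lg /(L2_cvgP lf_ lf) cf /(L2_cvgP lf_ lg) cg.
have lB := L2B lf lg.
suff : L2sq (fun x => f x - g x) = 0.
  by move=> /(L2sq_eq0_ae lB); apply: filterS => x /eqP; rewrite subr_eq0 => /eqP.
apply/eqP; rewrite eq_le L2sq_ge0 andbT.
have C : (fun k => 2 * L2sq (fun x => f_ k x - f x) + 2 * L2sq (fun x => f_ k x - g x)) @ \oo --> (0 : R).
  apply: (@cvgn_eq _ _ (2 * 0 + 2 * 0)); first by rewrite !mulr0 addr0.
  by apply: cvgD; (apply: cvgM => //; exact: cvg_cst).
apply: (cvgr_to_ge C).
apply: nearW => k; rewrite [X in _ <= 2 * X + _]L2sqC.
have := @L2sqD_le _ _ _ mu _ _ (L2B lf (lf_ k)) (L2B (lf_ k) lg).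
by rewrite (_ : (fun x => _) = (fun x => f x - g x))//; apply/funext => x; rewrite addrA subrK.
Qed.

(** Restricting [f] to [|f| >= 1/(k+1)] makes it integrable: there [|f| <= (k+1) |f|^2]. *)
Definition trunc f (k : nat) : T -> R[i] :=
  fun x => if k.+1%:R^-1 <= normc (f x) then f x else 0.

Lemma normc_trunc f k x : normc (trunc f k x) <= normc (f x).
Proof. by rewrite /trunc; case: ifP => // _; rewrite normc0 normc_ge0. Qed.

Lemma cmeas_if (b : T -> bool) f g : measurable_fun setT b -> cmeas f -> cmeas g ->
  cmeas (fun x => if b x then f x else g x).
Proof.
move=> mb [f1 f2] [g1 g2]; split.
  rewrite (_ : (fun x => _) = fun x => if b x then complex.Re (f x) else complex.Re (g x)).
    exact: measurable_fun_ifT.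
  by apply/funext => x; case: ifP.
rewrite (_ : (fun x => _) = fun x => if b x then complex.Im (f x) else complex.Im (g x)).
  exact: measurable_fun_ifT.
by apply/funext => x; case: ifP.
Qed.

Lemma cmeas_trunc f k : cmeas f -> cmeas (trunc f k).
Proof.
move=> mf; apply: (cmeas_if _ mf (cmeas_cst _ 0)).
by apply: measurable_fun_ler => //; exact: meas_normc.
Qed.

Lemma L2_trunc f k : L2 mu f -> L2 mu (trunc f k).
Proof.
move=> lf; apply: (L2_le _ (L2_sq_int lf)); first by apply: cmeas_trunc; case: lf.
by move=> x; rewrite lerXn2r ?nnegrE ?normc_ge0// normc_trunc.
Qed.

Lemma L1_trunc f k : L2 mu f -> L1 mu (trunc f k).
Proof.
move=> lf; apply: (@L1_le _ _ _ _ _ (fun x => k.+1%:R * normc (f x) ^+ 2)).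
- by apply: cmeas_trunc; case: lf.
- by apply: eq_integrable (integrableZl measurableT k.+1%:R (L2_sq_int lf)).
move=> x; rewrite /trunc; case: ifP => h; last by rewrite normc0; apply: mulr_ge0 => //; exact: sqr_ge0.
rewrite expr2 mulrA ler_peMl ?normc_ge0//.
by rewrite -ler_pdivrMl// mulr1.
Qed.

Lemma trunc_near f x : \forall k \near \oo, trunc f k x = f x.
Proof.
have [f0|fx0] := eqVneq (f x) 0.
  by apply: nearW => k; rewrite /trunc f0; case: ifP.
have p : 0 < normc (f x) by rewrite lt_neqAle normc_ge0 andbT eq_sym normc_eq0.
near=> k; rewrite /trunc ifT//; near: k.
have := near_infty_natSinv_lt (PosNum p).
by apply: filterS => j /= /ltW.
Unshelve. all: by end_near. Qed.

Lemma trunc_cvg f : L2 mu f -> L2sq (fun x => trunc f k x - f x) @[k --> \oo] --> 0.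
Proof.
move=> lf; apply: fine_cvg.
apply: (Rdct0 _ _ (L2_sq_int lf)).
- move=> k; apply: meas_normc2; apply: cmeasB; last by case: lf.
  by apply: cmeas_trunc; case: lf.
- by move=> *; exact: sqr_ge0.
- apply: aeW => x k; rewrite /trunc; case: ifP => _.
    by rewrite subrr normc0 expr0n sqr_ge0.
  by rewrite sub0r normcN.
- apply: aeW => x; apply: cvg_near_cst.
  by apply: filterS (trunc_near f x) => k ->; rewrite subrr normc0 expr0n.
Qed.

End L2_limits.

(** * Completeness of L2 and the Riesz representation theorem *)

Lemma ler_normc_dist (R : realType) (z w : R[i]) : `|normc z - normc w| <= normc (z - w).
Proof.
rewrite ler_norml; apply/andP; split.
  rewrite lerNl opprB lerBlDr normcC.
  by apply: le_trans (ler_normcD _ _); rewrite subrK.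
by rewrite lerBlDr; apply: le_trans (ler_normcD _ _); rewrite subrK.
Qed.

Lemma normc_cvg (R : realType) (z_ : nat -> R[i]) z :
  normc (z_ k - z) @[k --> \oo] --> 0 -> normc (z_ k) @[k --> \oo] --> normc z.
Proof.
move=> zc; apply/subr_cvg0/norm_cvg0P.
apply: (@squeeze_cvgr _ _ _ _ (fun=> 0) (fun k => normc (z_ k - z))) => //; last exact: cvg_cst.
by apply: nearW => k; rewrite normr_ge0 ler_normc_dist.
Qed.

Lemma normc_cvg2 (R : realType) (z_ : nat -> R[i]) z :
  normc (z_ k - z) @[k --> \oo] --> 0 ->
  normc (z_ k) ^+ 2 @[k --> \oo] --> normc z ^+ 2.
Proof.
move=> /normc_cvg zc; rewrite expr2; under eq_fun do rewrite expr2.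
exact: cvgM.
Qed.

Section L2_complete.
Context (R : realType) d (T : measurableType d).
Variable mu : {measure set T -> \bar R}.
Implicit Types (f g h : T -> R[i]).
Local Notation cmeas := (cmeasurable_fun setT).
Local Notation L2sq := (L2sq mu).
Local Notation cdot := (cdot mu).

Lemma sum_half_le (m : nat) : \sum_(k < m) (2^-1 : R) ^+ k <= 2.
Proof.
have -> : \sum_(k < m) (2^-1 : R) ^+ k = 2 - 2 * 2^-1 ^+ m.
  elim: m => [|m IH]; first by rewrite big_ord0 expr0; ring.
  by rewrite big_ord_recr /= IH exprS; field.
by rewrite lerBlDr lerDl mulr_ge0// exprn_ge0.
Qed.

Lemma cvg_geometric_steps (u : nat -> R) (C : R) :
  (forall k, `|u k.+1 - u k| <= C * 2^-1 ^+ k) -> cvgn u.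
Proof.
move=> H.
have C0 : 0 <= C by have := le_trans (normr_ge0 _) (H 0%N); rewrite expr0 mulr1.
have -> : u = (fun n => u 0%N + series (telescope u) n).
  by apply/funext => n; rewrite -eq_sum_telescope.
apply: is_cvgD; first exact: is_cvg_cst.
apply: (@normed_cvg R R^o).
apply: (@series_le_cvg _ _ (geometric C 2^-1)) => [n|n|n|]; rewrite /geometric /=.
- exact: normr_ge0.
- by rewrite mulr_ge0// exprn_ge0.
- exact: H.
- apply: is_cvg_geometric_series; rewrite ger0_norm ?invr_ge0//.
  by rewrite invf_lt1// ltr1n.
Qed.

(** The weighted sum of the [4^k |g_(k+1) - g_k|^2] has finite integral, so it is finite almost
    everywhere; at such points the steps are at most a constant times [2^-k] and the sequence
    converges. Taking limsup of the real and imaginary parts makes the limit measurable everywhere.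
    *)
Lemma fast_cauchy_cvg (g : nat -> T -> R[i]) :
  (forall k, L2 mu (g k)) ->
  (forall k, L2sq (fun x => g k.+1 x - g k x) <= (8^-1) ^+ k) ->
  exists2 f, cmeas f & {ae mu, forall x, normc (g k x - f x) @[k --> \oo] --> 0}.
Proof.
move=> lg gd.
pose dd k x := 4 ^+ k * normc (g k.+1 x - g k x) ^+ 2.
have lB k : L2 mu (fun x => g k.+1 x - g k x) by exact: L2B.
have md k : measurable_fun setT (fun x => (dd k x)%:E).
  apply/measurable_EFinP; apply: measurable_funM => //.
  by apply: meas_normc2; case: (lB k).
have d0 k x : (0 <= (dd k x)%:E)%E.
  by rewrite lee_fin; apply: mulr_ge0; [exact: exprn_ge0|exact: sqr_ge0].
pose E x := (\sum_(k <oo) (dd k x)%:E)%E.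
have E0 x : (0 <= E x)%E by apply: nneseries_ge0 => k _ _; exact: d0.
have mE : measurable_fun setT E.
  by apply: ge0_emeasurable_sum => [k x _ _|k _]; [exact: d0|exact: md].
have IE : (\int[mu]_x E x <= 2%:E)%E.
  rewrite integral_nneseries//.
  apply: lime_le; first by apply: is_cvg_nneseries => k _ _; exact: integral_ge0.
  apply: nearW => m.
  have -> : (\sum_(0 <= k < m) \int[mu]_x (dd k x)%:E =
      \sum_(0 <= k < m) (4 ^+ k * L2sq (fun x => g k.+1 x - g k x))%:E)%E.
    apply: eq_bigr => k _; under eq_integral do rewrite EFinM.
    rewrite ge0_integralZl_EFin ?L2sqE//.
    - by move=> x _; rewrite lee_fin sqr_ge0.
    - by apply/measurable_EFinP; apply: meas_normc2; case: (lB k).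
  rewrite sumEFin lee_fin big_mkord; apply: le_trans (sum_half_le m).
  apply: ler_sum => k _.
  apply: (@le_trans _ _ (4 ^+ k * 8^-1 ^+ k)).
    by rewrite ler_wpM2l ?exprn_ge0.
  rewrite -exprMn (_ : 4 * 8^-1 = 2^-1)//; by field.
have iE : mu.-integrable setT E.
  apply/integrableP; split => //.
  under eq_integral do rewrite gee0_abs//.
  by apply: le_lt_trans IE _; rewrite ltry.
have steps x : E x \is a fin_num -> exists C : R, forall k,
    normc (g k.+1 x - g k x) <= C * 2^-1 ^+ k.
  move=> Ef; exists (Num.sqrt (fine (E x))) => k.
  have H : dd k x <= fine (E x).
    rewrite -lee_fin fineK//.
    apply: le_trans (nneseries_lim_ge k.+1 _) => //.
    by rewrite big_mkord big_ord_recr /= leeDr// sume_ge0.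
  rewrite -[leLHS]ger0_norm ?normc_ge0// -sqrtr_sqr.
  rewrite -[X in _ * X]ger0_norm ?exprn_ge0// -(sqrtr_sqr (2^-1 ^+ k)) -sqrtrM ?fine_ge0//.
  rewrite ler_wsqrtr//.
  rewrite -exprM mulnC exprM -ler_pdivrMr ?exprn_gt0//.
  apply: le_trans H; rewrite /d mulrC ler_wpM2r ?sqr_ge0//.
  by rewrite -exprVn (_ : ((2^-1 ^+ 2)^-1 : R) = 4)//; field.
pose fr x := fine (limn_esup (fun k => (complex.Re (g k x))%:E)).
pose fi x := fine (limn_esup (fun k => (complex.Im (g k x))%:E)).
have lim_of (u : nat -> R) : cvgn u -> u @ \oo --> fine (limn_esup (fun k => (u k)%:E)).
  move=> cu; have H : (u k)%:E @[k --> \oo] --> (limn u)%:E.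
    by apply: cvg_EFin => //; exact: nearW.
  by have [_ ->] := cvg_limn_einf_sup H.
exists (fun x => fr x +i* fi x).
  split => /=; apply: (measurableT_comp (fine_measurable measurableT));
    apply: measurable_fun_limn_esup => k; apply/measurable_EFinP; by case: (lg k) => -[].
have := integrable_ae measurableT iE; apply: filterS => x /(_ I) /steps[C HC].
have cr : complex.Re (g k x) @[k --> \oo] --> fr x.
  apply: lim_of; apply: (@cvg_geometric_steps _ C) => k.
  by apply: le_trans (HC k); rewrite -cReN -cReD; exact: le_Re_normc.
have ci : complex.Im (g k x) @[k --> \oo] --> fi x.
  apply: lim_of; apply: (@cvg_geometric_steps _ C) => k.
  by apply: le_trans (HC k); rewrite -cImN -cImD; exact: le_Im_normc.
apply: (@squeeze_cvgr _ _ _ _ (fun=> 0)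
  (fun k => `|complex.Re (g k x) - fr x| + `|complex.Im (g k x) - fi x|)).
- near=> k; rewrite normc_ge0/=; apply: le_trans (normc_le_ReIm _) _.
  by rewrite !(cReD, cImD, cReN, cImN).
- exact: cvg_cst.
- apply: (@cvgn_eq _ _ (0 + 0)); first by rewrite addr0.
  by apply: cvgD; apply/norm_cvg0P/subr_cvg0.
Unshelve. all: by end_near. Qed.

(** Riesz-Fischer: a subsequence with geometric steps has an almost everywhere limit, and Fatou
    bounds the distance of the whole sequence to it. *)
Lemma L2_complete (f_ : nat -> T -> R[i]) : (forall k, L2 mu (f_ k)) ->
  (forall e : R, 0 < e -> exists N, forall i j, (N <= i)%N -> (N <= j)%N ->
     L2sq (fun x => f_ i x - f_ j x) <= e) ->
  exists2 f, L2 mu f & L2sq (fun x => f_ k x - f x) @[k --> \oo] --> 0.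
Proof.
move=> lf_ cau.
have /choice[N HN] : forall k : nat, exists N, forall i j, (N <= i)%N -> (N <= j)%N ->
     L2sq (fun x => f_ i x - f_ j x) <= (8^-1) ^+ k.
  by move=> k; apply: cau; rewrite exprn_gt0.
(* Partial sums of the thresholds: the index increases strictly and exceeds every threshold so far.
   *)
pose nn k := (\sum_(i < k.+1) (N i).+1)%N.
have nnE k : nn k.+1 = (nn k + (N k.+1).+1)%N by rewrite /nn big_ord_recr.
have nn1 k : (N k <= nn k)%N by rewrite /nn big_ord_recr/= (leq_trans (leqnSn _))// leq_addl.
have nnS k : (N k <= nn k.+1)%N by rewrite nnE; have := nn1 k; lia.
have nnk k : (k <= nn k)%N by elim: k => // k IH; rewrite nnE; lia.
have [||f mf fc] := @fast_cauchy_cvg (fun k => f_ (nn k)) => //.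
  by move=> k; apply: HN.
have H e : 0 < e -> exists M, forall j, (M <= j)%N ->
    (\int[mu]_x (normc (f_ j x - f x) ^+ 2)%:E <= e%:E)%E.
  move=> /cau[M HM]; exists M => j Mj.
  apply: (@fatou_bound _ _ _ mu (fun i x => normc (f_ j x - f_ (nn (i + M)%N) x) ^+ 2)).
  - by move=> i; apply: meas_normc2; apply: cmeasB; exact: L2_meas.
  - by apply: meas_normc2; apply: cmeasB => //; exact: L2_meas.
  - by move=> *; exact: sqr_ge0.
  - by move=> *; exact: sqr_ge0.
  - apply: filterS fc => x fx.
    have {}fx : normc (f_ (nn (i + M)%N) x - f x) @[i --> \oo] --> 0.
      by move: fx; rewrite -(cvg_shiftn M).
    apply: normc_cvg2.
    have E i : f_ j x - f_ (nn (i + M)%N) x - (f_ j x - f x) = - (f_ (nn (i + M)%N) x - f x).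
      by ring.
    by under eq_fun do rewrite E normcN.
  - move=> i; rewrite L2sqE; last exact: L2B.
    by rewrite lee_fin; apply: HM => //; apply: leq_trans (nnk _); rewrite leq_addl.
have lf : L2 mu f.
  have [M /(_ M (leqnn _)) HM] := H 1 ltr01.
  have lB : L2 mu (fun x => f_ M x - f x).
    by split; [apply: cmeasB => //; exact: L2_meas|apply: le_lt_trans HM _; rewrite ltry].
  have -> : f = (fun x => f_ M x - (f_ M x - f x)) by apply/funext => x; ring.
  exact: L2B.
exists f => //.
apply/cvgrPdist_le => e e0; have [M HM] := H e e0.
exists M => // j /= Mj; have := HM j Mj.
by rewrite L2sqE ?lee_fin ?sub0r ?normrN ?ger0_norm ?L2sq_ge0//; exact: L2B.
Unshelve. all: by end_near. Qed.

End L2_complete.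

Section riesz.
Context (R : realType) d (T : measurableType d).
Variable mu : {measure set T -> \bar R}.
Implicit Types (f g h : T -> R[i]).
Local Notation L2sq := (L2sq mu).
Local Notation cdot := (cdot mu).

(** Variational proof: by the parallelogram identity a minimizing sequence of [|h|^2 - 2 Re (ell h)]
    is Cauchy, and the first variation at the limit [f] vanishes, which says [Re <f, h> = Re (ell
    h)]. Applying this to [i h] gives the imaginary part. *)
Lemma riesz_representation (ell : (T -> R[i]) -> R[i]) (K : R) :
  (forall f g, L2 mu f -> L2 mu g -> ell (fun x => f x + g x) = ell f + ell g) ->
  (forall z f, L2 mu f -> ell (fun x => z * f x) = conjc z * ell f) ->
  (forall f, L2 mu f -> normc (ell f) ^+ 2 <= K * L2sq f) ->
  exists2 f, L2 mu f & forall h, L2 mu h -> ell h = cdot f h.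
Proof.
move=> ellD ellZ ellK.
pose J h := L2sq h - 2 * complex.Re (ell h).
have JK h : L2 mu h -> - `|K| <= J h.
  move=> lh; have H := ellK _ lh; rewrite /J.
  have h0 := L2sq_ge0 mu h; have k0 := normr_ge0 K; have kK := ler_norm K.
  have : complex.Re (ell h) ^+ 2 <= `|K| * L2sq h.
    apply: (@le_trans _ _ (normc (ell h) ^+ 2)).
      by rewrite normc_sqr lerDl sqr_ge0.
    by apply: le_trans H _; rewrite ler_wpM2r.
  set r := complex.Re _; move=> {}H.
  have : (2 * r) ^+ 2 <= (`|K| + L2sq h) ^+ 2 by have := sqr_ge0 (`|K| - L2sq h); nra.
  move=> {}H; move: H; set A := `|K| + L2sq h => H; have A0 : 0 <= A by rewrite addr_ge0.
  suff : 2 * r <= A by rewrite /A; lra.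
  by rewrite leNgt; apply/negP => lt; nra.
pose S := [set J h | h in L2 mu].
have S0 : S !=set0.
  exists (J (fun=> 0)), (fun=> 0) => //; split; first exact: cmeas_cst.
  under eq_integral do rewrite normc0 expr0n/=.
  by rewrite integral0 ltry.
have Slb : has_lbound S by exists (- `|K|) => _ [h lh <-]; exact: JK.
have Sinf : has_inf S by split.
pose m := inf S.
have mJ h : L2 mu h -> m <= J h by move=> lh; apply: ge_inf => //; exists h.
have /choice[h_ Hh_] : forall k : nat, exists h, L2 mu h /\ J h < m + k.+1%:R^-1.
  move=> k; have [|_ [h lh <-] hm] := @inf_adherent _ S k.+1%:R^-1 _ Sinf.
    by rewrite invr_gt0.
  by exists h.
clearbody m.
have lh_ k : L2 mu (h_ k) by case: (Hh_ k).
have Jh_ k : J (h_ k) < m + k.+1%:R^-1 by case: (Hh_ k).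
(* Comparing [J] at the midpoint with its infimum. *)
have mid f g : L2 mu f -> L2 mu g ->
    L2sq (fun x => f x - g x) <= 2 * (J f + J g - 2 * m).
  move=> lf lg; have lfg := L2D lf lg.
  have := mJ _ (L2Zl (2^-1)%:C lfg).
  rewrite /J L2sqZ// ellZ// ellD// normc_real ger0_norm ?invr_ge0//.
  have -> : conjc (2^-1)%:C = (2^-1)%:C :> R[i] by rewrite /conjc /= oppr0.
  rewrite cReM /= mul0r subr0 cReD.
  have := parallelogram lf lg.
  move: (L2sq (fun x => f x + g x)) (L2sq (fun x => f x - g x)) => p q.
  lra.
have cau e : 0 < e -> exists N, forall i j, (N <= i)%N -> (N <= j)%N ->
     L2sq (fun x => h_ i x - h_ j x) <= e.
  move=> e0; have e4 : 0 < e / 4 by rewrite divr_gt0.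
  have [N _ HN] := near_infty_natSinv_lt (PosNum e4).
  exists N => i j /HN/= Ni /HN/= Nj; apply: le_trans (mid _ _ (lh_ i) (lh_ j)) _.
  have {}Ni : i.+1%:R^-1 < e / 4 := Ni; have {}Nj : j.+1%:R^-1 < e / 4 := Nj.
  by move: (Jh_ i) (Jh_ j) Ni Nj; move: (_^-1) (_^-1) (J _) (J _) => *; lra.
have [f lf fc] := L2_complete lh_ cau.
have key h : L2 mu h -> complex.Re (cdot f h) = complex.Re (ell h).
  move=> lh; set D := complex.Re (cdot f h) - complex.Re (ell h).
  (* [J (f + s h) - J f], which is nonnegative at the minimizer; it is the limit along the
     minimizing sequence. *)
  have H (s : R) : 0 <= s ^+ 2 * L2sq h + 2 * s * D.
    have C : (fun k => k.+1%:R^-1 + (s ^+ 2 * L2sq h + 2 * s * (complex.Re (cdot (h_ k) h) - complex.Re (ell h))))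
        @ \oo --> 0 + (s ^+ 2 * L2sq h + 2 * s * D).
      apply: cvgD; first exact: cvg_harmonic.
      apply: cvgD; first exact: cvg_cst.
      apply: cvgM; first exact: cvg_cst.
      apply: cvgB; last exact: cvg_cst.
      by apply: normc_cvg_Re; exact: cdot_cvgl.
    rewrite add0r in C; apply: (cvgr_to_ge C); apply: nearW => k.
    have := mJ _ (L2D (lh_ k) (L2Zl s%:C lh)).
    rewrite /J ellD//; last exact: L2Zl.
    rewrite ellZ// L2sqD//; last exact: L2Zl.
    rewrite L2sqZ// cdotZr// normc_real real_normK ?num_real//.
    have -> : conjc s%:C = s%:C by rewrite /conjc /= oppr0.
    rewrite cReD !cReM /= !mul0r !subr0.
    have := Jh_ k; rewrite /J; move: (k.+1%:R^-1) (complex.Re (ell (h_ k))) => *; nra.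
  have r0 := L2sq_ge0 mu h; have rp : 0 < L2sq h + 1 by lra.
  (* The minimizing [s] is [- D / L2sq h]; adding 1 to the denominator covers [L2sq h = 0]. *)
  have := H (- D / (L2sq h + 1)).
  have -> : (- D / (L2sq h + 1)) ^+ 2 * L2sq h + 2 * (- D / (L2sq h + 1)) * D =
      - (D ^+ 2 / (L2sq h + 1) ^+ 2 * (L2sq h + 2)).
    by field; rewrite gt_eqF.
  rewrite oppr_ge0 => {}H.
  have : D ^+ 2 / (L2sq h + 1) ^+ 2 * (L2sq h + 2) == 0.
    rewrite eq_le H mulr_ge0 ?divr_ge0 ?sqr_ge0//; lra.
  rewrite mulf_eq0 mulf_eq0 invr_eq0 !sqrf_eq0 (gt_eqF rp) orbF.
  case/orP => [/eqP|/eqP]; last by lra.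
  by rewrite /D => /eqP; rewrite subr_eq0 => /eqP.
exists f => // h lh.
have := key _ lh; have := key _ (L2Zl 'i lh).
rewrite cdotZr// ellZ//.
case: (cdot f h) (ell h) => a b [a' b'] /=; simpc => ib ia.
by rewrite ia ib.
Qed.

End riesz.

(** * Lebesgue measure under affine maps *)

Section affine1.
Variable R : realType.
Local Notation lam := (@lebesgue_measure R).

Lemma measurable_inv : measurable_fun setT (fun x : R => x^-1).
Proof.
have mD : measurable [set~ (0:R)] by apply: measurableC; exact: measurable_set1.
rewrite -(setvU [set (0:R)]); apply/measurable_funU => //; split.
  apply: open_continuous_measurable_fun.
    by apply: closed_openC; exact: closed_eq.
  by move=> x; rewrite inE /= => x0; apply: inv_continuous; apply/eqP.
exact: measurable_fun_set1.
Qed.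

Lemma measurable_affine1 (a b : R) :
  measurable_fun setT (fun x : measurableTypeR R => (x - b) / a : measurableTypeR R).
Proof.
by apply: measurable_funM => //; apply: measurable_funB.
Qed.

(** Lebesgue measure is determined by its values on half-open intervals, and on those the affine
    change of scale is explicit. *)
Lemma lebesgue_affine (a b : R) (A : set R) : a != 0 -> measurable A ->
  pushforward lam (fun x : measurableTypeR R => (x - b) / a : measurableTypeR R) A =
  (`|a|%:E * lam A)%E.
Proof.
move=> a0 mA.
have na0 : 0 < `|a| by rewrite normr_gt0.
pose g := (fun x : measurableTypeR R => (x - b) / a : measurableTypeR R).
pose m : {measure set (measurableTypeR R) -> \bar R} :=
  measure_function_pushforward__canonical__measure_function_Measure lam (measurable_affine1 a b).
have na1 : 0 <= `|a|^-1 by rewrite invr_ge0 ltW.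
pose nu : {measure set (measurableTypeR R) -> \bar R} := mscale (NngNum na1) m.
have H : lam A = nu A.
  apply: lebesgue_measure_unique => // _ [[x y] _ <-] /=.
  rewrite /nu /mscale/= /pushforward.
  have [a_gt0|a_lt0|a_eq0] := ltgtP 0 a; last by rewrite -a_eq0 eqxx in a0.
    rewrite [X in _ = (_ * lebesgue_measure X)%E](_ : _ @^-1` _ = `]a * x + b, a * y + b]%classic); last first.
      apply/seteqP; split => t /=; rewrite !in_itv/= ltr_pdivlMr// ler_pdivrMr// => /andP[h1 h2];
      apply/andP; split; lra.
    rewrite !lebesgue_measure_itv/= !lte_fin ltrD2r ltr_pM2l//; case: ifP => _; last by rewrite mule0.
    by rewrite -!EFinB -EFinM gtr0_norm//; congr EFin; field; rewrite gt_eqF.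
  rewrite [X in _ = (_ * lebesgue_measure X)%E](_ : _ @^-1` _ = `[a * y + b, a * x + b[%classic); last first.
    apply/seteqP; split => t /=; rewrite !in_itv/= ltr_ndivlMr// ler_ndivrMr// => /andP[h1 h2];
    apply/andP; split; lra.
  rewrite !lebesgue_measure_itv/= !lte_fin ltrD2r ltr_nM2l//; case: ifP => _; last by rewrite mule0.
  by rewrite -!EFinB -EFinM ltr0_norm//; congr EFin; field; rewrite lt_eqF.
rewrite H /nu /mscale /= muleA -EFinM mulfV ?mul1e// gt_eqF//.
Qed.

Lemma ge0_integral_affine1 (a b : R) (f : R -> \bar R) : a != 0 ->
  measurable_fun setT f -> (forall x, 0 <= f x)%E ->
  (\int[lam]_x f ((x - b) / a)%R = `|a|%:E * \int[lam]_x f x)%E.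
Proof.
move=> a0 mf f0.
have na0 : 0 <= `|a| by [].
transitivity (\int[mscale (NngNum na0) lam]_x f x)%E; last first.
  by rewrite ge0_integral_mscale.
have mg := measurable_affine1 a b.
pose m : {measure set (measurableTypeR R) -> \bar R} :=
  measure_function_pushforward__canonical__measure_function_Measure lam (measurable_affine1 a b).
transitivity (\int[m]_x f x)%E.
  by rewrite /m /= ge0_integral_pushforward.
apply: eq_measure_integral => A mA _.
by rewrite /m/= lebesgue_affine.
Qed.

End affine1.

Section lebn_theory.
Variable R : realType.
Local Notation lam := (@lebesgue_measure R).

Lemma ge0_integral_lebnS n (f : n.+1.-tuple R -> \bar R) :
  measurable_fun setT f -> (forall t, 0 <= f t)%E ->
  (\int[lebn R n.+1]_t f t = \int[lam]_x \int[lebn R n]_t f (tcons (x, t)))%E.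
Proof.
move=> mf f0.
transitivity (\int[(lam \x lebn R n)%E]_p (f \o @tcons R n) p)%E.
  by rewrite /= /lebnS ge0_integral_pushforward//; exact: measurable_tcons.
rewrite fubini_tonelli1//; last by move=> p; exact: f0.
by apply: measurableT_comp => //; exact: measurable_tcons.
Qed.

Lemma integral_lebn0 (f : 0.-tuple R -> \bar R) : measurable_fun setT f ->
  (\int[lebn R 0]_t f t = f [tuple])%E.
Proof. by move=> mf; rewrite /= integral_dirac// diracT mul1e. Qed.

Section maps.
Context d (T : measurableType d) (n : nat).
Implicit Types u v : T -> n.-tuple R.

Lemma meas_tnth u i : measurable_fun setT u -> measurable_fun setT (fun x => tnth (u x) i).
Proof. by move=> /measurable_fun_tnthP /(_ i). Qed.

Lemma meas_tsub u v : measurable_fun setT u -> measurable_fun setT v ->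
  measurable_fun setT (fun x => tsub (u x) (v x)).
Proof.
move=> mu mv; apply/measurable_fun_tnthP => i.
rewrite (_ : _ \o _ = fun x => tnth (u x) i - tnth (v x) i); last first.
  by apply/funext => x /=; rewrite tnth_mktuple.
by apply: measurable_funB; exact: meas_tnth.
Qed.

Lemma meas_tdiv u v : measurable_fun setT u -> measurable_fun setT v ->
  measurable_fun setT (fun x => tdiv (u x) (v x)).
Proof.
move=> mu mv; apply/measurable_fun_tnthP => i.
rewrite (_ : _ \o _ = fun x => tnth (u x) i / tnth (v x) i); last first.
  by apply/funext => x /=; rewrite tnth_mktuple.
apply: measurable_funM; first exact: meas_tnth.
by apply: (measurableT_comp (@measurable_inv R)); exact: meas_tnth.
Qed.

Lemma meas_inner u v : measurable_fun setT u -> measurable_fun setT v ->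
  measurable_fun setT (fun x => inner (u x) (v x)).
Proof.
by move=> mu mv; apply: measurable_sum => i; apply: measurable_funM; exact: meas_tnth.
Qed.

Lemma meas_sqnorm u : measurable_fun setT u -> measurable_fun setT (fun x => sqnorm (u x)).
Proof.
by move=> mu; apply: measurable_sum => i; apply: measurable_funX; exact: meas_tnth.
Qed.

Lemma meas_absp u : measurable_fun setT u -> measurable_fun setT (fun x => absp (u x)).
Proof.
move=> mu; apply: (measurableT_comp (@normr_measurable R setT)).
by apply: measurable_prod => i _; exact: meas_tnth.
Qed.

End maps.

Lemma R0P n (a : n.-tuple R) : R0 a <-> forall i, tnth a i != 0.
Proof.
rewrite /R0 /= /absp normr_eq0; split => [/prodf_neq0 H i|H]; first exact: H.
by apply/prodf_neq0 => i _; exact: H.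
Qed.

Lemma absp_gt0 n (a : n.-tuple R) : R0 a -> 0 < absp a.
Proof. by move=> a0; rewrite lt_neqAle eq_sym a0 normr_ge0. Qed.

Lemma absp_ge0 n (a : n.-tuple R) : 0 <= absp a.
Proof. exact: normr_ge0. Qed.

(** Induction on the dimension: Tonelli splits off the first coordinate, on which the map acts by
    itself. *)
Lemma ge0_integral_affine n (a b : n.-tuple R) (f : n.-tuple R -> \bar R) :
  R0 a -> measurable_fun setT f -> (forall x, 0 <= f x)%E ->
  (\int[lebn R n]_t f (tdiv (tsub t b) a) = (absp a)%:E * \int[lebn R n]_t f t)%E.
Proof.
elim: n a b f => [|n IH] a b f a0 mf f0.
  rewrite !integral_lebn0//; last first.
    by apply: measurableT_comp => //; apply: meas_tdiv => //; apply: meas_tsub.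
  by rewrite /absp big_ord0 normr1 mul1e; congr f; rewrite [LHS]tuple0.
have mg : measurable_fun setT (fun t => f (tdiv (tsub t b) a)).
  by apply: measurableT_comp => //; apply: meas_tdiv => //; apply: meas_tsub.
rewrite !ge0_integral_lebnS//.
have ta : R0 [tuple of behead a].
  by apply/R0P => i; rewrite tnth_behead; move/R0P : a0; apply.
have E x t : tdiv (tsub (tcons (x, t)) b) a =
    tcons ((x - thead b) / thead a, tdiv (tsub t [tuple of behead b]) [tuple of behead a]).
  apply: eq_from_tnth => i; rewrite !tnth_mktuple.
  case: (unliftP ord0 i) => [j|] ->.
    by rewrite !tnthS !tnth_mktuple !tnth_behead; congr ((_ - tnth b _) / tnth a _);
      apply: val_inj; rewrite /= inordK ?ltnS ?ltn_ord.
  by rewrite !tnth0.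
under eq_integral do under eq_integral do rewrite E.
have m1 x : measurable_fun setT (fun t => f (tcons (x, t))).
  by apply: measurableT_comp => //; apply: measurableT_comp; [exact: measurable_tcons|exact: pair1_measurable].
have m2 : measurable_fun setT (fun p => f (tcons p) : \bar R).
  by apply: measurableT_comp => //; exact: measurable_tcons.
under eq_integral => x _ do rewrite (IH _ _ (fun t => f (tcons ((x - thead b) / thead a, t))))//.
rewrite ge0_integralZl_EFin//; last 3 first.
- by move=> x _; exact: integral_ge0.
- have := measurable_fun_fubini_tonelli_F (fun p => f (tcons p)) m2 (fun p => f0 _) (m2 := lebn R n).
  by move=> mF; exact: (measurableT_comp mF (measurable_affine1 (thead a) (thead b))).
- exact: absp_ge0.
rewrite (@ge0_integral_affine1 R (thead a) (thead b) (fun x => \int[lebn R n]_t f (tcons (x, t)))%E).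
- rewrite muleA -EFinM; congr (_%:E * _)%E.
  rewrite /absp big_ord_recl normrM mulrC; congr (_ * `|_|).
  by apply: eq_bigr => i _; rewrite tnth_behead; congr tnth; apply: val_inj; rewrite /= inordK ?ltnS ?ltn_ord.
- by move/R0P : a0 => /(_ ord0).
- exact: (measurable_fun_fubini_tonelli_F (fun p => f (tcons p)) m2 (fun p => f0 _)).
- by move=> x; exact: integral_ge0.
Qed.

(** A coordinate hyperplane is a box with one side a point. *)
Lemma lebn_R0 n : {ae lebn R n, forall a, R0 a}.
Proof.
suff H i : {ae lebn R n, forall a : n.-tuple R, tnth a i != 0}.
  have /(_ H) := @filter_forall _ _ (fun i a => tnth a i != 0) (almost_everywhere (lebn R n))
    (ae_filter_ringOfSetsType _).
  by apply: filterS => a /R0P.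
pose A (j : 'I_n) : set R := if j == i then [set 0] else setT.
have mA j : measurable (A j) by rewrite /A; case: ifP.
have E := lebn_box mA.
exists [set t | forall j, A j (tnth t j)]; split.
- rewrite (_ : mkset _ = \bigcap_(j in [set: 'I_n]) (@tnth n R ^~ j) @^-1` A j).
    apply: fin_bigcap_measurable => // j _; rewrite -[X in measurable X]setTI.
    exact: (@measurable_tnth _ R).
  by apply/seteqP; split => t H j; [move=> _ |]; exact: H.
- rewrite E (bigD1 i)//= /A eqxx lebesgue_measure_set1 mul0e//.
- move=> a /= /negP; rewrite negbK => /eqP ai j; rewrite /A; case: eqP => // ->.
  by rewrite ai.
Qed.

End lebn_theory.

Lemma pos_muleBr (R : realType) (c : R) (x y : \bar R) : 0 < c ->
  (0 <= x -> 0 <= y -> c%:E * x - c%:E * y = c%:E * (x - y))%E.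
Proof.
move=> c0; case: x => [x||//] _; case: y => [y||//] _.
- by congr EFin; rewrite mulrBr.
- by rewrite addeNy gt0_muley ?lte_fin// gt0_muleNy ?lte_fin// addeNy.
- by rewrite addye// gt0_muley ?lte_fin// addye// -EFinM.
- by rewrite addeNy gt0_muley ?lte_fin// gt0_muleNy ?lte_fin// addeNy.
Qed.

Section scaling_map.
Context (R : realType) d (T : measurableType d).
Variables (mu : {measure set T -> \bar R}) (g : T -> T) (c : R).
Hypothesis mg : measurable_fun setT g.
Hypothesis c0 : 0 < c.
Hypothesis Hg : forall f : T -> \bar R, measurable_fun setT f -> (forall x, 0 <= f x)%E ->
  (\int[mu]_x f (g x) = c%:E * \int[mu]_x f x)%E.

(** The scaling identity for nonnegative functions extends to signed functions through positive and
    negative parts, and also holds when the integral is infinite because both sides then have finite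
    part 0. *)
Lemma Rintegral_scaling (h : T -> R) : measurable_fun setT h ->
  \int[mu]_x h (g x) = c * \int[mu]_x h x.
Proof.
move=> mh; have mE : measurable_fun setT (EFin \o h) by exact/measurable_EFinP.
have E : (\int[mu]_x (h (g x))%:E = c%:E * \int[mu]_x (h x)%:E)%E.
  rewrite integralE [in RHS]integralE.
  have -> : (\int[mu]_x ((fun x => (h (g x))%:E)^\+ x) = c%:E * \int[mu]_x ((EFin \o h)^\+ x))%E.
    rewrite -Hg//; last exact: measurable_funepos.
    by apply: eq_integral => x _; exact: (congr1 (@^~ x) (funepos_comp (EFin \o h) g)).
  have -> : (\int[mu]_x ((fun x => (h (g x))%:E)^\- x) = c%:E * \int[mu]_x ((EFin \o h)^\- x))%E.
    rewrite -Hg//; last exact: measurable_funeneg.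
    by apply: eq_integral => x _; exact: (congr1 (@^~ x) (funeneg_comp (EFin \o h) g)).
  by apply: pos_muleBr => //; exact: integral_ge0.
rewrite /Rintegral E; case: (\int[mu]_x (h x)%:E)%E => [r||] //=.
- by rewrite gt0_muley ?lte_fin// mulr0.
- by rewrite gt0_muleNy ?lte_fin// mulr0.
Qed.

Lemma cint_scaling (f : T -> R[i]) : cmeasurable_fun setT f ->
  cintegral mu setT (fun x => f (g x)) = c%:C * cintegral mu setT f.
Proof.
move=> [f1 f2]; rewrite /cintegral (Rintegral_scaling f1) (Rintegral_scaling f2).
by simpc.
Qed.

Lemma L1_scaling (f : T -> R[i]) : L1 mu f -> L1 mu (fun x => f (g x)).
Proof.
move=> [mf ff]; split; first exact: (cmeas_comp mg mf).
rewrite (Hg (f := fun x => (normc (f x))%:E)); last 2 first.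
- by apply/measurable_EFinP; exact: meas_normc.
- by move=> x; rewrite lee_fin normc_ge0.
by rewrite lte_mul_pinfty// ?lee_fin ?ltW.
Qed.

Lemma L2_scaling (f : T -> R[i]) : L2 mu f -> L2 mu (fun x => f (g x)).
Proof.
move=> [mf ff]; split; first exact: (cmeas_comp mg mf).
rewrite (Hg (f := fun x => (normc (f x) ^+ 2)%:E)); last 2 first.
- by apply/measurable_EFinP; exact: meas_normc2.
- by move=> x; rewrite lee_fin sqr_ge0.
by rewrite lte_mul_pinfty// ?lee_fin ?ltW.
Qed.

Lemma L2sq_scaling (f : T -> R[i]) : cmeasurable_fun setT f ->
  L2sq mu (fun x => f (g x)) = c * L2sq mu f.
Proof. by move=> mf; exact: (Rintegral_scaling (meas_normc2 mf)). Qed.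

End scaling_map.

Section affine_maps.
Variable R : realType.
Local Notation lam := (@lebesgue_measure R).

Lemma meas_affine n (a b : n.-tuple R) :
  measurable_fun setT (fun t : n.-tuple R => tdiv (tsub t b) a).
Proof. by apply: meas_tdiv => //; exact: meas_tsub. Qed.

Section fixed.
Context n (a b : n.-tuple R).
Hypothesis a0 : R0 a.
Let H f mf f0 := @ge0_integral_affine R n a b f a0 mf f0.

Lemma cint_affine f : cmeasurable_fun setT f ->
  cintegral (lebn R n) setT (fun t => f (tdiv (tsub t b) a)) =
  (absp a)%:C * cintegral (lebn R n) setT f.
Proof. exact: (cint_scaling (absp_gt0 a0) H). Qed.

Lemma L1_affine f : L1 (lebn R n) f -> L1 (lebn R n) (fun t => f (tdiv (tsub t b) a)).
Proof. exact: (L1_scaling (meas_affine a b) (absp_gt0 a0) H). Qed.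

Lemma L2_affine f : L2 (lebn R n) f -> L2 (lebn R n) (fun t => f (tdiv (tsub t b) a)).
Proof. exact: (L2_scaling (meas_affine a b) (absp_gt0 a0) H). Qed.

Lemma L2sq_affine f : cmeasurable_fun setT f ->
  L2sq (lebn R n) (fun t => f (tdiv (tsub t b) a)) = absp a * L2sq (lebn R n) f.
Proof. by move=> mf; apply: (L2sq_scaling (absp_gt0 a0) H). Qed.
End fixed.

Definition tmul n (a t : n.-tuple R) : n.-tuple R :=
  [tuple tnth a i * tnth t i | i < n].
End affine_maps.

(** * The transform of the Laplace density *)

Section laplace.
Variable R : realType.
Local Notation lam := (@lebesgue_measure R).
Local Notation X := (measurableTypeR R).

Definition lap (x : R) : R := expR (- `|x|).
Definition cauchy_kernel (z : R) : R := 2 * (oneDsqr z)^-1.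

Lemma lap_ge0 x : 0 <= lap x. Proof. exact: expR_ge0. Qed.

Lemma lap_le1 x : lap x <= 1.
Proof. by rewrite /lap -expR0 ler_expR oppr_le0. Qed.

Lemma continuous_lap : continuous lap.
Proof.
move=> x; apply: continuous_comp; last exact: continuous_expR.
by apply: continuousN; exact: norm_continuous.
Qed.

Lemma is_derive_lap_prim (c z x : R) :
  is_derive x 1 (fun x : R => expR (- x) * (c * (z * sin (z * x) - cos (z * x)) / oneDsqr z - 1))
    (expR (- x) * (1 + c * cos (z * x))).
Proof.
have De : is_derive x 1 (expR \o (fun x : R => - x)) (expR (- x) * - 1).
  by apply: is_derive1_comp.
have Dz : is_derive x 1 (fun x : R => z * x) z.
  by apply: is_derive_eq; rewrite /GRing.scale /= mulr1.
have Ds : is_derive x 1 (sin \o (fun x : R => z * x)) (cos (z * x) * z).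
  by apply: is_derive1_comp.
have Dc : is_derive x 1 (cos \o (fun x : R => z * x)) (- sin (z * x) * z).
  by apply: is_derive1_comp.
pose G (x : R) : R := c * (z * (sin \o (fun x : R => z * x)) x - (cos \o (fun x : R => z * x)) x) / oneDsqr z - 1.
have DG : is_derive x 1 G (c * (z * (cos (z * x) * z) - (- sin (z * x) * z)) / oneDsqr z).
  rewrite /G; apply: is_derive_eq; rewrite /GRing.scale /=; ring.
have := @is_deriveM _ _ _ _ _ _ _ _ De DG.
have -> : (expR \o (fun x : R => - x)) * G = (fun x : R => expR (- x) * (c * (z * sin (z * x) - cos (z * x)) / oneDsqr z - 1)).
  by apply/funext => y.
move=> H; apply: is_derive_eq; rewrite /GRing.scale /= /G /=.
have n0 : oneDsqr z != 0 by rewrite gt_eqF// oneDsqr_gt0.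
move: n0; rewrite /oneDsqr => n0; field.
exact: n0.
Qed.

Lemma lap_prim_cvg (c z : R) :
  (fun x : R => expR (- x) * (c * (z * sin (z * x) - cos (z * x)) / oneDsqr z - 1))
    @ +oo --> (0 : R).
Proof.
pose C := `|c| * (`|z| + 1) + 1.
have C0 : 0 <= C by rewrite addr_ge0// mulr_ge0// addr_ge0.
apply/norm_cvg0P.
apply: (@squeeze_cvgr _ _ _ _ (fun=> 0) (fun x => expR (- x) * C)).
- near=> x; rewrite normr_ge0/= normrM ger0_norm ?expR_ge0//.
  rewrite ler_wpM2l ?expR_ge0//.
  apply: le_trans (ler_normB _ _) _; rewrite normr1 lerD2r.
  have D1 : 1 <= oneDsqr z by exact: oneDsqr_ge1.
  rewrite normrM normrM -[leRHS]mulr1; apply: ler_pM => //; last first.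
    by rewrite normfV ger0_norm ?invf_le1// (lt_le_trans ltr01 D1)// (le_trans ler01 D1).
  rewrite ler_wpM2l//.
  apply: le_trans (ler_normB _ _) _; apply: lerD; last exact: cos_max.
  by rewrite normrM -[leRHS]mulr1 ler_wpM2l// sin_max.
- exact: cvg_cst.
- rewrite -(mul0r C); apply: cvgM; last exact: cvg_cst.
  exact: cvgr_expR.
Unshelve. all: by end_near. Qed.

(** The integrand is nonnegative for [|c| <= 1], so the fundamental theorem of calculus applies on
    the half line with no separate proof of integrability. The values [c = 1] and [c = 0] then give
    the integral of [exp (- |x|) cos (z x)] by difference. *)
Lemma integral_lap_cos (c z : R) : `|c| <= 1 ->
  (\int[lam]_x (lap x * (1 + c * cos (z * x)))%:E = (2 + 2 * c / oneDsqr z)%:E)%E.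
Proof.
move=> c1.
have ccos : continuous (fun x : R => 1 + c * cos (z * x)).
  move=> x; apply: cvgD; first exact: cvg_cst.
  apply: cvgM; first exact: cvg_cst.
  apply: continuous_comp; last exact: continuous_cos.
  by apply: cvgM; [exact: cvg_cst|exact: cvg_id].
have pos x : 0 <= 1 + c * cos (z * x).
  have : `|c * cos (z * x)| <= 1 by rewrite normrM mulr_ile1// cos_max.
  by rewrite ler_norml => /andP[]; lra.
rewrite ge0_symfun_integralT; first last.
- by move=> x /=; rewrite /lap normrN mulrN cosN.
- by move=> x; apply: cvgM; [exact: continuous_lap|exact: ccos].
- by move=> x; rewrite mulr_ge0 ?lap_ge0.
rewrite -set_itvcy.
under eq_integral => x.
  rewrite inE/= in_itv/= andbT => x0; rewrite /lap ger0_norm//; over.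
rewrite (@ge0_continuous_FTC2y _ _ (fun x : R => expR (- x) * (c * (z * sin (z * x) - cos (z * x)) / oneDsqr z - 1)) 0 0).
- rewrite -EFinB -EFinM mulr0 sin0 cos0 oppr0 expR0; congr EFin; field.
  by rewrite gt_eqF// oneDsqr_gt0.
- by move=> x _; rewrite mulr_ge0 ?expR_ge0.
- apply: continuous_subspaceT => x; apply: cvgM; last exact: ccos.
  by apply: continuous_comp; [exact: oppr_continuous|exact: continuous_expR].
- exact: lap_prim_cvg.
- by move=> x _; have H := is_derive_lap_prim c z x; exact: ex_derive.
- apply: cvg_at_right_filter; have H := is_derive_lap_prim c z 0.
  have /derivable1_diffP/differentiable_continuous := @ex_derive _ _ _ _ _ _ _ H.
  exact.
- by move=> x _; rewrite derive1E; have H := is_derive_lap_prim c z x; exact: derive_val.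
Qed.

Lemma meas_lap : measurable_fun setT lap.
Proof. by apply: continuous_measurable_fun; exact: continuous_lap. Qed.

Lemma integral_lap : (\int[lam]_x (lap x)%:E = 2%:E)%E.
Proof.
have := @integral_lap_cos 0 0; rewrite normr0 => /(_ ler01).
rewrite mulr0 mul0r addr0 => <-; apply: eq_integral => x _.
by rewrite mul0r addr0 mulr1.
Qed.

Lemma integrable_lap : lam.-integrable setT (EFin \o lap).
Proof.
apply/integrableP; split; first by apply/measurable_EFinP; exact: meas_lap.
under eq_integral do rewrite /= ger0_norm ?lap_ge0//.
by rewrite integral_lap ltry.
Qed.

Lemma L1_lap (h : R -> R[i]) : cmeasurable_fun setT (h : X -> R[i]) ->
  (forall x, normc (h x) <= 1) -> L1 lam (fun x : X => (lap x)%:C * h x).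
Proof.
move=> mh h1; apply: (L1M (M := 1)) => //.
apply: (L1_le _ integrable_lap); first exact: cmeas_real meas_lap.
by move=> x; rewrite normc_real ger0_norm ?lap_ge0.
Qed.

Lemma meas_mulz (z : R) : measurable_fun setT (fun x : X => z * x : X).
Proof. exact: mulrl_measurable. Qed.

(** The reflection [x |-> - x] preserves the integral and changes the sign of the integrand. *)
Lemma Rintegral_odd (h : R -> R) : lam.-integrable setT (EFin \o h) ->
  (forall x, h (- x) = - h x) -> \int[lam]_x h x = 0.
Proof.
move=> ih oh.
have mh : measurable_fun setT (h : X -> R).
  by apply/measurable_EFinP; exact: measurable_int ih.
have H f : measurable_fun setT f -> (forall x, 0 <= f x)%E ->
   (\int[lam]_x f ((x - 0) / -1 : X)%R = 1%:E * \int[lam]_x f x)%E.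
  by move=> mf f0; rewrite ge0_integral_affine1 ?normrN1// ?oppr_eq0 ?oner_eq0.
have := Rintegral_scaling ltr01 H mh.
under eq_Rintegral do rewrite subr0 invrN1 mulrN1 oh -mulN1r.
rewrite mul1r RintegralZl//; lra.
Qed.

(** The real part is the half-line integral and the imaginary part is the integral of an odd
    function. *)
Lemma ft_lap (z : R) :
  cintegral lam setT (fun x : X => (lap x)%:C * cis (z * x)) = (cauchy_kernel z)%:C.
Proof.
have ml : L1 lam (fun x : X => (lap x)%:C * cis (z * x)).
  apply: L1_lap => [|x]; last by rewrite normc_cis.
  by apply: cmeas_cis; exact: meas_mulz.
rewrite /cintegral/=; congr (_ +i* _).
  have iR := L1_Re ml.
  have icos : lam.-integrable setT (EFin \o (fun x => lap x * cos (z * x))).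
    by apply: eq_integrable iR => // x _ /=; rewrite mul0r subr0.
  have := @integral_lap_cos 1 z; rewrite normr1 => /(_ (lexx _)).
  under eq_integral do rewrite mul1r mulrDr mulr1 EFinD.
  rewrite integralD//; last exact: integrable_lap.
  rewrite integral_lap => /(congr1 fine).
  rewrite fineD//; last exact: integrable_fin_num.
  rewrite /= mulr1 => /addrI; rewrite -/(cauchy_kernel z) => <-.
  by apply: eq_Rintegral => x _; rewrite mul0r subr0.
apply: Rintegral_odd; first exact: (L1_Im ml).
by move=> x /=; rewrite /lap normrN mulrN sinN !mul0r !addr0 mulrN.
Qed.

Lemma cauchy_kernel_ge0 z : 0 <= cauchy_kernel z.
Proof. by rewrite /cauchy_kernel mulr_ge0// invr_ge0 ltW// oneDsqr_gt0. Qed.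

Lemma continuous_cauchy_kernel : continuous cauchy_kernel.
Proof.
by move=> x; apply: cvgM; [exact: cvg_cst|exact: continuous_oneDsqrV].
Qed.

Lemma meas_cauchy_kernel : measurable_fun setT (cauchy_kernel : X -> R).
Proof. by apply: continuous_measurable_fun; exact: continuous_cauchy_kernel. Qed.

Lemma integral_cauchy_kernel :
  (\int[lam]_z (cauchy_kernel z)%:E = (2 * pi)%:E)%E.
Proof.
rewrite ge0_symfun_integralT.
- rewrite -set_itvcy; under eq_integral do rewrite EFinM.
  rewrite ge0_integralZl_EFin//.
    have E := @integral0y_oneDsqr R.
    by rewrite [X in (_ * (_ * X))%E]E -!EFinM; congr EFin; field.
  apply/measurable_EFinP; apply: measurable_funTS.
  by apply: continuous_measurable_fun; exact: continuous_oneDsqrV.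
- exact: cauchy_kernel_ge0.
- exact: continuous_cauchy_kernel.
- by move=> x; rewrite /cauchy_kernel /oneDsqr/= sqrrN.
Qed.

Lemma integrable_cauchy_kernel : lam.-integrable setT (EFin \o cauchy_kernel).
Proof.
apply/integrableP; split; first by apply/measurable_EFinP; exact: meas_cauchy_kernel.
under eq_integral do rewrite /= ger0_norm ?cauchy_kernel_ge0//.
by rewrite integral_cauchy_kernel ltry.
Qed.

(** As [eps] tends to 0 these transforms are an approximate identity of mass [2 pi]. *)
Lemma ft_lap_scaled (eps z : R) : 0 < eps ->
  cintegral lam setT (fun x : X => (lap (eps * x))%:C * cis (z * x)) =
  (eps^-1 * cauchy_kernel (z / eps))%:C.
Proof.
move=> e0; have ie0 : 0 < eps^-1 by rewrite invr_gt0.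
pose f (x : X) := (lap x)%:C * cis (z / eps * x).
have H g : measurable_fun setT g -> (forall x, 0 <= g x)%E ->
   (\int[lam]_x g ((x - 0) / eps^-1 : X)%R = (eps^-1)%:E * \int[lam]_x g x)%E.
  by move=> mf f0; rewrite ge0_integral_affine1 ?gt_eqF// gtr0_norm.
rewrite rmorphM/= -ft_lap -(cint_scaling ie0 H (f := f)).
  apply: eq_cint => x; rewrite /f subr0 invrK; congr (_%:C * cis _).
    by rewrite mulrC.
  by field; rewrite gt_eqF.
apply: cmeasM; first exact: cmeas_real meas_lap.
by apply: cmeas_cis; exact: meas_mulz.
Qed.

End laplace.

(** * Continuity of translations *)

Section translation.
Variable R : realType.
Local Notation lam := (@lebesgue_measure R).
Local Notation X := (measurableTypeR R).
Implicit Types (u v : X -> R[i]).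

Definition corr u v (s : R) : R[i] :=
  cintegral lam setT (fun x : X => u x * conjc (v (x + s : X))).

(** Continuity at 0 of the correlation with every bounded integrable [v]. Testing against [v],
    instead of asking that translation be continuous in norm, makes dominated convergence sufficient
    for truncated continuous functions. *)
Definition tcont u := forall v M (s_ : nat -> R), L1 lam v ->
  (forall x, normc (v x) <= M) -> s_ k @[k --> \oo] --> (0 : R) ->
  normc (corr u v (s_ k) - corr u v 0) @[k --> \oo] --> 0.

Lemma meas_shift (s : R) : measurable_fun setT (fun x : X => x + s : X).
Proof. by apply: measurable_funD. Qed.

Lemma L1_corr u v M s : L1 lam u -> cmeasurable_fun setT v -> (forall x, normc (v x) <= M) ->
  L1 lam (fun x : X => u x * conjc (v (x + s : X))).
Proof.
move=> lu mv vM; apply: (L1M (M := M) lu) => [|x]; last by rewrite normc_conj.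
by apply: cmeas_conj; apply: (cmeas_comp (meas_shift s) mv).
Qed.

Lemma corr_le u v M s : L1 lam u -> cmeasurable_fun setT v -> (forall x, normc (v x) <= M) ->
  normc (corr u v s) <= M * \int[lam]_x normc (u x).
Proof.
move=> lu mv vM; apply: le_trans (normc_cint_le (L1_corr s lu mv vM)) _.
have lc := L1_corr s lu mv vM.
rewrite -RintegralZl//; last exact: L1_normc.
apply: le_Rintegral => //; first exact: L1_normc.
  by apply: eq_integrable (integrableZl measurableT M (L1_normc lu)).
by move=> x _; rewrite normcM normc_conj mulrC ler_wpM2r ?normc_ge0.
Qed.

Lemma corrB u u' v M s : L1 lam u -> L1 lam u' -> cmeasurable_fun setT v ->
  (forall x, normc (v x) <= M) ->
  corr u v s - corr u' v s = corr (fun x => u x - u' x) v s.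
Proof.
move=> lu lu' mv vM; rewrite /corr -cintB; try exact: (L1_corr s _ mv vM).
by apply: eq_cint => x; rewrite mulrBl.
Qed.

(** The correlation is Lipschitz in [u] for the [L1] norm, uniformly in the shift, so the property
    passes to [L1] limits. *)
Lemma tcont_lim u : L1 lam u ->
  (forall e : R, 0 < e -> exists u', [/\ L1 lam u', tcont u' & \int[lam]_x normc (u x - u' x) <= e]) ->
  tcont u.
Proof.
move=> lu H v M s_ lv vM s0; have mv := L1_meas lv.
have M0 : 0 <= M by apply: le_trans (vM 0); exact: normc_ge0.
apply/cvgrPdist_le => e e0.
have d0 : 0 < e / (4 * (M + 1)) by rewrite divr_gt0// mulr_gt0//; lra.
have [u' [lu' cu' ue]] := H _ d0.
have /cvgrPdist_le /(_ (e / 2)) := cu' v M s_ lv vM s0.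
rewrite divr_gt0// => /(_ isT); apply: filterS => k.
rewrite !sub0r !normrN !ger0_norm ?normc_ge0// => hk.
have B s : normc (corr u v s - corr u' v s) <= e / 4.
  rewrite (corrB _ lu lu' mv vM); apply: le_trans (corr_le _ (L1B lu lu') mv vM) _.
  apply: (@le_trans _ _ (M * (e / (4 * (M + 1))))); first by rewrite ler_wpM2l.
  rewrite mulrA ler_pdivrMr; last by lra.
  by rewrite mulrAC -mulrA ler_wpM2l ?ltW//; [field|lra] || nra.
(* The three-epsilon split: both [u]-errors are at most [e / 4]. *)
have -> : corr u v (s_ k) - corr u v 0 = (corr u v (s_ k) - corr u' v (s_ k)) +
   ((corr u' v (s_ k) - corr u' v 0) - (corr u v 0 - corr u' v 0)) by ring.
apply: le_trans (ler_normcD _ _) _.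
have h2 := ler_normcB (corr u' v (s_ k) - corr u' v 0) (corr u v 0 - corr u' v 0).
by have := B (s_ k); have := B 0; lra.
Qed.

Lemma tcontD u u' : L1 lam u -> L1 lam u' -> tcont u -> tcont u' ->
  tcont (fun x => u x + u' x).
Proof.
move=> lu lu' cu cu' v M s_ lv vM s0; have mv := L1_meas lv.
have E s : corr (fun x => u x + u' x) v s = corr u v s + corr u' v s.
  rewrite /corr -cintD; try exact: (L1_corr s _ mv vM).
  by apply: eq_cint => x; rewrite mulrDl.
apply: (@squeeze_cvgr _ _ _ _ (fun=> 0) (fun k => normc (corr u v (s_ k) - corr u v 0) + normc (corr u' v (s_ k) - corr u' v 0))).
- near=> k; rewrite normc_ge0 andTb !E.
  apply: le_trans (ler_normcD _ _); rewrite le_eqVlt; apply/orP; left; apply/eqP; congr normc; ring.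
- exact: cvg_cst.
- apply: (@cvgn_eq _ _ (0 + 0)); first by rewrite addr0.
  by apply: cvgD; [exact: (cu v M)|exact: (cu' v M)].
Unshelve. all: by end_near. Qed.

Lemma tcontZ z u : L1 lam u -> tcont u -> tcont (fun x => z * u x).
Proof.
move=> lu cu v M s_ lv vM s0; have mv := L1_meas lv.
have E s : corr (fun x => z * u x) v s = z * corr u v s.
  rewrite /corr -cintZl; last exact: (L1_corr s lu mv vM).
  by apply: eq_cint => x; rewrite mulrA.
under eq_fun do rewrite !E -mulrBr normcM.
apply: (@cvgn_eq _ _ (normc z * 0)); first by rewrite mulr0.
by apply: cvgM; [exact: cvg_cst|exact: (cu v M)].
Qed.

(** Moving the shift from [v] onto the truncated continuous function makes the integrand converge at
    every point off the two ends [x = m] and [x = - m] of the truncation. *)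
Lemma tcont_continuous (g : R -> R) (m : R) : continuous g -> 0 < m ->
  L1 lam (fun x : X => (if `|x| <= m then g x else 0)%:C) ->
  tcont (fun x : X => (if `|x| <= m then g x else 0)%:C).
Proof.
move=> cg m0 lu v M s_ lv vM s0; have mv := L1_meas lv.
set u := (fun x : X => _).
have [B0 HB0] : exists B, forall x, `|x| <= m -> `|g x| <= B.
  have cA : {within `[-m, m], continuous g} by exact: continuous_subspaceT.
  have [c _ Hc] := @EVT_max R (fun x => `|g x|) (-m) m (ltW (gtrN m0))
    (fun x => continuous_comp (cA x) (@norm_continuous _ _ _)).
  exists `|g c| => x xm; apply: Hc.
  by rewrite in_itv/= -ler_norml.
pose B := `|B0|.
have uB x : normc (u x) <= B.
  rewrite /u normc_real; case: ifP => [/HB0|_]; last by rewrite normr0 /B normr_ge0.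
  by move=> h; apply: le_trans h (ler_norm _).
have E s : corr u v s = cintegral lam setT (fun x : X => u (x - s : X) * conjc (v x)).
  have H f : measurable_fun setT f -> (forall x, 0 <= f x)%E ->
    (\int[lam]_x f ((x - (- s)) / 1 : X)%R = 1%:E * \int[lam]_x f x)%E.
    by move=> mf f0; rewrite ge0_integral_affine1 ?normr1// oner_eq0.
  have mf : cmeasurable_fun setT (fun x : X => u (x - s : X) * conjc (v x)).
    apply: cmeasM; last exact: (cmeas_conj mv).
    by apply: (cmeas_comp (meas_shift (- s)) (L1_meas lu)).
  rewrite -[RHS]mul1r -(cint_scaling ltr01 H mf).
  by apply: eq_cint => x; rewrite opprK divr1 addrK.
under eq_fun do rewrite !E.
apply: (@cint_dct _ _ _ lam _ _ (fun x => B * normc (v x))).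
- move=> k; apply: cmeasM; last exact: (cmeas_conj mv).
  by apply: (cmeas_comp (meas_shift (- s_ k)) (L1_meas lu)).
- apply: cmeasM; last exact: (cmeas_conj mv).
  by apply: (cmeas_comp (meas_shift (- 0)) (L1_meas lu)).
- by apply: eq_integrable (integrableZl measurableT B (L1_normc lv)).
- by move=> k x; rewrite normcM normc_conj ler_wpM2r ?normc_ge0.
- by move=> x; rewrite normcM normc_conj ler_wpM2r ?normc_ge0.
have am : {ae lam, forall x : X, `|x| != m}.
  exists ([set m] `|` [set -m]); split.
  - by apply: measurableU; exact: measurable_set1.
  - have m1 (r : R) : lam [set r] = 0%E by exact: lebesgue_measure_set1.
    by rewrite null_set_setU//; exact: m1.
  - move=> x /= /negP; rewrite negbK => /eqP <-.
    by case: (ger0P x) => _; [left|right; rewrite opprK].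
apply: filterS am => x xm.
have sx : (x - s_ k) @[k --> \oo] --> (x : R).
  by rewrite -[X in _ --> X]subr0; apply: cvgB => //; exact: cvg_cst.
have nsx : `|x - s_ k| @[k --> \oo] --> `|x : R|.
  by apply: continuous_cvg => //; exact: norm_continuous.
have ux : normc (u (x - s_ k : X) - u x) @[k --> \oo] --> 0.
  have [xlt|xgt] : `|x| < m \/ m < `|x| by case: (ltgtP `|x| m) xm => //; [left|right].
    have near1 : \forall k \near \oo, `|x - s_ k| < m by exact: (cvgr_lt _ nsx).
    apply: (@squeeze_cvgr _ _ _ _ (fun=> 0) (fun k => `|g (x - s_ k) - g x|)).
    - near=> k; rewrite normc_ge0 andTb /u -rmorphB normc_real (ltW xlt).
      by rewrite ifT// ltW//; near: k.
    - exact: cvg_cst.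
    - by apply/norm_cvg0P/subr_cvg0; apply: continuous_cvg => //; exact: cg.
  have near1 : \forall k \near \oo, m < `|x - s_ k| by exact: (cvgr_gt _ nsx).
  apply: cvg_near_cst; apply: filterS near1 => k hk.
  by rewrite /u !ifF ?subrr ?normc0// leNgt ?hk ?xgt.
have ux' : normc (u (x - s_ k : X) - u x) * normc (v x) @[k --> \oo] --> 0.
  apply: (@cvgn_eq _ _ (0 * normc (v x))); first by rewrite mul0r.
  by apply: cvgM => //; exact: cvg_cst.
rewrite subr0; under eq_fun do rewrite -mulrBl normcM normc_conj.
exact: ux'.
Unshelve. all: by end_near. Qed.

Lemma L1_real (h : X -> R) : lam.-integrable setT (EFin \o h) ->
  L1 lam (fun x => (h x)%:C).
Proof.
move=> ih; apply: (L1_le _ (integrable_norm ih)).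
  by apply: cmeas_real; apply/measurable_EFinP; exact: measurable_int ih.
by move=> x; rewrite normc_real.
Qed.

Lemma restrict_if (h : R -> R) (m : R) :
  (fun x : R => if `|x| <= m then h x else 0) = h \_ `[- m, m].
Proof.
apply/funext => x; rewrite /restrict; case: ifPn => xm.
  by rewrite ifT// inE/= in_itv/= -ler_norml.
by rewrite ifF//; apply/negP; rewrite inE/= in_itv/= -ler_norml; exact/negP.
Qed.

Lemma integrable_if (h : R -> R) (m : R) : lam.-integrable `[-m, m] (EFin \o h) ->
  lam.-integrable setT (EFin \o (fun x : X => if `|x| <= m then h x else 0)).
Proof.
move=> ih; rewrite (restrict_if h m) -restrict_EFin.
by apply/integrable_restrict => //; rewrite setTI.
Qed.

Lemma tcont_cpt (h : X -> R) (m : R) : 0 < m -> lam.-integrable setT (EFin \o h) ->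
  tcont (fun x => (if `|x| <= m then h x else 0)%:C).
Proof.
move=> m0 ih.
have ihm : lam.-integrable `[-m, m] (EFin \o h) by exact: integrableS ih.
pose A : set R := `[-m, m]%classic.
have fm : (lam A < +oo)%E.
  by rewrite lebesgue_measure_itv/=; case: ifP => _; rewrite ltry.
have [g [cg ig gc]] := @approximation_continuous_integrable R A h
  (measurable_itv _) fm ihm.
have lu : L1 lam (fun x : X => (if `|x| <= m then h x else 0)%:C).
  by apply: L1_real; exact: integrable_if.
apply: tcont_lim => // e e0.
have gc' : fine (\int[lam]_(z in A) `|(h z - g k z)%:E|)%E @[k --> \oo] --> (0 : R).
  exact: fine_cvg gc.
have /cvgrPdist_le /(_ e e0) [N2 _ HN] := gc'.
have lgn : L1 lam (fun x : X => (if `|x| <= m then g N2 x else 0)%:C).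
  by apply: L1_real; exact: integrable_if.
exists (fun x : X => (if `|x| <= m then g N2 x else 0)%:C); split => //.
  exact: tcont_continuous.
have := HN N2 (leqnn _) => /=; rewrite sub0r normrN.
apply: le_trans.
rewrite (le_trans _ (ler_norm _))//.
rewrite -[X in _ <= X]/(Rintegral lam A (fun z => `|h z - g N2 z|)) Rintegral_mkcond.
rewrite le_eqVlt; apply/orP; left; apply/eqP; apply: eq_Rintegral => x _.
rewrite -restrict_if.
transitivity (normc ((if `|x| <= m then h x else 0)%:C - (if `|x| <= m then g N2 x else 0)%:C)) => //.
rewrite -rmorphB normc_real.
by case: ifP => //; rewrite subrr normr0.
Qed.

Lemma tcont_real (h : X -> R) : lam.-integrable setT (EFin \o h) ->
  tcont (fun x => (h x)%:C).
Proof.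
move=> ih; apply: tcont_lim => [|e e0]; first exact: L1_real.
pose u k (x : X) := (if `|x| <= k.+1%:R then h x else 0)%:C : R[i].
have lu k : L1 lam (u k).
  by apply: L1_real; apply: integrable_if; exact: integrableS ih.
have H : (\int[lam]_x (normc ((h x)%:C - u k x))%:E)%E @[k --> \oo] --> 0%E.
  apply: (@Rdct0 _ _ _ lam _ (fun x => `|h x|)).
  - by move=> k; apply: meas_normc; exact: L1_meas (L1B (L1_real ih) (lu k)).
  - by move=> *; exact: normc_ge0.
  - exact: integrable_norm.
  - apply: aeW => x k; rewrite /u -rmorphB normc_real; case: ifP => _.
      by rewrite subrr normr0.
    by rewrite subr0.
  - apply: aeW => x; apply: cvg_near_cst; near=> k.
    rewrite /u ifT ?subrr ?normc0//.
    apply: (@le_trans _ _ k%:R); last by rewrite ler_nat.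
    by near: k; exact: nbhs_infty_ger.
have H' : fine (\int[lam]_x (normc ((h x)%:C - u k x))%:E)%E @[k --> \oo] --> (0 : R).
  exact: fine_cvg H.
have /cvgrPdist_le /(_ e e0) [N _ HN] := H'.
exists (u N); split => //; first by apply: tcont_cpt.
have := HN N (leqnn _) => /=; rewrite sub0r normrN.
by apply: le_trans; exact: ler_norm.
Unshelve. all: by end_near. Qed.

Lemma tcont_L1 u : L1 lam u -> tcont u.
Proof.
move=> lu; have iR := L1_Re lu; have iI := L1_Im lu.
have -> : u = (fun x => (complex.Re (u x))%:C + 'i * (complex.Im (u x))%:C).
  by apply/funext => x; exact: complexE.
apply: tcontD.
- exact: L1_real.
- by apply: L1Zl; exact: L1_real.
- exact: tcont_real.
- by apply: tcontZ; [exact: L1_real|exact: tcont_real].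
Qed.

End translation.

(** * Plancherel on the line *)

Section plancherel1.
Variable R : realType.
Local Notation lam := (@lebesgue_measure R).
Local Notation X := (measurableTypeR R).
Implicit Types (u v : X -> R[i]).

Definition ft1 u (xi : X) : R[i] :=
  cintegral lam setT (fun x : X => u x * cis (- (x * xi))).

Lemma cmeas_cisM d (T : measurableType d) (f g : T -> R) (s : R) :
  measurable_fun setT f -> measurable_fun setT g ->
  cmeasurable_fun setT (fun p => cis (s * (f p * g p))).
Proof.
move=> mf mg; apply: cmeas_cis; apply: measurable_funM => //.
exact: measurable_funM.
Qed.

Lemma cmeas_cismul : cmeasurable_fun setT (fun p : X * X => cis (- (p.1 * p.2))).
Proof.
under eq_fun do rewrite -mulN1r; apply: cmeas_cisM; [exact: measurable_fst|exact: measurable_snd].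
Qed.

Lemma cmeas_ft1 u : cmeasurable_fun setT u -> cmeasurable_fun setT (ft1 u).
Proof.
move=> mu; apply: (@cmeas_cint1 _ _ _ _ _ lam (fun p : X * X => u p.1 * cis (- (p.1 * p.2)))).
by apply: cmeasM; [exact: cmeas_fst|exact: cmeas_cismul].
Qed.

Lemma L1_cis (u : X -> R[i]) (s xi : R) : L1 lam u ->
  L1 lam (fun x : X => u x * cis (s * (x * xi))).
Proof.
move=> lu; apply: (L1M (M := 1) lu) => [|x]; last by rewrite normc_cis.
by apply: cmeas_cisM => //; exact: measurable_cst.
Qed.

Lemma L1_ft1 u xi : L1 lam u -> L1 lam (fun x : X => u x * cis (- (x * xi))).
Proof. by move=> lu; under eq_fun do rewrite -[- _]mulN1r; exact: L1_cis. Qed.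

Lemma normc_ft1_le u xi : L1 lam u -> normc (ft1 u xi) <= \int[lam]_x normc (u x).
Proof.
move=> lu; apply: le_trans (normc_cint_le (L1_ft1 xi lu)) _.
by under eq_Rintegral do rewrite normcM normc_cis mulr1.
Qed.

Lemma conj_ft1 v xi : L1 lam v ->
  conjc (ft1 v xi) = cintegral lam setT (fun x : X => conjc (v x) * cis (x * xi)).
Proof.
move=> lv; rewrite /ft1 -cint_conj; last exact: L1_ft1.
by apply: eq_cint => x; rewrite conjcM conj_cis opprK.
Qed.

Lemma L1_lap_scaled (eps : R) : 0 < eps -> L1 lam (fun x : X => (lap (eps * x))%:C).
Proof.
move=> e0; have ie0 : 0 < eps^-1 by rewrite invr_gt0.
have H g : measurable_fun setT g -> (forall x, 0 <= g x)%E ->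
   (\int[lam]_x g ((x - 0) / eps^-1 : X)%R = (eps^-1)%:E * \int[lam]_x g x)%E.
  by move=> mf f0; rewrite ge0_integral_affine1 ?gt_eqF// gtr0_norm.
have := L1_scaling (measurable_affine1 eps^-1 0) ie0 H (L1_real (@integrable_lap R)).
by under eq_fun do rewrite subr0 invrK mulrC.
Qed.

(** The multiplication formula is used twice, once for each transform; the innermost integral left
    over is the transform of the damping factor. *)
Lemma pairing_lap u v (eps : R) : 0 < eps -> L1 lam u -> L1 lam v ->
  cintegral lam setT (fun xi : X => ft1 u xi * (conjc (ft1 v xi) * (lap (eps * xi))%:C)) =
  cintegral lam setT (fun x : X => u x * cintegral lam setT (fun y : X =>
     conjc (v y) * (eps^-1 * cauchy_kernel ((y - x) / eps))%:C)).
Proof.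
move=> e0 lu lv.
have lw : L1 lam (fun xi : X => conjc (ft1 v xi) * (lap (eps * xi))%:C).
  under eq_fun do rewrite mulrC.
  apply: (L1M (M := \int[lam]_x normc (v x)) (L1_lap_scaled e0)).
    by apply: cmeas_conj; apply: cmeas_ft1; exact: (L1_meas lv).
  by move=> xi; rewrite normc_conj; exact: normc_ft1_le.
transitivity (cintegral lam setT (fun x : X => u x * cintegral lam setT (fun xi : X =>
    cis (- (x * xi)) * (conjc (ft1 v xi) * (lap (eps * xi))%:C)))).
  apply: (@cint_swap _ _ _ _ _ lam lam u _ (fun p : X * X => cis (- (p.1 * p.2))) 1 lu lw cmeas_cismul).
  by move=> p; rewrite normc_cis.
apply: eq_cint => x; congr (_ * _); cbv beta delta [fst snd] iota.
under eq_fun => xi do rewrite conj_ft1// mulrCA.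
have lw2 : L1 lam (fun xi : X => cis (- (x * xi)) * (lap (eps * xi))%:C).
  have := L1_ft1 x (L1_lap_scaled e0).
  by under eq_fun do rewrite mulrC (mulrC _ x).
rewrite (@cint_swap _ _ _ _ _ lam lam (fun y => conjc (v y)) _ (fun p : X * X => cis (p.1 * p.2)) 1)//; last 3 first.
- exact: L1_conj.
- under eq_fun do rewrite -[_ * _]mul1r; apply: cmeas_cisM; [exact: measurable_fst|exact: measurable_snd].
- by move=> p; rewrite normc_cis.
apply: eq_cint => y; congr (_ * _); cbv beta.
rewrite -ft_lap_scaled//; apply: eq_cint => xi.
by rewrite mulrA -cisD mulrC; congr (_ * cis _) => /=; ring.
Qed.

(** The substitution [y = x + eps z] moves [eps] from the kernel into the argument of [v]. *)
Lemma shift_kernel v (M eps x : R) : 0 < eps -> cmeasurable_fun setT v ->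
  (forall x, normc (v x) <= M) ->
  cintegral lam setT (fun y : X => conjc (v y) * (eps^-1 * cauchy_kernel ((y - x) / eps))%:C) =
  cintegral lam setT (fun z : X => conjc (v (x + eps * z : X)) * (cauchy_kernel z)%:C).
Proof.
move=> e0 mv vM.
have H g : measurable_fun setT g -> (forall x, 0 <= g x)%E ->
   (\int[lam]_y g ((y - x) / eps : X)%R = eps%:E * \int[lam]_x g x)%E.
  by move=> mf f0; rewrite ge0_integral_affine1 ?gt_eqF// gtr0_norm.
have ms : measurable_fun setT (fun z : X => x + eps * z : X).
  by apply: measurable_funD => //; exact: meas_mulz.
have mf : cmeasurable_fun setT (fun z : X => (eps^-1)%:C * (conjc (v (x + eps * z : X)) * (cauchy_kernel z)%:C)).
  apply: cmeasM; first exact: cmeas_cst.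
  apply: cmeasM; first by apply: cmeas_conj; exact: (cmeas_comp ms mv).
  exact: cmeas_real (@meas_cauchy_kernel R).
transitivity (eps%:C * cintegral lam setT (fun z : X => (eps^-1)%:C * (conjc (v (x + eps * z : X)) * (cauchy_kernel z)%:C))).
  rewrite -(cint_scaling e0 H mf); apply: eq_cint => y.
  rewrite (_ : x + eps * ((y - x) / eps) = y); last by field; rewrite gt_eqF.
  by rewrite rmorphM mulrCA.
have lf : L1 lam (fun z : X => conjc (v (x + eps * z : X)) * (cauchy_kernel z)%:C).
  under eq_fun do rewrite mulrC.
  apply: (L1M (M := M) (L1_real (@integrable_cauchy_kernel R))) => [|z].
    by apply: cmeas_conj; exact: (cmeas_comp ms mv).
  by rewrite normc_conj.
by rewrite cintZl// mulrA -rmorphM mulfV ?gt_eqF// mul1r.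
Qed.

Lemma pairing_corr u v (M eps : R) : 0 < eps -> L1 lam u -> L1 lam v ->
  (forall x, normc (v x) <= M) ->
  cintegral lam setT (fun xi : X => ft1 u xi * (conjc (ft1 v xi) * (lap (eps * xi))%:C)) =
  cintegral lam setT (fun z : X => corr u v (eps * z) * (cauchy_kernel z)%:C).
Proof.
move=> e0 lu lv vM; have mv := L1_meas lv.
rewrite pairing_lap//; under eq_fun do rewrite (shift_kernel _ e0 mv vM).
rewrite -(@cint_swap _ _ _ _ _ lam lam u _ (fun p : X * X => conjc (v (p.1 + eps * p.2 : X))) M)//.
- exact: L1_real (@integrable_cauchy_kernel R).
- apply: cmeas_conj; apply: (cmeas_comp _ mv).
  apply: measurable_funD; first exact: measurable_fst.
  by apply: measurable_funM => //; exact: measurable_snd.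
- by move=> p; rewrite normc_conj.
Qed.

(** The damped pairing of two transforms is an average of correlations at shifts of order [eps]
    against a kernel of mass [2 pi]; as [eps] tends to 0 it tends to [2 pi <u, v>]. *)
Lemma pairing_cvg u v (M : R) (e_ : nat -> R) : L1 lam u -> L1 lam v ->
  (forall x, normc (v x) <= M) -> (forall k, 0 < e_ k) -> e_ k @[k --> \oo] --> (0 : R) ->
  normc (cintegral lam setT (fun xi : X => ft1 u xi * (conjc (ft1 v xi) * (lap (e_ k * xi))%:C))
     - (2 * pi)%:C * cdot lam u v) @[k --> \oo] --> 0.
Proof.
move=> lu lv vM e0 ec; have mv := L1_meas lv.
have M0 : 0 <= M by apply: le_trans (vM 0); exact: normc_ge0.
have lk := L1_real (@integrable_cauchy_kernel R).
have E : (2 * pi)%:C * cdot lam u v = cintegral lam setT (fun z : X => corr u v 0 * (cauchy_kernel z)%:C).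
  rewrite cintZl// cint_real mulrC; congr (_ * _%:C).
    by apply: eq_cint => x; rewrite addr0.
  by rewrite /Rintegral integral_cauchy_kernel.
under eq_fun do rewrite (pairing_corr (e0 _) lu lv vM).
rewrite E.
pose C := M * \int[lam]_x normc (u x).
have cC s : normc (corr u v s) <= C by exact: (corr_le s lu mv vM).
have mc (s : R -> R) : measurable_fun setT (s : X -> X) -> cmeasurable_fun setT (fun z : X => corr u v (s z)).
  move=> ms; rewrite /corr.
  apply: (@cmeas_cint2 _ _ _ _ _ lam (fun p : X * X => u p.2 * conjc (v (p.2 + s p.1 : X)))).
  apply: cmeasM; first by apply: (cmeas_comp _ (L1_meas lu)); exact: measurable_snd.
  apply: cmeas_conj; apply: (cmeas_comp _ mv).
  apply: measurable_funD; first exact: measurable_snd.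
  by apply: measurableT_comp => //; exact: measurable_fst.
apply: (@cint_dct _ _ _ lam _ _ (fun z => C * cauchy_kernel z)).
- move=> k; apply: cmeasM; last exact: L1_meas lk.
  by apply: mc; exact: meas_mulz.
- by apply: cmeasM; [exact: cmeas_cst|exact: L1_meas lk].
- by apply: eq_integrable (integrableZl measurableT C (@integrable_cauchy_kernel R)).
- move=> k z; rewrite normcM normc_real ger0_norm ?cauchy_kernel_ge0//.
  by rewrite ler_wpM2r ?cauchy_kernel_ge0.
- move=> z; rewrite normcM normc_real ger0_norm ?cauchy_kernel_ge0//.
  by rewrite ler_wpM2r ?cauchy_kernel_ge0.
- apply: aeW => z; under eq_fun do rewrite -mulrBl normcM normc_real.
  apply: (@cvgn_eq _ _ (0 * `|cauchy_kernel z|)); first by rewrite mul0r.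
  apply: cvgM; last exact: cvg_cst.
  apply: (tcont_L1 lu lv vM).
  apply: (@cvgn_eq _ _ (0 * z)); first by rewrite mul0r.
  by apply: cvgM => //; exact: cvg_cst.
Qed.

End plancherel1.

Section plancherel1b.
Variable R : realType.
Local Notation lam := (@lebesgue_measure R).
Local Notation X := (measurableTypeR R).
Implicit Types (u v : X -> R[i]).

Lemma L2_bounded d (T : measurableType d) (mu : {measure set T -> \bar R}) (v : T -> R[i]) M :
  L1 mu v -> (forall x, normc (v x) <= M) -> L2 mu v.
Proof.
move=> lv vM; apply: (@L2_le _ _ _ mu _ (fun x => M * normc (v x))).
- exact: L1_meas lv.
- by apply: eq_integrable (integrableZl measurableT M (L1_normc lv)).
- by move=> x; rewrite expr2 ler_wpM2r ?normc_ge0.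
Qed.

Lemma harmonic_scale_cvg (x : R) : lap (k.+1%:R^-1 * x) @[k --> \oo] --> (1 : R).
Proof.
rewrite -[X in _ --> X](_ : lap 0 = 1); last by rewrite /lap normr0 oppr0 expR0.
apply: continuous_cvg; first exact: continuous_lap.
apply: (@cvgn_eq _ _ (0 * x)); first by rewrite mul0r.
by apply: cvgM; [exact: cvg_harmonic|exact: cvg_cst].
Qed.

Lemma lap_scaled_nd (x : R) (k j : nat) : (k <= j)%N ->
  lap (k.+1%:R^-1 * x) <= lap (j.+1%:R^-1 * x).
Proof.
move=> kj; rewrite /lap ler_expR lerN2 !normrM ler_wpM2r//.
by rewrite !ger0_norm ?invr_ge0// lef_pV2 ?posrE// ler_nat.
Qed.

(** With [u = v] the damped pairing is the integral of [|ft v|^2 exp (- eps |xi|)], which increases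
    to the integral of [|ft v|^2] as [eps] decreases. *)
Lemma plancherel1_bdd v M : L1 lam v -> (forall x, normc (v x) <= M) ->
  (\int[lam]_xi (normc (ft1 v xi) ^+ 2)%:E = (2 * pi * L2sq lam v)%:E)%E.
Proof.
move=> lv vM; have mv := L1_meas lv; have mf := cmeas_ft1 mv.
pose f k (xi : X) := normc (ft1 v xi) ^+ 2 * lap (k.+1%:R^-1 * xi).
have ek (k : nat) : 0 < (k.+1%:R^-1 : R) by rewrite invr_gt0.
have cv := pairing_cvg lv lv vM ek (@cvg_harmonic R).
have Ef k (xi : X) : ft1 v xi * (conjc (ft1 v xi) * (lap (k.+1%:R^-1 * xi))%:C) = (f k xi)%:C.
  by rewrite mulrA mul_conjc -rmorphM.
have lf k : L1 lam (fun xi : X => (f k xi)%:C).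
  pose B := (\int[lam]_x normc (v x)).
  have := L1M (M := B ^+ 2) (L1_lap_scaled (ek k)) (cmeas_real (meas_normc2 mf)) _.
  under eq_fun do rewrite mulrC -rmorphM; apply => xi.
  rewrite normc_real ger0_norm ?sqr_ge0// lerXn2r ?nnegrE ?normc_ge0 ?normc_ft1_le//.
  exact: le_trans (normc_ge0 _) (normc_ft1_le xi lv).
have mfk k : measurable_fun setT (f k).
  by have [] := L1_meas (lf k).
have f0 k xi : 0 <= f k xi by rewrite mulr_ge0 ?sqr_ge0 ?lap_ge0.
have C1 : (\int[lam]_xi (f k xi)%:E)%E @[k --> \oo] --> (2 * pi * L2sq lam v)%:E.
  have E k : (\int[lam]_xi (f k xi)%:E)%E = (\int[lam]_xi (f k xi))%:E.
    rewrite /Rintegral fineK//; apply: integrable_fin_num => //.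
    by have := L1_Re (lf k).
  under eq_fun do rewrite E.
  apply: cvg_EFin; first exact: nearW.
  have := normc_cvg_Re cv; under eq_fun do rewrite (eq_cint _ (Ef _)) cint_real.
  by rewrite cdotff -rmorphM.
have C2 := @cvg_monotone_convergence _ _ _ lam setT measurableT (fun k xi => (f k xi)%:E).
have {}C2 : (\int[lam]_xi (f k xi)%:E)%E @[k --> \oo] -->
    (\int[lam]_xi (normc (ft1 v xi) ^+ 2)%:E)%E.
  have -> : (\int[lam]_xi (normc (ft1 v xi) ^+ 2)%:E)%E =
      (\int[lam]_xi (fun xi => limn ((fun k xi => (f k xi)%:E)^~ xi)) xi)%E.
    apply: eq_integral => xi _; apply/esym/cvg_lim => //.
    apply: cvg_EFin; first exact: nearW.
    apply: (@cvgn_eq _ _ (normc (ft1 v xi) ^+ 2 * 1)); first by rewrite mulr1.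
    by apply: cvgM; [exact: cvg_cst|exact: harmonic_scale_cvg].
  apply: C2.
  - by move=> k; exact/measurable_EFinP.
  - by move=> k x _; rewrite lee_fin.
  - move=> x _ k j kj; rewrite lee_fin /f ler_wpM2l ?sqr_ge0//.
    exact: lap_scaled_nd.
exact: (cvg_unique _ C2 C1).
Qed.

(** Cutting off the large values keeps integrability and adds boundedness, which the correlation
    argument requires of one of its factors. *)
Definition clip d (T : measurableType d) (u : T -> R[i]) (k : nat) : T -> R[i] :=
  fun x => if normc (u x) <= k%:R then u x else 0.

Lemma normc_clip d (T : measurableType d) (u : T -> R[i]) k x : normc (clip u k x) <= normc (u x).
Proof. by rewrite /clip; case: ifP => // _; rewrite normc0 normc_ge0. Qed.

Lemma clip_bound d (T : measurableType d) (u : T -> R[i]) k x : normc (clip u k x) <= k%:R.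
Proof. by rewrite /clip; case: ifP => // _; rewrite normc0. Qed.

Lemma cmeas_clip d (T : measurableType d) (u : T -> R[i]) k :
  cmeasurable_fun setT u -> cmeasurable_fun setT (clip u k).
Proof.
move=> mu; apply: (cmeas_if _ mu (cmeas_cst _ 0)).
by apply: measurable_fun_ler => //; exact: meas_normc.
Qed.

Lemma clip_near d (T : measurableType d) (u : T -> R[i]) x :
  \forall k \near \oo, clip u k x = u x.
Proof.
near=> k; rewrite /clip ifT//.
by near: k; exact: nbhs_infty_ger.
Unshelve. all: by end_near. Qed.

Lemma L1_clip u k : L1 lam u -> L1 lam (clip u k).
Proof.
move=> lu; apply: (L1_le _ (L1_normc lu)); last exact: normc_clip.
exact: cmeas_clip (L1_meas lu).
Qed.

Lemma le_half_sum (a b : R) : b <= 2^-1 * (a + b) -> b <= a.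
Proof. by lra. Qed.

(** The upper bound is Fatou along the clipped functions [U k]. For the lower bound, pairing [u]
    with [U k] and using [x y <= (x^2 + y^2) / 2] gives [2 pi |U k|^2 <= (|ft u|^2 + 2 pi |U k|^2) /
    2], and [2 pi |U k|^2] can be absorbed on the left. *)
Lemma plancherel1 u : L1 lam u ->
  (\int[lam]_xi (normc (ft1 u xi) ^+ 2)%:E =
   (2 * pi)%:E * \int[lam]_x (normc (u x) ^+ 2)%:E)%E.
Proof.
move=> lu; have mu := L1_meas lu; have mf := cmeas_ft1 mu.
have pi0 : 0 < (2 * pi : R) by rewrite mulr_gt0// pi_gt0.
pose U k := clip u k.
have lU k : L1 lam (U k) by exact: L1_clip.
have U2 k : L2 lam (U k) by apply: (L2_bounded (lU k)); exact: clip_bound.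
have PU k := plancherel1_bdd (lU k) (clip_bound u k).
have rU k : (\int[lam]_x (normc (U k x) ^+ 2)%:E = (L2sq lam (U k))%:E)%E by exact: L2sqE.
apply/eqP; rewrite eq_le; apply/andP; split.
  apply: (@fatou_bound _ _ _ lam (fun k xi => normc (ft1 (U k) xi) ^+ 2)).
  - by move=> k; apply: meas_normc2; apply: cmeas_ft1; exact: L1_meas (lU k).
  - exact: meas_normc2.
  - by move=> *; exact: sqr_ge0.
  - by move=> *; exact: sqr_ge0.
  - apply: aeW => xi; apply: normc_cvg2.
    apply: (@cint_dct _ _ _ lam _ _ (fun x => normc (u x))).
    + by move=> k; exact: L1_meas (L1_ft1 xi (lU k)).
    + exact: L1_meas (L1_ft1 xi lu).
    + exact: L1_normc lu.
    + by move=> k x; rewrite normcM normc_cis mulr1 normc_clip.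
    + by move=> x; rewrite normcM normc_cis mulr1.
    + apply: aeW => x; apply: cvg_near_cst.
      by apply: filterS (clip_near u x) => k; rewrite /U => ->; rewrite subrr normc0.
  - move=> k; rewrite PU EFinM -rU; apply: lee_wpmul2l; first by rewrite lee_fin ltW.
    apply: ge0_le_integral => //.
    + by move=> x _; rewrite lee_fin sqr_ge0.
    + by apply/measurable_EFinP; apply: meas_normc2; exact: L1_meas (lU k).
    + by apply/measurable_EFinP; exact: meas_normc2.
    + by move=> x _; rewrite lee_fin lerXn2r ?nnegrE ?normc_ge0 ?normc_clip.
have [fy|fy] := eqVneq (\int[lam]_xi (normc (ft1 u xi) ^+ 2)%:E)%E +oo%E.
  by rewrite fy leey.
have lf : L2 lam (ft1 u) by split => //; rewrite ltey.
rewrite (L2sqE lf).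
suff H : (\int[lam]_x (normc (u x) ^+ 2)%:E <= (L2sq lam (ft1 u) / (2 * pi))%:E)%E.
  apply: le_trans (lee_wpmul2l _ H) _; first by rewrite lee_fin ltW.
  by rewrite -EFinM lee_fin mulrC divfK// gt_eqF.
apply: (@fatou_bound _ _ _ lam (fun k x => normc (U k x) ^+ 2)).
- by move=> k; apply: meas_normc2; exact: L1_meas (lU k).
- exact: meas_normc2.
- by move=> *; exact: sqr_ge0.
- by move=> *; exact: sqr_ge0.
- apply: aeW => x; apply: cvg_near_cst.
  by apply: filterS (clip_near u x) => k; rewrite /U => ->.
move=> k; rewrite rU lee_fin ler_pdivlMr//.
have lfU : L2 lam (ft1 (U k)).
  by split; [exact: cmeas_ft1 (L1_meas (lU k))|rewrite PU ltry].
have rfU : L2sq lam (ft1 (U k)) = 2 * pi * L2sq lam (U k).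
  by apply: EFin_inj; rewrite -L2sqE// PU.
have ek (j : nat) : 0 < (j.+1%:R^-1 : R) by rewrite invr_gt0.
have cv := normc_cvg_Re (pairing_cvg lu (lU k) (clip_bound u k) ek (@cvg_harmonic R)).
have dU : cdot lam u (U k) = (L2sq lam (U k))%:C.
  rewrite -cdotff; apply: eq_cint => x; rewrite /U /clip; case: ifP => // _.
  by rewrite /conjc/= oppr0 !mulr0.
rewrite dU -rmorphM in cv.
rewrite mulrC; apply: le_half_sum.
apply: (cvgr_to_le cv); apply: nearW => j.
apply: le_trans (ler_norm _) _; apply: le_trans (le_Re_normc _) _.
have lp : L1 lam (fun xi : X => ft1 u xi * (conjc (ft1 (U k) xi) * (lap (j.+1%:R^-1 * xi))%:C)).
  under eq_fun do rewrite mulrA.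
  apply: (L1M (M := 1) (L2_mulc lf lfU)).
    apply: cmeas_real; apply: (measurableT_comp (@meas_lap R)); exact: meas_mulz.
  by move=> xi; rewrite normc_real ger0_norm ?lap_ge0// lap_le1.
apply: le_trans (normc_cint_le lp) _.
rewrite -rfU /L2sq -RintegralD//; try exact: L2_sq_int.
rewrite -RintegralZl//; last first.
  by apply: eq_integrable (integrableD measurableT (L2_sq_int lf) (L2_sq_int lfU)).
apply: le_Rintegral => //; first exact: L1_normc.
  by apply: eq_integrable (integrableZl measurableT 2^-1 (integrableD measurableT (L2_sq_int lf) (L2_sq_int lfU))).
move=> xi _; apply: le_trans (normc_mul_le _ _).
rewrite !normcM normc_conj normc_real ger0_norm ?lap_ge0//.
by rewrite mulrA ler_piMr ?mulr_ge0 ?normc_ge0// lap_le1.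
Qed.

End plancherel1b.

(** * Plancherel in several variables *)

Section slices.
Context (R : realType) d1 d2 (T1 : measurableType d1) (T2 : measurableType d2).
Variables (m1 : {sigma_finite_measure set T1 -> \bar R})
          (m2 : {sigma_finite_measure set T2 -> \bar R}).
Implicit Types (f : T1 * T2 -> R[i]).

Lemma L1_of_normc d (T : measurableType d) (mu : {measure set T -> \bar R}) (f : T -> R[i]) :
  cmeasurable_fun setT f -> mu.-integrable setT (fun x => (normc (f x))%:E) -> L1 mu f.
Proof. by move=> mf ih; apply: (L1_le mf ih) => x. Qed.

Lemma cmeas_slice1 f y : cmeasurable_fun setT f -> cmeasurable_fun setT (fun x => f (x, y)).
Proof. by move=> mf; apply: (cmeas_comp _ mf); exact: pair2_measurable. Qed.

Lemma L1_slice1 f : L1 (m1 \x m2)%E f -> {ae m2, forall y, L1 m1 (fun x => f (x, y))}.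
Proof.
move=> lf; have := ae_integrable2 (L1_normc lf); apply: filterS => y iy.
by apply: L1_of_normc => //; apply: cmeas_slice1; exact: L1_meas lf.
Qed.

Lemma L1_cint1 f : L1 (m1 \x m2)%E f ->
  L1 m2 (fun y => cintegral m1 setT (fun x => f (x, y))).
Proof.
move=> lf; have mf := L1_meas lf; split; first exact: cmeas_cint1.
have mn : measurable_fun setT (fun p => (normc (f p))%:E).
  by apply/measurable_EFinP; exact: meas_normc.
have n0 p : (0 <= (normc (f p))%:E)%E by rewrite lee_fin normc_ge0.
have fin : (\int[m2]_y \int[m1]_x (normc (f (x, y)))%:E < +oo)%E.
  by case: lf => _; rewrite (fubini_tonelli2 (fun p => (normc (f p))%:E) mn n0).
apply: le_lt_trans fin; apply: ae_ge0_le_integral => //.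
- by move=> y _; rewrite lee_fin normc_ge0.
- by apply/measurable_EFinP; apply: meas_normc; exact: cmeas_cint1.
- by move=> y _; apply: integral_ge0 => x _; exact: n0.
- exact: (measurable_fun_fubini_tonelli_G _ mn n0).
- have := L1_slice1 lf; apply: filterS => y ly _.
  apply: le_trans (_ : (\int[m1]_x normc (f (x, y)))%:E <= _)%E.
    by rewrite lee_fin normc_cint_le.
  rewrite /Rintegral fineK//; apply: integrable_fin_num => //.
  exact: L1_normc ly.
Qed.

End slices.

Section transfer.
Context (R : realType) d1 d2 (T1 : measurableType d1) (T2 : measurableType d2).
Variables (m1 : {measure set T1 -> \bar R}) (m2 : {measure set T2 -> \bar R}) (phi : T1 -> T2).
Hypothesis mphi : measurable_fun setT phi.
Hypothesis Hphi : forall f : T2 -> \bar R, measurable_fun setT f -> (forall x, 0 <= f x)%E ->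
  (\int[m2]_y f y = \int[m1]_x f (phi x))%E.

Lemma Rintegral_transfer (h : T2 -> R) : measurable_fun setT h ->
  \int[m2]_y h y = \int[m1]_x h (phi x).
Proof.
move=> mh; have mE : measurable_fun setT (EFin \o h) by exact/measurable_EFinP.
congr fine; rewrite integralE [in RHS]integralE; congr (_ - _)%E.
  rewrite Hphi//; last exact: measurable_funepos.
  by apply: eq_integral => x _; apply/esym; exact: (congr1 (@^~ x) (funepos_comp (EFin \o h) phi)).
rewrite Hphi//; last exact: measurable_funeneg.
by apply: eq_integral => x _; apply/esym; exact: (congr1 (@^~ x) (funeneg_comp (EFin \o h) phi)).
Qed.

Lemma cint_transfer (f : T2 -> R[i]) : cmeasurable_fun setT f ->
  cintegral m2 setT f = cintegral m1 setT (fun x => f (phi x)).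
Proof.
by move=> [f1 f2]; rewrite /cintegral (Rintegral_transfer f1) (Rintegral_transfer f2).
Qed.

Lemma L1_transfer (f : T2 -> R[i]) : L1 m2 f -> L1 m1 (fun x => f (phi x)).
Proof.
move=> [mf ff]; split; first exact: (cmeas_comp mphi mf).
rewrite -(Hphi (f := fun x => (normc (f x))%:E))//.
- by apply/measurable_EFinP; exact: meas_normc.
- by move=> x; rewrite lee_fin normc_ge0.
Qed.

End transfer.

Section plancherel.
Variable R : realType.
Local Notation lam := (@lebesgue_measure R).
Local Notation X := (measurableTypeR R).

Definition ft n (u : n.-tuple R -> R[i]) (w : n.-tuple R) : R[i] :=
  cintegral (lebn R n) setT (fun t => u t * cis (- inner t w)).

Lemma cint_lebn0 (f : 0.-tuple R -> R[i]) : cmeasurable_fun setT f ->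
  cintegral (lebn R 0) setT f = f [tuple].
Proof.
move=> [f1 f2]; rewrite /cintegral /Rintegral !integral_lebn0//=.
- by case: (f [tuple]).
- exact/measurable_EFinP.
- exact/measurable_EFinP.
Qed.

Lemma ge0_integral_tcons n (f : n.+1.-tuple R -> \bar R) :
  measurable_fun setT f -> (forall t, 0 <= f t)%E ->
  (\int[lebn R n.+1]_t f t = \int[(lam \x lebn R n)%E]_p f (tcons p))%E.
Proof.
by move=> mf f0; rewrite /= /lebnS ge0_integral_pushforward//; exact: measurable_tcons.
Qed.

Lemma inner_tcons n x y (t w : n.-tuple R) :
  inner (tcons (x, t)) (tcons (y, w)) = x * y + inner t w.
Proof.
rewrite /inner big_ord_recl !tnth0; congr (_ + _).
by apply: eq_bigr => i _; rewrite !tnthS.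
Qed.

Lemma cmeas_cis_inner d (T : measurableType d) n (f g : T -> n.-tuple R) :
  measurable_fun setT f -> measurable_fun setT g ->
  cmeasurable_fun setT (fun p => cis (- inner (f p) (g p))).
Proof.
by move=> mf mg; apply: cmeas_cis; apply: measurableT_comp => //; exact: meas_inner.
Qed.

Lemma cmeas_ft n (u : n.-tuple R -> R[i]) : cmeasurable_fun setT u -> cmeasurable_fun setT (ft u).
Proof.
move=> mu; apply: (@cmeas_cint1 _ _ _ _ _ (lebn R n) (fun p => u p.1 * cis (- inner p.1 p.2))).
by apply: cmeasM; [exact: cmeas_fst|apply: cmeas_cis_inner; [exact: measurable_fst|exact: measurable_snd]].
Qed.

Lemma L1_ft n (u : n.-tuple R -> R[i]) w : L1 (lebn R n) u ->
  L1 (lebn R n) (fun t => u t * cis (- inner t w)).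
Proof.
move=> lu; apply: (L1M (M := 1) lu) => [|x]; last by rewrite normc_cis.
by apply: cmeas_cis_inner.
Qed.

(** Induction on the dimension: by Fubini the transform in [n + 1] variables is the [n]-variable
    transform of the partial transform [v xi] in the first coordinate, and the line case applies to
    almost every section. *)
Theorem plancherel n (u : n.-tuple R -> R[i]) : L1 (lebn R n) u ->
  (\int[lebn R n]_w (normc (ft u w) ^+ 2)%:E =
   ((2 * pi) ^+ n)%:E * \int[lebn R n]_t (normc (u t) ^+ 2)%:E)%E.
Proof.
elim: n u => [|n IH] u lu; have mu := L1_meas lu.
  have mE : measurable_fun setT (fun t => (normc (u t) ^+ 2)%:E).
    by apply/measurable_EFinP; exact: meas_normc2.
  have mF : measurable_fun setT (fun t => (normc (ft u t) ^+ 2)%:E).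
    by apply/measurable_EFinP; apply: meas_normc2; exact: cmeas_ft.
  rewrite !integral_lebn0// expr0 mul1e /ft cint_lebn0; last exact: L1_meas (L1_ft _ lu).
  by rewrite normcM normc_cis mulr1.
pose U p := u (tcons p).
have lU : L1 (lam \x lebn R n)%E U.
  apply: (L1_transfer (@measurable_tcons R n) _ lu) => f mf f0.
  exact: ge0_integral_tcons.
have mU := L1_meas lU.
have pi0 : 0 <= (2 * pi : R) by rewrite mulr_ge0// pi_ge0.
pose v (xi : X) t := ft1 (fun x => U (x, t)) xi.
have lUc xi : L1 (lam \x lebn R n)%E (fun p => U p * cis (- (p.1 * xi))).
  apply: (L1M (M := 1) lU) => [|x]; last by rewrite normc_cis.
  under eq_fun do rewrite -mulN1r.
  by apply: cmeas_cisM; [exact: measurable_fst|exact: measurable_cst].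
have lv xi : L1 (lebn R n) (v xi) by exact: L1_cint1 (lUc xi).
have Eft xi w : ft u (tcons (xi, w)) = ft (v xi) w.
  rewrite /ft (@cint_transfer _ _ _ _ _ (lam \x lebn R n)%E (lebn R n.+1) (@tcons R n)); last 2 first.
  - by move=> f mf f0; exact: ge0_integral_tcons.
  - exact: L1_meas (L1_ft _ lu).
  have lp : L1 (lam \x lebn R n)%E (fun p => U p * cis (- (p.1 * xi)) * cis (- inner p.2 w)).
    apply: (L1M (M := 1) (lUc xi)) => [|x]; last by rewrite normc_cis.
    by apply: cmeas_cis_inner; [exact: measurable_snd|exact: measurable_cst].
  transitivity (cintegral (lam \x lebn R n)%E setT (fun p => U p * cis (- (p.1 * xi)) * cis (- inner p.2 w))).
    apply: eq_cint => -[x t]; rewrite inner_tcons opprD cisD mulrA //.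
  rewrite cint_fubini2//; apply: eq_cint_ae.
  - exact: cmeas_cint1 (L1_meas lp).
  - exact: L1_meas (L1_ft _ (lv xi)).
  - have := L1_slice1 (lUc xi); apply: filterS => t lt.
    exact: (cintZr (cis (- inner t w)) lt).
have mft : measurable_fun setT (fun t => (normc (ft u t) ^+ 2)%:E).
  by apply/measurable_EFinP; apply: meas_normc2; exact: cmeas_ft.
rewrite ge0_integral_lebnS//; last by move=> t; rewrite lee_fin sqr_ge0.
under eq_integral => xi _.
  under eq_integral do rewrite Eft.
  rewrite (IH _ (lv xi)).
  over.
have mvj : cmeasurable_fun setT (fun p : X * n.-tuple R => v p.1 p.2).
  apply: (@cmeas_cint1 _ _ _ _ _ lam (fun q : X * (X * n.-tuple R) =>
     U (q.1, q.2.2) * cis (- (q.1 * q.2.1)))).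
  apply: cmeasM.
    apply: (cmeas_comp _ mU); apply: measurable_fun_pair; first exact: measurable_fst.
    exact: (measurableT_comp measurable_snd measurable_snd).
  under eq_fun do rewrite -mulN1r; apply: cmeas_cisM; first exact: measurable_fst.
  exact: (measurableT_comp measurable_fst measurable_snd).
have mv2 : measurable_fun setT (fun p : X * n.-tuple R => (normc (v p.1 p.2) ^+ 2)%:E).
  by apply/measurable_EFinP; exact: meas_normc2.
have v20 (p : X * n.-tuple R) : (0 <= (normc (v p.1 p.2) ^+ 2)%:E)%E by rewrite lee_fin sqr_ge0.
rewrite ge0_integralZl_EFin ?exprn_ge0//; last 2 first.
- by move=> xi _; apply: integral_ge0 => t _; exact: (v20 (xi, t)).
- exact: (measurable_fun_fubini_tonelli_F _ mv2 v20).
rewrite (fubini_tonelli (fun p : X * n.-tuple R => (normc (v p.1 p.2) ^+ 2)%:E) mv2 v20)/=.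
have mU2 : measurable_fun setT (fun p => (normc (U p) ^+ 2)%:E).
  by apply/measurable_EFinP; exact: meas_normc2.
have U20 p : (0 <= (normc (U p) ^+ 2)%:E)%E by rewrite lee_fin sqr_ge0.
rewrite (_ : \int[lebn R n]_t \int[lam]_xi _ = \int[lebn R n]_t ((2 * pi)%:E * \int[lam]_x (normc (U (x, t)) ^+ 2)%:E))%E; last first.
  apply: ge0_ae_eq_integral => //.
  - exact: (measurable_fun_fubini_tonelli_G _ mv2 v20).
  - apply: measurable_funeM; exact: (measurable_fun_fubini_tonelli_G _ mU2 U20).
  - by move=> t _; apply: integral_ge0 => x _; exact: (v20 (x, t)).
  - by move=> t _; rewrite mule_ge0 ?lee_fin//; apply: integral_ge0 => x _; exact: U20.
  - have := L1_slice1 lU; apply: filterS => t lt _.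
    exact: plancherel1.
rewrite ge0_integralZl_EFin//; last 2 first.
- by move=> t _; apply: integral_ge0 => x _; exact: U20.
- exact: (measurable_fun_fubini_tonelli_G _ mU2 U20).
rewrite -(fubini_tonelli2 (fun p => (normc (U p) ^+ 2)%:E) mU2 U20) muleA -EFinM -exprSr.
congr (_ * _)%E; rewrite ge0_integral_tcons//.
- by apply/measurable_EFinP; exact: meas_normc2.
- by move=> t; rewrite lee_fin sqr_ge0.
Qed.

End plancherel.

(** * The L2 Fourier transform *)

Section tmul_scaling.
Variable R : realType.
Context (n : nat).
Implicit Types (a t w : n.-tuple R).

Lemma meas_tmul d (T : measurableType d) (u v : T -> n.-tuple R) :
  measurable_fun setT u -> measurable_fun setT v ->
  measurable_fun setT (fun x => tmul (u x) (v x)).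
Proof.
move=> mu mv; apply/measurable_fun_tnthP => i.
rewrite (_ : _ \o _ = fun x => tnth (u x) i * tnth (v x) i); last first.
  by apply/funext => x /=; rewrite tnth_mktuple.
by apply: measurable_funM; exact: meas_tnth.
Qed.

Lemma meas_tmul1 a : measurable_fun setT (tmul a).
Proof. by apply: meas_tmul. Qed.

Lemma absp_tmul a t : absp (tmul a t) = absp a * absp t.
Proof.
rewrite /absp -normrM -big_split/=; congr (`|_|).
by apply: eq_bigr => i _; rewrite tnth_mktuple.
Qed.

Lemma tmulC a t : tmul a t = tmul t a.
Proof. by apply: eq_from_tnth => i; rewrite !tnth_mktuple mulrC. Qed.

Lemma ge0_integral_tmul a (f : n.-tuple R -> \bar R) : R0 a ->
  measurable_fun setT f -> (forall x, 0 <= f x)%E ->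
  (\int[lebn R n]_t f (tmul a t) = (absp a)^-1%:E * \int[lebn R n]_t f t)%E.
Proof.
move=> a0 mf f0; have pa := absp_gt0 a0.
pose z : n.-tuple R := [tuple 0 | i < n].
have mg : measurable_fun setT (fun t => f (tmul a t)).
  by apply: measurableT_comp => //; exact: meas_tmul1.
have := ge0_integral_affine z a0 mg (fun t => f0 _).
under eq_integral => t _.
  rewrite (_ : tmul a (tdiv (tsub t z) a) = t); first over.
  apply: eq_from_tnth => i; rewrite !tnth_mktuple subr0 mulrC divfK//.
  by move/R0P : a0.
move=> ->; rewrite muleA -EFinM mulVf ?mul1e// gt_eqF//.
Qed.

Context (a : n.-tuple R).
Hypothesis a0 : R0 a.
Let H f mf f0 := @ge0_integral_tmul a f a0 mf f0.
Let va0 : 0 < (absp a)^-1. Proof. by rewrite invr_gt0 absp_gt0. Qed.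

Lemma L2_tmul f : L2 (lebn R n) f -> L2 (lebn R n) (fun t => f (tmul a t)).
Proof. exact: (L2_scaling (meas_tmul1 a) va0 H). Qed.

Lemma L2sq_tmul f : cmeasurable_fun setT f ->
  L2sq (lebn R n) (fun t => f (tmul a t)) = (absp a)^-1 * L2sq (lebn R n) f.
Proof. by move=> mf; apply: (L2sq_scaling va0 H). Qed.

Lemma cint_tmul f : cmeasurable_fun setT f ->
  cintegral (lebn R n) setT (fun t => f (tmul a t)) = ((absp a)^-1)%:C * cintegral (lebn R n) setT f.
Proof. exact: (cint_scaling va0 H). Qed.

End tmul_scaling.

Section L2_fourier.
Variable R : realType.
Context (n : nat).
Local Notation leb := (lebn R n).
Local Notation Rn := (n.-tuple R).
Local Notation L2sq := (L2sq leb).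
Local Notation cdot := (cdot leb).
Local Notation kap := ((2 * pi : R) ^+ n).
Implicit Types (f g h u : Rn -> R[i]) (a b w : Rn).

Lemma kap_gt0 : 0 < kap.
Proof. by rewrite exprn_gt0// mulr_gt0// pi_gt0. Qed.

Lemma L2_ft u : L1 leb u -> L2 leb u -> L2 leb (ft u).
Proof.
move=> lu l2; split; first exact: cmeas_ft (L1_meas lu).
by rewrite plancherel// L2sqE// -EFinM ltry.
Qed.

Lemma L2sq_ft u : L1 leb u -> L2 leb u -> L2sq (ft u) = kap * L2sq u.
Proof.
move=> lu l2; apply: EFin_inj; rewrite -L2sqE; last exact: L2_ft.
by rewrite plancherel// L2sqE// EFinM.
Qed.

Lemma ftB f g w : L1 leb f -> L1 leb g -> ft (fun x => f x - g x) w = ft f w - ft g w.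
Proof.
move=> lf lg; rewrite /ft -cintB; try exact: L1_ft.
by apply: eq_cint => x; rewrite mulrBl.
Qed.

Lemma ftD f g w : L1 leb f -> L1 leb g -> ft (fun x => f x + g x) w = ft f w + ft g w.
Proof.
move=> lf lg; rewrite /ft -cintD; try exact: L1_ft.
by apply: eq_cint => x; rewrite mulrDl.
Qed.

Lemma ftZ z f w : L1 leb f -> ft (fun x => z * f x) w = z * ft f w.
Proof.
move=> lf; rewrite /ft -cintZl; last exact: L1_ft.
by apply: eq_cint => x; rewrite mulrA.
Qed.

(** The limit is taken along one fixed sequence of integrable functions, so that existence is a
    matter of completeness; independence of the sequence is [is_ft_seq]. *)
Definition is_ft f g := L2 leb g /\
  L2sq (fun w => ft (trunc f k) w - g w) @[k --> \oo] --> 0.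

Lemma L2_ft_trunc f k : L2 leb f -> L2 leb (ft (trunc f k)).
Proof. by move=> lf; apply: L2_ft; [exact: L1_trunc|exact: L2_trunc]. Qed.

(** Plancherel makes the transforms of the truncations a Cauchy sequence. *)
Lemma ex_ft f : L2 leb f -> exists g, is_ft f g.
Proof.
move=> lf; have lt k := L2_trunc k lf; have l1 k := L1_trunc k lf.
have [|g lg gc] := L2_complete (fun k => L2_ft_trunc k lf); last by exists g.
move=> e e0; have K0 := kap_gt0.
have e4 : 0 < e / (4 * kap) by rewrite divr_gt0// mulr_gt0.
have /cvgrPdist_le /(_ _ e4) [N _ HN] := trunc_cvg lf.
exists N => i j /HN/= Ni /HN/= Nj.
rewrite !sub0r !normrN !ger0_norm ?L2sq_ge0// in Ni Nj.
rewrite (_ : (fun x => _) = ft (fun x => trunc f i x - trunc f j x)); last first.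
  by apply/funext => w; rewrite ftB.
rewrite L2sq_ft; [|exact: L1B|exact: L2B].
have H : L2sq (fun x => trunc f i x - trunc f j x) <= 4 * (e / (4 * kap)).
  rewrite (_ : (fun x => _) = (fun x => (trunc f i x - f x) + (f x - trunc f j x))); last first.
    by apply/funext => x; rewrite addrA subrK.
  apply: le_trans (L2sqD_le (L2B (lt i) lf) (L2B lf (lt j))) _.
  by rewrite (L2sqC leb f); move: Ni Nj; clear; lra.
apply: le_trans (ler_wpM2l (ltW K0) H) _.
by rewrite le_eqVlt; apply/orP; left; apply/eqP; field; rewrite gt_eqF.
Qed.

(** The transform is independent of the approximating sequence, since Plancherel carries the
    distance of two sequences to that of their transforms. *)
Lemma is_ft_seq f g (f_ : nat -> Rn -> R[i]) : L2 leb f -> is_ft f g ->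
  (forall k, L1 leb (f_ k)) -> (forall k, L2 leb (f_ k)) ->
  L2sq (fun x => f_ k x - f x) @[k --> \oo] --> 0 ->
  L2sq (fun w => ft (f_ k) w - g w) @[k --> \oo] --> 0.
Proof.
move=> lf [lg gc] l1 l2 fc; have tc := trunc_cvg lf.
apply: (@squeeze_cvgr _ _ _ _ (fun=> 0) (fun k => 2 * (kap * (2 * L2sq (fun x => f_ k x - f x) + 2 * L2sq (fun x => trunc f k x - f x))) + 2 * L2sq (fun w => ft (trunc f k) w - g w))).
- near=> k; rewrite L2sq_ge0 andTb.
  have lt := L2_trunc k lf; have lt1 := L1_trunc k lf.
  rewrite (_ : (fun w => ft (f_ k) w - g w) = (fun w => ft (fun x => f_ k x - trunc f k x) w + (ft (trunc f k) w - g w))); last first.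
    by apply/funext => w; rewrite ftB// addrA subrK.
  apply: le_trans (L2sqD_le _ _) _.
  + by apply: L2_ft; [exact: L1B|exact: L2B].
  + by apply: L2B => //; exact: L2_ft_trunc.
  rewrite lerD2r ler_wpM2l// L2sq_ft; [|exact: L1B|exact: L2B].
  rewrite ler_wpM2l ?(ltW kap_gt0)//.
  rewrite (_ : (fun x => _) = (fun x => (f_ k x - f x) + (f x - trunc f k x))); last first.
    by apply/funext => x; rewrite addrA subrK.
  by rewrite (L2sqC leb (trunc f k)) L2sqD_le//; exact: L2B.
- exact: cvg_cst.
- apply: (@cvgn_eq _ _ (2 * (kap * (2 * 0 + 2 * 0)) + 2 * 0)); first by rewrite !(mulr0,addr0).
  apply: cvgD; last by apply: cvgM => //; exact: cvg_cst.
  apply: cvgM; first exact: cvg_cst.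
  apply: cvgM; first exact: cvg_cst.
  by apply: cvgD; (apply: cvgM => //; exact: cvg_cst).
Unshelve. all: by end_near. Qed.

Lemma is_ft_of_seq f g (f_ : nat -> Rn -> R[i]) : L2 leb f -> L2 leb g ->
  (forall k, L1 leb (f_ k)) -> (forall k, L2 leb (f_ k)) ->
  L2sq (fun x => f_ k x - f x) @[k --> \oo] --> 0 ->
  L2sq (fun w => ft (f_ k) w - g w) @[k --> \oo] --> 0 -> is_ft f g.
Proof.
move=> lf lg l1 l2 fc gc; split; first exact: lg.
have [G [lG Gc]] := ex_ft lf.
have Gc' := is_ft_seq lf (conj lG Gc) l1 l2 fc.
have lft k := L2_ft (l1 k) (l2 k).
have gG := L2_cvg_unique lft lg lG ((L2_cvgP lft lg).2 gc) ((L2_cvgP lft lG).2 Gc').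
apply: cvg_trans Gc; apply: near_eq_cvg; apply: nearW => k /=.
congr fine; apply: ge0_ae_eq_integral => //.
- by apply/measurable_EFinP; apply: meas_normc2; apply: cmeasB; [exact: L2_meas (L2_ft_trunc k lf)|exact: L2_meas lG].
- by apply/measurable_EFinP; apply: meas_normc2; apply: cmeasB; [exact: L2_meas (L2_ft_trunc k lf)|exact: L2_meas lg].
- by move=> x _; rewrite lee_fin sqr_ge0.
- by move=> x _; rewrite lee_fin sqr_ge0.
- by apply: filterS gG => w -> _.
Qed.

Lemma is_ft_L2sq f g : L2 leb f -> is_ft f g -> L2sq g = kap * L2sq f.
Proof.
move=> lf [lg gc]; have lt k := L2_trunc k lf; have l1 k := L1_trunc k lf.
have c1 := L2sq_cvg (fun k => L2_ft_trunc k lf) lg gc.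
have c2 : kap * L2sq (trunc f k) @[k --> \oo] --> kap * L2sq f.
  by apply: cvgM; [exact: cvg_cst|exact: L2sq_cvg (trunc_cvg lf)].
have E k := L2sq_ft (l1 k) (lt k).
have c3 : L2sq (ft (trunc f k)) @[k --> \oo] --> kap * L2sq f by under eq_fun do rewrite E.
exact: (cvg_unique _ c1 c3).
Qed.

Lemma is_ftD f g F G : L2 leb f -> L2 leb g -> is_ft f F -> is_ft g G ->
  is_ft (fun x => f x + g x) (fun w => F w + G w).
Proof.
move=> lf lg [lF Fc] [lG Gc].
apply: (@is_ft_of_seq _ _ (fun k x => trunc f k x + trunc g k x)).
- exact: L2D.
- exact: L2D.
- by move=> k; apply: L1D; exact: L1_trunc.
- by move=> k; apply: L2D; exact: L2_trunc.
- apply: (@squeeze_cvgr _ _ _ _ (fun=> 0) (fun k => 2 * L2sq (fun x => trunc f k x - f x) + 2 * L2sq (fun x => trunc g k x - g x))).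
  + near=> k; rewrite L2sq_ge0 andTb.
    rewrite (_ : (fun x => _) = (fun x => (trunc f k x - f x) + (trunc g k x - g x))); last first.
      by apply/funext => x; rewrite opprD addrACA.
    by apply: L2sqD_le; apply: L2B => //; exact: L2_trunc.
  + exact: cvg_cst.
  + apply: (@cvgn_eq _ _ (2 * 0 + 2 * 0)); first by rewrite !mulr0 addr0.
    by apply: cvgD; (apply: cvgM; [exact: cvg_cst|exact: trunc_cvg]).
- apply: (@squeeze_cvgr _ _ _ _ (fun=> 0) (fun k => 2 * L2sq (fun x => ft (trunc f k) x - F x) + 2 * L2sq (fun x => ft (trunc g k) x - G x))).
  + near=> k; rewrite L2sq_ge0 andTb.
    rewrite (_ : (fun x => _) = (fun x => (ft (trunc f k) x - F x) + (ft (trunc g k) x - G x))); last first.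
      by apply/funext => x; rewrite ftD ?opprD; [rewrite addrACA|exact: L1_trunc|exact: L1_trunc].
    by apply: L2sqD_le; apply: L2B => //; exact: L2_ft_trunc.
  + exact: cvg_cst.
  + apply: (@cvgn_eq _ _ (2 * 0 + 2 * 0)); first by rewrite !mulr0 addr0.
    by apply: cvgD; (apply: cvgM => //; exact: cvg_cst).
Unshelve. all: by end_near. Qed.

Lemma is_ftZ z f F : L2 leb f -> is_ft f F -> is_ft (fun x => z * f x) (fun w => z * F w).
Proof.
move=> lf [lF Fc]; have lt k := L2_trunc k lf.
apply: (@is_ft_of_seq _ _ (fun k x => z * trunc f k x)).
- exact: L2Zl.
- exact: L2Zl.
- by move=> k; apply: L1Zl; exact: L1_trunc.
- by move=> k; exact: L2Zl.
- have E k : L2sq (fun x => z * trunc f k x - z * f x) = normc z ^+ 2 * L2sq (fun x => trunc f k x - f x).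
    by rewrite -L2sqZ; [under [in RHS]eq_fun do rewrite mulrBr|exact: L2B].
  under eq_fun do rewrite E; apply: (@cvgn_eq _ _ (normc z ^+ 2 * 0)); first by rewrite mulr0.
  by apply: cvgM; [exact: cvg_cst|exact: trunc_cvg].
- have E k : L2sq (fun w => ft (fun x => z * trunc f k x) w - z * F w) = normc z ^+ 2 * L2sq (fun w => ft (trunc f k) w - F w).
    rewrite -L2sqZ; last by apply: L2B => //; exact: L2_ft_trunc.
    congr L2sq; apply/funext => w; rewrite ftZ ?mulrBr//; exact: L1_trunc.
  under eq_fun do rewrite E; apply: (@cvgn_eq _ _ (normc z ^+ 2 * 0)); first by rewrite mulr0.
  by apply: cvgM => //; exact: cvg_cst.
Qed.

(** Polarization of the norm identity. *)
Lemma parseval f g F G : L2 leb f -> L2 leb g -> is_ft f F -> is_ft g G ->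
  cdot F G = kap%:C * cdot f g.
Proof.
move=> lf lg hF hG; have [lF _] := hF; have [lG _] := hG.
apply/eqP; rewrite eq_complex; apply/andP; split; apply/eqP.
  rewrite polar_re// (is_ft_L2sq (L2D lf lg) (is_ftD lf lg hF hG)) (is_ft_L2sq lf hF) (is_ft_L2sq lg hG).
  rewrite cReM polar_re//; rewrite [complex.Re kap%:C]/= [complex.Im kap%:C]/=; ring.
have hiG := is_ftZ 'i lg hG; have lig := L2Zl 'i lg.
rewrite polar_im// (is_ft_L2sq (L2D lf lig) (is_ftD lf lig hF hiG)) (is_ft_L2sq lf hF) (is_ft_L2sq lg hG).
rewrite cImM polar_im//; rewrite [complex.Re kap%:C]/= [complex.Im kap%:C]/=; ring.
Qed.

End L2_fourier.

(** * The wavelet transform on the Fourier side *)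

Section dilation.
Variable R : realType.
Context (n : nat).
Local Notation leb := (lebn R n).
Local Notation Rn := (n.-tuple R).
Local Notation L2sq := (L2sq leb).
Local Notation cdot := (cdot leb).
Local Notation kap := ((2 * pi : R) ^+ n).
Implicit Types (f g h u psi : Rn -> R[i]) (a b w : Rn).

Lemma ft_affine u a b w : R0 a -> L1 leb u ->
  ft (fun t => u (tdiv (tsub t b) a)) w =
  (absp a)%:C * (cis (- inner b w) * ft u (tmul a w)).
Proof.
move=> a0 lu; have mu := L1_meas lu.
have mH : cmeasurable_fun setT (fun s => u s * cis (- inner s (tmul a w))).
  by apply: cmeasM => //; apply: cmeas_cis_inner.
have mH2 : cmeasurable_fun setT (fun s => cis (- inner b w) * (u s * cis (- inner s (tmul a w)))).
  by apply: cmeasM => //; exact: cmeas_cst.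
have E : (fun t => u (tdiv (tsub t b) a) * cis (- inner t w)) =
  (fun t => (fun s => cis (- inner b w) * (u s * cis (- inner s (tmul a w)))) (tdiv (tsub t b) a)).
  apply/funext => t; rewrite mulrCA -cisD -opprD; congr (_ * cis (- _)).
  rewrite /inner -big_split/=; apply: eq_bigr => i _; rewrite !tnth_mktuple.
  by move/R0P : a0 => /(_ i) ai; field.
rewrite /ft E (cint_affine b a0 mH2) cintZl//.
exact: L1_ft.
Qed.

Definition dil psi a b t : R[i] :=
  ((Num.sqrt (absp a))^-1)%:C * psi (tdiv (tsub t b) a).

Lemma sqrt_absp_gt0 a : R0 a -> 0 < Num.sqrt (absp a).
Proof. by move=> a0; rewrite sqrtr_gt0 absp_gt0. Qed.

Lemma L2_dil psi a b : R0 a -> L2 leb psi -> L2 leb (dil psi a b).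
Proof. by move=> a0 lp; apply: L2Zl; exact: L2_affine. Qed.

Lemma L1_dil psi a b : R0 a -> L1 leb psi -> L1 leb (dil psi a b).
Proof. by move=> a0 lp; apply: L1Zl; exact: L1_affine. Qed.

Lemma L2sq_dil psi a b : R0 a -> L2 leb psi -> L2sq (dil psi a b) = L2sq psi.
Proof.
move=> a0 lp; have s0 := sqrt_absp_gt0 a0.
rewrite L2sqZ; last exact: L2_affine.
rewrite (L2sq_affine b a0 (L2_meas lp)) normc_real ger0_norm ?invr_ge0 ?ltW//.
by rewrite mulrA exprVn sqr_sqrtr ?absp_ge0// mulVf ?mul1r// gt_eqF ?absp_gt0.
Qed.

Lemma dilB psi psi' a b :
  (fun t => dil psi a b t - dil psi' a b t) = dil (fun t => psi t - psi' t) a b.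
Proof. by apply/funext => t; rewrite /dil mulrBr. Qed.

Lemma ft_dil u a b w : R0 a -> L1 leb u ->
  ft (dil u a b) w = (Num.sqrt (absp a))%:C * cis (- inner b w) * ft u (tmul a w).
Proof.
move=> a0 lu; have s0 := sqrt_absp_gt0 a0.
rewrite (_ : dil u a b = fun t => ((Num.sqrt (absp a))^-1)%:C * (fun t => u (tdiv (tsub t b) a)) t)//.
rewrite ftZ; last exact: L1_affine.
rewrite ft_affine// mulrA -rmorphM mulrA; congr (_%:C * _ * _).
by rewrite -{2}(sqr_sqrtr (absp_ge0 a)) expr2 mulrA mulVf ?mul1r// gt_eqF.
Qed.

(** The formula holds for integrable functions by substitution, and passes to the limit because the
    normalized dilations on both sides are isometries of [L2]. *)
Lemma is_ft_dil psi Psi a b : R0 a -> L2 leb psi -> is_ft psi Psi ->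
  is_ft (dil psi a b)
    (fun w => (Num.sqrt (absp a))%:C * cis (- inner b w) * Psi (tmul a w)).
Proof.
move=> a0 lp hP; have [lP Pc] := hP; have s0 := sqrt_absp_gt0 a0.
have mc : cmeasurable_fun setT (fun w => cis (- inner b w)).
  by apply: cmeas_cis_inner.
have L2s F : L2 leb F -> L2 leb (fun w => (Num.sqrt (absp a))%:C * cis (- inner b w) * F (tmul a w)).
  move=> lF; under eq_fun do rewrite -mulrA [cis _ * _]mulrC.
  apply: L2Zl; apply: (L2M (M := 1) (L2_tmul a0 lF) mc) => x.
  by rewrite normc_cis.
have rs F : L2 leb F -> L2sq (fun w => (Num.sqrt (absp a))%:C * cis (- inner b w) * F (tmul a w)) = L2sq F.
  move=> lF; transitivity (L2sq (fun w => (Num.sqrt (absp a))%:C * F (tmul a w))).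
    by apply: eq_Rintegral => w _; rewrite !normcM normc_cis mulr1.
  rewrite L2sqZ; last exact: L2_tmul.
  rewrite (L2sq_tmul a0 (L2_meas lF)) normc_real ger0_norm ?ltW//.
  by rewrite mulrA sqr_sqrtr ?absp_ge0// mulfV ?mul1r// gt_eqF ?absp_gt0.
apply: (@is_ft_of_seq _ _ _ _ (fun k => dil (trunc psi k) a b)).
- exact: L2_dil.
- exact: L2s.
- by move=> k; apply: L1_dil => //; exact: L1_trunc.
- by move=> k; apply: L2_dil => //; exact: L2_trunc.
- have E k : L2sq (fun x => dil (trunc psi k) a b x - dil psi a b x) = L2sq (fun x => trunc psi k x - psi x).
    by rewrite dilB L2sq_dil//; apply: L2B => //; exact: L2_trunc.
  by under eq_fun do rewrite E; exact: trunc_cvg.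
- have E k : L2sq (fun w => ft (dil (trunc psi k) a b) w -
      (Num.sqrt (absp a))%:C * cis (- inner b w) * Psi (tmul a w)) =
      L2sq (fun w => ft (trunc psi k) w - Psi w).
    rewrite -[RHS](rs (fun w => ft (trunc psi k) w - Psi w)); last first.
      by apply: L2B => //; exact: L2_ft_trunc.
    by congr L2sq; apply/funext => w; rewrite (ft_dil _ _ a0 (L1_trunc k lp)) mulrBr.
  by under eq_fun do rewrite E.
Qed.

Lemma innerC a b : inner a b = inner b a.
Proof. by apply: eq_bigr => i _; rewrite mulrC. Qed.

Lemma L1_wave Psi Gam a : R0 a -> L2 leb Psi -> L2 leb Gam ->
  L1 leb (fun w => Psi (tmul a w) * conjc (Gam w)).
Proof. by move=> a0 lP lG; apply: L2_mulc => //; exact: L2_tmul. Qed.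

(** On the Fourier side a wavelet coefficient, as a function of [b], is again a Fourier integral. *)
Lemma cdot_dil_ft psi g Psi Gam a b : R0 a -> L2 leb psi -> L2 leb g ->
  is_ft psi Psi -> is_ft g Gam ->
  cdot (dil psi a b) g = (kap^-1 * Num.sqrt (absp a))%:C *
    ft (fun w => Psi (tmul a w) * conjc (Gam w)) b.
Proof.
move=> a0 lp lg hP hG; have [lP _] := hP; have [lG _] := hG.
have := parseval (L2_dil b a0 lp) lg (is_ft_dil b a0 lp hP) hG.
have K0 := kap_gt0 R n.
move=> /(congr1 (fun z => (kap^-1)%:C * z)); rewrite mulrA -rmorphM mulVf ?gt_eqF// mul1r => <-.
rewrite rmorphM -mulrA; congr (_ * _).
rewrite /ft -cintZl; last exact: L1_ft (L1_wave a0 lP lG).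
by apply: eq_cint => w; rewrite innerC -!mulrA; congr (_ * _); rewrite mulrC -mulrA.
Qed.

(** Plancherel in [b]. *)
Lemma integral_cdot_dil psi g Psi Gam a : R0 a -> L2 leb psi -> L2 leb g ->
  is_ft psi Psi -> is_ft g Gam ->
  (\int[leb]_b (normc (cdot (dil psi a b) g) ^+ 2)%:E =
   (kap^-1 * absp a)%:E * \int[leb]_w (normc (Psi (tmul a w)) ^+ 2 * normc (Gam w) ^+ 2)%:E)%E.
Proof.
move=> a0 lp lg hP hG; have [lP _] := hP; have [lG _] := hG.
have K0 := kap_gt0 R n; have lw := L1_wave a0 lP lG.
under eq_integral do rewrite (cdot_dil_ft _ a0 lp lg hP hG) normcM exprMn EFinM.
rewrite ge0_integralZl_EFin ?sqr_ge0//; last 2 first.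
- by move=> b _; rewrite lee_fin sqr_ge0.
- by apply/measurable_EFinP; apply: meas_normc2; exact: cmeas_ft (L1_meas lw).
rewrite plancherel// muleA -EFinM; congr (_%:E * _)%E.
  rewrite normc_real real_normK ?num_real// exprMn sqr_sqrtr ?absp_ge0//.
  by field; rewrite gt_eqF ?pi_gt0.
by apply: eq_integral => w _; rewrite normcM normc_conj exprMn.
Qed.

(** Calderon: for every frequency [w] off the coordinate hyperplanes, integrating [|Psi (a w)|^2]
    against [da / |a|] gives the same constant, because that measure is invariant under dilation. *)
Lemma cwt_plancherel psi g Psi Gam : L2 leb psi -> L2 leb g ->
  is_ft psi Psi -> is_ft g Gam ->
  (\int[leb]_a \int[leb]_b (normc (cdot (dil psi a b) g) ^+ 2 / absp a ^+ 2)%:E =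
   (\int[leb]_u (normc (Psi u) ^+ 2 / absp u)%:E) * (L2sq g)%:E)%E.
Proof.
move=> lp lg hP hG; have [lP _] := hP; have [lG _] := hG.
have K0 := kap_gt0 R n; have mP := L2_meas lP; have mG := L2_meas lG.
have mia : measurable_fun setT (fun a : Rn => (absp a)^-1).
  by apply: (measurableT_comp (@measurable_inv R)); exact: meas_absp.
set C := (\int[leb]_u (normc (Psi u) ^+ 2 / absp u)%:E)%E.
have C0 : (0 <= C)%E.
  by apply: integral_ge0 => u _; rewrite lee_fin mulr_ge0 ?sqr_ge0// invr_ge0 absp_ge0.
pose q (p : Rn * Rn) := (normc (Psi (tmul p.1 p.2)) ^+ 2 * normc (Gam p.2) ^+ 2 / absp p.1)%:E.
have q0 p : (0 <= q p)%E.
  by rewrite lee_fin; apply: mulr_ge0; [apply: mulr_ge0; exact: sqr_ge0|rewrite invr_ge0 absp_ge0].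
have mq : measurable_fun setT q.
  apply/measurable_EFinP; apply: measurable_funM.
    apply: measurable_funM; apply: meas_normc2.
      by apply: (cmeas_comp _ mP); apply: meas_tmul; [exact: measurable_fst|exact: measurable_snd].
    by apply: (cmeas_comp _ mG); exact: measurable_snd.
  by apply: (measurableT_comp mia); exact: measurable_fst.
have E a : (\int[leb]_b (normc (cdot (dil psi a b) g) ^+ 2 / absp a ^+ 2)%:E =
    (kap^-1)%:E * \int[leb]_w q (a, w))%E.
  have [a0|a0] := eqVneq (absp a) 0.
    rewrite [X in (_ * X)%E](_ : _ = 0%E) ?mule0; last first.
      by rewrite (eq_integral (cst 0%E)) ?integral0// => w _; rewrite /q /= a0 invr0 mulr0.
    by rewrite (eq_integral (cst 0%E)) ?integral0// => w _; rewrite a0 expr0n invr0 mulr0.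
  have ra : R0 a by [].
  have mb : measurable_fun setT (fun b => (normc (cdot (dil psi a b) g) ^+ 2)%:E).
    under eq_fun do rewrite (cdot_dil_ft _ ra lp lg hP hG).
    apply/measurable_EFinP; apply: meas_normc2; apply: cmeasM; first exact: cmeas_cst.
    by apply: cmeas_ft; exact: L1_meas (L1_wave ra lP lG).
  under eq_integral do rewrite mulrC EFinM.
  rewrite ge0_integralZl_EFin//; last 2 first.
  - by move=> b _; rewrite lee_fin sqr_ge0.
  - by rewrite invr_ge0 sqr_ge0.
  rewrite (integral_cdot_dil ra lp lg hP hG) muleA -EFinM.
  transitivity ((kap^-1)%:E * ((absp a)^-1%:E * \int[leb]_w (normc (Psi (tmul a w)) ^+ 2 * normc (Gam w) ^+ 2)%:E))%E.
    by rewrite muleA -EFinM; congr (_%:E * _)%E; field; rewrite a0 gt_eqF.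
  rewrite -ge0_integralZl_EFin//; last 3 first.
  - by move=> b _; rewrite lee_fin mulr_ge0 ?sqr_ge0.
  - apply/measurable_EFinP; apply: measurable_funM; apply: meas_normc2 => //.
    by apply: (cmeas_comp _ mP); exact: meas_tmul1.
  - by rewrite invr_ge0 absp_ge0.
  by congr (_ * _)%E; apply: eq_integral => w _; rewrite /q -EFinM mulrC.
under eq_integral do rewrite E.
rewrite ge0_integralZl_EFin ?invr_ge0 ?(ltW K0)//; last 2 first.
- by move=> a _; apply: integral_ge0 => w _; exact: q0.
- exact: (measurable_fun_fubini_tonelli_F _ mq q0).
rewrite (fubini_tonelli q mq q0).
(* The substitution [a |-> w a]. *)
have I w : R0 w -> (\int[leb]_a q (a, w) = (normc (Gam w) ^+ 2)%:E * C)%E.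
  move=> w0; have pw := absp_gt0 w0.
  pose h (x : Rn) := (normc (Psi x) ^+ 2 / absp x)%:E.
  have mh : measurable_fun setT h.
    by apply/measurable_EFinP; apply: measurable_funM => //; exact: meas_normc2.
  have h0 x : (0 <= h x)%E by rewrite lee_fin mulr_ge0 ?sqr_ge0// invr_ge0 absp_ge0.
  transitivity (\int[leb]_a ((normc (Gam w) ^+ 2 * absp w)%:E * h (tmul w a)))%E.
    apply: eq_integral => a _; rewrite /q /h -EFinM absp_tmul (tmulC a) invfM/=; congr EFin.
    by move: ((absp a)^-1) => ia; field; rewrite gt_eqF.
  rewrite ge0_integralZl_EFin//; last 2 first.
  - by apply: measurableT_comp => //; exact: meas_tmul1.
  - by rewrite mulr_ge0 ?sqr_ge0 ?absp_ge0.
  rewrite (ge0_integral_tmul w0 mh h0) muleA -EFinM; congr (_%:E * _)%E.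
  by rewrite mulfK// gt_eqF.
rewrite (_ : \int[leb]_y _ = \int[leb]_w ((normc (Gam w) ^+ 2)%:E * C))%E; last first.
  apply: ge0_ae_eq_integral => //.
  - exact: (measurable_fun_fubini_tonelli_G _ mq q0).
  - apply: emeasurable_funM => //; apply/measurable_EFinP; exact: meas_normc2.
  - by move=> w _; apply: integral_ge0 => a _; exact: q0.
  - by move=> w _; rewrite mule_ge0// lee_fin sqr_ge0.
  - by have := lebn_R0 R n; apply: filterS => w w0 _; exact: I.
rewrite ge0_integralZr//; last 2 first.
- by apply/measurable_EFinP; exact: meas_normc2.
- by move=> w _; rewrite lee_fin sqr_ge0.
rewrite L2sqE// (is_ft_L2sq lg hG) muleA -EFinM mulrA mulVf ?mul1r; last by rewrite gt_eqF.
by rewrite muleC.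
Qed.

End dilation.

(** * Orthogonality relations *)

Section orthogonality.
Variable R : realType.
Context (n : nat).
Local Notation leb := (lebn R n).
Local Notation Rn := (n.-tuple R).
Local Notation leb2 := (leb \x leb)%E.
Local Notation L2sq2 := (L2sq (leb \x leb)%E).
Local Notation cdot2 := (cdot (leb \x leb)%E).
Local Notation L2sq := (L2sq leb).
Local Notation cdot := (cdot leb).
Implicit Types (f g h psi phi Psi Phi : Rn -> R[i]) (a b : Rn).

(** The density [1/|a|^2] is split evenly between the two factors of an inner product;
    since [0^-1 = 0] it also discards the null set where [|a| = 0]. *)
Definition cwt psi f (p : Rn * Rn) : R[i] :=
  cdot f (dil psi p.2 p.1) * ((absp p.2)^-1)%:C.

(** The Calderon constant is the squared norm of this function, and its polarized form is an inner
    product. *)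
Definition wgt Psi (u : Rn) : R[i] := Psi u * ((Num.sqrt (absp u))^-1)%:C.

Lemma meas_iabsp : measurable_fun setT (fun a : Rn => (absp a)^-1).
Proof. by apply: (measurableT_comp (@measurable_inv R)); exact: meas_absp. Qed.

Lemma meas_isqrt_absp : measurable_fun setT (fun a : Rn => (Num.sqrt (absp a))^-1).
Proof.
apply: (measurableT_comp (@measurable_inv R)).
apply: (@measurableT_comp _ _ _ _ _ _ (@Num.sqrt R)); last exact: meas_absp.
by apply: continuous_measurable_fun; exact: sqrt_continuous.
Qed.

Lemma cmeas_wgt Psi : cmeasurable_fun setT Psi -> cmeasurable_fun setT (wgt Psi).
Proof. by move=> mP; apply: cmeasM => //; apply: cmeas_real; exact: meas_isqrt_absp. Qed.

Lemma normc2_wgt Psi u : normc (wgt Psi u) ^+ 2 = normc (Psi u) ^+ 2 / absp u.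
Proof.
rewrite normcM exprMn normc_real real_normK ?num_real// exprVn sqr_sqrtr//.
exact: absp_ge0.
Qed.

Lemma cmeas_cwt psi f : cmeasurable_fun setT psi -> cmeasurable_fun setT f ->
  cmeasurable_fun setT (cwt psi f).
Proof.
move=> mp mf; apply: cmeasM; last first.
  by apply: cmeas_real; apply: (measurableT_comp meas_iabsp); exact: measurable_snd.
apply: (@cmeas_cint2 _ _ _ _ _ leb (fun q : (Rn * Rn) * Rn => f q.2 * conjc (dil psi q.1.2 q.1.1 q.2))).
apply: cmeasM; first by apply: (cmeas_comp _ mf); exact: measurable_snd.
have m12 : measurable_fun setT (fun q : (Rn * Rn) * Rn => q.1.2).
  exact: (measurableT_comp measurable_snd measurable_fst).
have m11 : measurable_fun setT (fun q : (Rn * Rn) * Rn => q.1.1).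
  exact: (measurableT_comp measurable_fst measurable_fst).
apply: cmeas_conj; apply: cmeasM.
  by apply: cmeas_real; apply: (measurableT_comp meas_isqrt_absp).
apply: (cmeas_comp _ mp); apply: meas_tdiv => //; apply: meas_tsub => //.
Qed.

Lemma cwt_off psi f b a : absp a = 0 -> cwt psi f (b, a) = 0.
Proof. by move=> a0; rewrite /cwt /= a0 invr0 mulr0. Qed.

Lemma cwt_cases psi psi' f f' (z : R[i]) (p : Rn * Rn) :
  (R0 p.2 -> cwt psi f p = z * cwt psi' f' p) -> cwt psi f p = z * cwt psi' f' p.
Proof.
case: p => b a /= H; have [a0|a0] := eqVneq (absp a) 0; last exact: H.
by rewrite !cwt_off// mulr0.
Qed.

Lemma cwtDr psi f g p : L2 leb psi -> L2 leb f -> L2 leb g ->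
  cwt psi (fun x => f x + g x) p = cwt psi f p + cwt psi g p.
Proof.
case: p => b a lp lf lg; have [a0|a0] := eqVneq (absp a) 0.
  by rewrite !cwt_off// addr0.
by rewrite /cwt cdotDl ?mulrDl//; exact: L2_dil.
Qed.

Lemma cwtZr z psi f p : L2 leb psi -> L2 leb f ->
  cwt psi (fun x => z * f x) p = z * cwt psi f p.
Proof.
case: p => b a lp lf; apply: cwt_cases => a0.
by rewrite /cwt cdotZl ?mulrA//; exact: L2_dil.
Qed.

Lemma cwtDl psi phi f p : L2 leb psi -> L2 leb phi -> L2 leb f ->
  cwt (fun x => psi x + phi x) f p = cwt psi f p + cwt phi f p.
Proof.
case: p => b a lp lp' lf; have [a0|a0] := eqVneq (absp a) 0.
  by rewrite !cwt_off// addr0.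
rewrite /cwt -mulrDl -cdotDr//; try exact: L2_dil.
by congr (cdot _ _ * _); apply/funext => t; rewrite /dil mulrDr.
Qed.

Lemma cwtZl z psi f p : L2 leb psi -> L2 leb f ->
  cwt (fun x => z * psi x) f p = conjc z * cwt psi f p.
Proof.
case: p => b a lp lf; apply: cwt_cases => a0.
rewrite /cwt mulrA -cdotZr//; last exact: L2_dil.
by congr (cdot _ _ * _); apply/funext => t; rewrite /dil mulrCA.
Qed.

Lemma integral_cwt psi Psi f : L2 leb psi -> is_ft psi Psi -> L2 leb f ->
  (\int[leb2]_p (normc (cwt psi f p) ^+ 2)%:E =
   (\int[leb]_u (normc (wgt Psi u) ^+ 2)%:E) * (L2sq f)%:E)%E.
Proof.
move=> lp hP lf; have [Gam hG] := ex_ft lf.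
have mw := cmeas_cwt (L2_meas lp) (L2_meas lf).
rewrite fubini_tonelli2//; last 2 first.
- by apply/measurable_EFinP; exact: meas_normc2.
- by move=> p; rewrite lee_fin sqr_ge0.
under [in RHS]eq_integral do rewrite normc2_wgt.
rewrite -(cwt_plancherel lp lf hP hG).
apply: eq_integral => a _; apply: eq_integral => b _; congr EFin.
have [a0|a0] := eqVneq (absp a) 0.
  by rewrite cwt_off// normc0 expr0n a0 expr0n/= invr0 mulr0.
rewrite /cwt normcM exprMn normc_real real_normK ?num_real// exprVn.
by rewrite (cdotC (L2_dil b a0 lp) lf) normc_conj.
Qed.

Lemma L2_cwt psi Psi f : L2 leb psi -> is_ft psi Psi -> L2 leb (wgt Psi) -> L2 leb f ->
  L2 leb2 (cwt psi f).
Proof.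
move=> lp hP lw lf; split; first exact: cmeas_cwt (L2_meas lp) (L2_meas lf).
by rewrite (integral_cwt lp hP lf) L2sqE// -EFinM ltry.
Qed.

Lemma L2sq_cwt psi Psi f : L2 leb psi -> is_ft psi Psi -> L2 leb (wgt Psi) -> L2 leb f ->
  L2sq2 (cwt psi f) = L2sq (wgt Psi) * L2sq f.
Proof.
move=> lp hP lw lf; apply: EFin_inj; rewrite -L2sqE; last exact: L2_cwt hP lw lf.
by rewrite (integral_cwt lp hP lf) L2sqE.
Qed.

(** The norm identity holds for every function of the form [f + z h], so it polarizes in the
    analysed function. *)
Lemma cdot_cwt_diag psi Psi f h : L2 leb psi -> is_ft psi Psi -> L2 leb (wgt Psi) ->
  L2 leb f -> L2 leb h ->
  cdot2 (cwt psi f) (cwt psi h) = (L2sq (wgt Psi))%:C * cdot f h.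
Proof.
move=> lp hP lw lf lh.
have L g : L2 leb g -> L2 leb2 (cwt psi g) by exact: L2_cwt hP lw.
have rq g : L2 leb g -> L2sq2 (cwt psi g) = L2sq (wgt Psi) * L2sq g by exact: L2sq_cwt.
apply/eqP; rewrite eq_complex; apply/andP; split; apply/eqP.
  rewrite (polar_re (L _ lf) (L _ lh)).
  rewrite (_ : (fun p => _) = cwt psi (fun x => f x + h x)); last first.
    by apply/funext => p; rewrite cwtDr.
  rewrite (rq _ (L2D lf lh)) (rq _ lf) (rq _ lh) cReM (polar_re lf lh).
  rewrite [complex.Re _%:C]/= [complex.Im _%:C]/=; ring.
have lih := L2Zl 'i lh.
rewrite (polar_im (L _ lf) (L _ lh)).
rewrite (_ : (fun p => _) = cwt psi (fun x => f x + 'i * h x)); last first.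
  by apply/funext => p; rewrite cwtDr// cwtZr.
rewrite (rq _ (L2D lf lih)) (rq _ lf) (rq _ lh) cImM (polar_im lf lh).
rewrite [complex.Re _%:C]/= [complex.Im _%:C]/=; ring.
Qed.

(** Polarization in the wavelet: the diagonal case for [psi + phi] and [psi + i phi] gives the
    symmetric sum of the two cross terms [B1] and [B2], and its analogue twisted by [i], from which
    [B1] is recovered. *)
Theorem cwt_orthogonality psi phi Psi Phi f h : L2 leb psi -> L2 leb phi ->
  is_ft psi Psi -> is_ft phi Phi -> L2 leb (wgt Psi) -> L2 leb (wgt Phi) ->
  L2 leb f -> L2 leb h ->
  cdot2 (cwt psi f) (cwt phi h) = cdot (wgt Phi) (wgt Psi) * cdot f h.
Proof.
move=> lp lq hP hQ lwP lwQ lf lh.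
set z := cdot (wgt Psi) (wgt Phi).
have sum (eta Eta : Rn -> R[i]) : L2 leb eta -> is_ft eta Eta -> L2 leb (wgt Eta) ->
    cdot2 (cwt psi f) (cwt eta h) + cdot2 (cwt eta f) (cwt psi h) =
    (2 * complex.Re (cdot (wgt Psi) (wgt Eta)))%:C * cdot f h.
  move=> le hE lE.
  have lpe := L2D lp le; have hpe := is_ftD lp le hP hE.
  have Ew : wgt (fun w => Psi w + Eta w) = (fun w => wgt Psi w + wgt Eta w).
    by apply/funext => w; rewrite /wgt mulrDl.
  have lwpe : L2 leb (wgt (fun w => Psi w + Eta w)) by rewrite Ew; exact: L2D.
  have := cdot_cwt_diag lpe hpe lwpe lf lh.
  rewrite (_ : cwt _ f = (fun p => cwt psi f p + cwt eta f p)); last first.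
    by apply/funext => p; rewrite cwtDl.
  rewrite (_ : cwt _ h = (fun p => cwt psi h p + cwt eta h p)); last first.
    by apply/funext => p; rewrite cwtDl.
  have lwpf := L2_cwt lp hP lwP lf; have lwph := L2_cwt lp hP lwP lh.
  have lwef := L2_cwt le hE lE lf; have lweh := L2_cwt le hE lE lh.
  rewrite (cdotDl lwpf lwef (L2D lwph lweh)) (cdotDr lwpf lwph lweh) (cdotDr lwef lwph lweh).
  rewrite (cdot_cwt_diag lp hP lwP lf lh) (cdot_cwt_diag le hE lE lf lh) Ew L2sqD//.
  rewrite !rmorphD/=; set A := _%:C; set B := _%:C; set C := _%:C; set c := cdot f h.
  move: (cdot2 (cwt psi f) (cwt eta h)) (cdot2 (cwt eta f) (cwt psi h)) => B1 B2.
  clearbody A B C c => E.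
  by apply: (addrI (A * c + B * c)); rewrite -!mulrDl -E; ring.
have s1 := sum phi Phi lq hQ lwQ.
have liq := L2Zl 'i lq; have hiQ := is_ftZ 'i lq hQ.
have Ewi : wgt (fun w => 'i * Phi w) = (fun w => 'i * wgt Phi w).
  by apply/funext => w; rewrite /wgt mulrA.
have lwiq : L2 leb (wgt (fun w => 'i * Phi w)) by rewrite Ewi; exact: L2Zl.
have := sum _ _ liq hiQ lwiq.
rewrite (_ : cwt (fun x => 'i * phi x) f = (fun p => conjc 'i * cwt phi f p)); last first.
  by apply/funext => p; rewrite cwtZl.
rewrite (_ : cwt (fun x => 'i * phi x) h = (fun p => conjc 'i * cwt phi h p)); last first.
  by apply/funext => p; rewrite cwtZl.
have lqf := L2_cwt lq hQ lwQ lf; have lqh := L2_cwt lq hQ lwQ lh.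
have lpf := L2_cwt lp hP lwP lf; have lph := L2_cwt lp hP lwP lh.
rewrite (cdotZr _ lpf lqh) (cdotZl _ lqf lph) Ewi (cdotZr _ lwP lwQ) -/z conjcK.
move: s1; rewrite -/z => s1 s2.
rewrite (cdotC lwP lwQ) -/z.
move: s1 s2; set B1 := cdot2 (cwt psi f) (cwt phi h).
set B2 := cdot2 (cwt phi f) (cwt psi h); set c := cdot f h.
case: z => x y s1 s2.
have ci : conjc ('i : R[i]) = - 'i by simpc.
have i2 : 'i * 'i = -1 :> R[i] by rewrite -expr2 sqr_i.
have e1 : complex.Re (conjc 'i * (x +i* y)) = y by rewrite /=; ring.
have e2 : conjc (x +i* y) = x%:C - 'i * y%:C by simpc.
rewrite e1 ci in s2; rewrite e2; rewrite [complex.Re _]/= in s1.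
apply: (@mulfI _ 2%:R); first by rewrite pnatr_eq0.
(* The multiples of [B2] cancel because [i * i = -1]. *)
have t1 : 2%:R * B1 = (B1 + B2) - 'i * ('i * B1 + - 'i * B2).
  by transitivity (B1 + B2 - 'i * 'i * B1 + 'i * 'i * B2); [rewrite i2; ring|ring].
by rewrite t1 s1 s2 !rmorphM /= !rmorph_nat; ring.
Qed.

End orthogonality.

(** * The fractional wavelet transform *)

Section fractional.
Variable R : realType.
Context (n : nat) (alpha : R).
Local Notation leb := (lebn R n).
Local Notation Rn := (n.-tuple R).
Local Notation leb2 := (leb \x leb)%E.
Local Notation L2sq2 := (L2sq (leb \x leb)%E).
Local Notation cdot2 := (cdot (leb \x leb)%E).
Local Notation L2sq := (L2sq leb).
Local Notation cdot := (cdot leb).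
Implicit Types (f g h psi phi Psi Phi : Rn -> R[i]) (a b t : Rn).

(** The chirps of the fractional transform are [cis] of plus and minus this phase. *)
Definition phase t : R := 2^-1 * sqnorm t * cot alpha.

Definition unchirp f t : R[i] := cis (phase t) * f t.

Lemma meas_phase : measurable_fun setT phase.
Proof.
apply: measurable_funM => //; apply: measurable_funM => //.
by apply: meas_sqnorm.
Qed.

Lemma cmeas_phase d (T : measurableType d) (u : T -> Rn) : measurable_fun setT u ->
  cmeasurable_fun setT (fun x => cis (phase (u x))).
Proof. by move=> mu; apply: cmeas_cis; exact: (measurableT_comp meas_phase mu). Qed.

Lemma cmeas_phN d (T : measurableType d) (u : T -> Rn) : measurable_fun setT u ->
  cmeasurable_fun setT (fun x => cis (- phase (u x))).
Proof.
move=> mu; apply: cmeas_cis; apply: measurableT_comp => //.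
exact: (measurableT_comp meas_phase mu).
Qed.

Lemma chirpK f : unchirp (chirp alpha f) = f.
Proof. by apply/funext => t; rewrite /unchirp /chirp mulrA cisVK mul1r. Qed.

Lemma cmeas_unchirp f : cmeasurable_fun setT f -> cmeasurable_fun setT (unchirp f).
Proof. by move=> mf; apply: cmeasM => //; apply: cmeas_phase. Qed.

Lemma cmeas_chirp f : cmeasurable_fun setT f -> cmeasurable_fun setT (chirp alpha f).
Proof. by move=> mf; apply: cmeasM => //; exact: (@cmeas_phN _ _ id). Qed.

Lemma normc_unchirp f t : normc (unchirp f t) = normc (f t).
Proof. by rewrite normcM normc_cis mul1r. Qed.

Lemma normc_chirp f t : normc (chirp alpha f t) = normc (f t).
Proof. by rewrite normcM normc_cis mul1r. Qed.

Lemma L2_unchirp f : L2 leb f -> L2 leb (unchirp f).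
Proof.
by move=> lf; apply: (L2_eq_normc (cmeas_unchirp (L2_meas lf)) lf) => t; exact: normc_unchirp.
Qed.

Lemma L1_unchirp f : L1 leb f -> L1 leb (unchirp f).
Proof.
by move=> lf; apply: (L1_eq_normc (cmeas_unchirp (L1_meas lf)) lf) => t; exact: normc_unchirp.
Qed.

Lemma L2_chirp f : L2 leb f -> L2 leb (chirp alpha f).
Proof.
by move=> lf; apply: (L2_eq_normc (cmeas_chirp (L2_meas lf)) lf) => t; exact: normc_chirp.
Qed.

Lemma L1_chirp f : L1 leb f -> L1 leb (chirp alpha f).
Proof.
by move=> lf; apply: (L1_eq_normc (cmeas_chirp (L1_meas lf)) lf) => t; exact: normc_chirp.
Qed.

Lemma cdot_unchirp f h : cdot (unchirp f) (unchirp h) = cdot f h.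
Proof.
apply: eq_cint => t; rewrite /unchirp conjcM mulrACA conj_cis cisVK mul1r//.
Qed.

Lemma L2sq_unchirp f : L2sq (unchirp f) = L2sq f.
Proof. by apply: eq_Rintegral => t _; rewrite normc_unchirp. Qed.

Lemma daughterE psi a b t :
  daughter alpha psi a b t = cis (phase b) * (cis (- phase t) * dil psi a b t).
Proof.
rewrite /daughter -/(dil psi a b t) mulrC mulrA -cisD; congr (cis _ * _).
by rewrite /phase; ring.
Qed.

Lemma L2_daughter psi a b : R0 a -> L2 leb psi -> L2 leb (daughter alpha psi a b).
Proof.
move=> a0 lp; have ld := L2_dil b a0 lp.
rewrite (_ : daughter _ _ _ _ = (fun t => cis (phase b) * chirp alpha (dil psi a b) t)).
  by apply: L2Zl; exact: L2_chirp.
by apply/funext => t; rewrite daughterE.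
Qed.

(** The chirp in [t] moves onto the analysed function and the chirp in [b] comes out as a unimodular
    factor: only an ordinary wavelet coefficient is left. *)
Lemma cfrwtE psi f a b : R0 a -> L2 leb psi -> L2 leb f ->
  cfrwt alpha psi f b a = cis (- phase b) * cdot (unchirp f) (dil psi a b).
Proof.
move=> a0 lp lf; rewrite /cfrwt -cintZl.
  apply: eq_cint => t; rewrite daughterE !conjcM !conj_cis opprK /unchirp; ring.
by apply: L2_mulc; [exact: L2_unchirp|exact: L2_dil].
Qed.

Lemma normc_L2dot_daughter psi f a b : R0 a -> L2 leb psi -> L2 leb f ->
  normc (L2dot (daughter alpha psi a b) f) = normc (cdot (dil psi a b) (unchirp f)).
Proof.
move=> a0 lp lf; rewrite -[RHS]mul1r -(normc_cis (phase b)) -normcM; congr normc.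
rewrite /L2dot -cintZl.
  apply: eq_cint => t; rewrite daughterE /unchirp conjcM conj_cis; ring.
by apply: L2_mulc; [exact: L2_dil|exact: L2_unchirp].
Qed.

Definition fcwt psi f (p : Rn * Rn) : R[i] :=
  cfrwt alpha psi f p.1 p.2 * ((absp p.2)^-1)%:C.

Lemma fcwtE psi f : L2 leb psi -> L2 leb f ->
  fcwt psi f = (fun p => cis (- phase p.1) * cwt psi (unchirp f) p).
Proof.
move=> lp lf; apply/funext => -[b a]; have [a0|a0] := eqVneq (absp a) 0.
  by rewrite cwt_off// /fcwt /= a0 invr0 !mulr0.
by rewrite /fcwt cfrwtE// mulrA.
Qed.

Lemma cmeas_fcwt psi f : L2 leb psi -> L2 leb f -> cmeasurable_fun setT (fcwt psi f).
Proof.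
move=> lp lf; rewrite fcwtE//; apply: cmeasM; first exact: (cmeas_phN measurable_fst).
by apply: cmeas_cwt; [exact: L2_meas lp|exact: L2_meas (L2_unchirp lf)].
Qed.

Lemma normc_fcwt psi f p : L2 leb psi -> L2 leb f ->
  normc (fcwt psi f p) = normc (cwt psi (unchirp f) p).
Proof. by move=> lp lf; rewrite fcwtE// normcM normc_cis mul1r. Qed.

Lemma L2_fcwt psi Psi f : L2 leb psi -> is_ft psi Psi -> L2 leb (wgt Psi) -> L2 leb f ->
  L2 leb2 (fcwt psi f).
Proof.
move=> lp hP lw lf; apply: (L2_eq_normc (cmeas_fcwt lp lf) (L2_cwt lp hP lw (L2_unchirp lf))) => p.
exact: normc_fcwt.
Qed.

Lemma L2sq_fcwt psi Psi f : L2 leb psi -> is_ft psi Psi -> L2 leb (wgt Psi) -> L2 leb f ->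
  L2sq2 (fcwt psi f) = L2sq (wgt Psi) * L2sq f.
Proof.
move=> lp hP lw lf; rewrite -(L2sq_unchirp f) -(L2sq_cwt lp hP lw (L2_unchirp lf)).
by apply: eq_Rintegral => p _; rewrite normc_fcwt.
Qed.

Lemma fcwt_orthogonality psi phi Psi Phi f h : L2 leb psi -> L2 leb phi ->
  is_ft psi Psi -> is_ft phi Phi -> L2 leb (wgt Psi) -> L2 leb (wgt Phi) ->
  L2 leb f -> L2 leb h ->
  cdot2 (fcwt psi f) (fcwt phi h) = cdot (wgt Phi) (wgt Psi) * cdot f h.
Proof.
move=> lp lq hP hQ lwP lwQ lf lh.
rewrite -(cdot_unchirp f h) -(cwt_orthogonality lp lq hP hQ lwP lwQ (L2_unchirp lf) (L2_unchirp lh)).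
apply: eq_cint => p; rewrite !fcwtE// conjcM conj_cis opprK mulrACA.
by rewrite -cisD addNr cis0 mul1r.
Qed.

Lemma fcwtD psi f g p : L2 leb psi -> L2 leb f -> L2 leb g ->
  fcwt psi (fun x => f x + g x) p = fcwt psi f p + fcwt psi g p.
Proof.
move=> lp lf lg; rewrite !fcwtE//; last exact: L2D.
have -> : unchirp (fun x => f x + g x) = (fun x => unchirp f x + unchirp g x).
  by apply/funext => t; rewrite /unchirp mulrDr.
by rewrite (cwtDr _ lp (L2_unchirp lf) (L2_unchirp lg)) mulrDr.
Qed.

Lemma fcwtZ psi z f p : L2 leb psi -> L2 leb f ->
  fcwt psi (fun x => z * f x) p = z * fcwt psi f p.
Proof.
move=> lp lf; rewrite !fcwtE//; last exact: L2Zl.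
have -> : unchirp (fun x => z * f x) = (fun x => z * unchirp f x).
  by apply/funext => t; rewrite /unchirp mulrCA.
by rewrite (cwtZr _ _ lp (L2_unchirp lf)) mulrCA.
Qed.

Lemma measurable_R0 : measurable (@R0 R n).
Proof.
rewrite (_ : R0 = (fun a : Rn => absp a) @^-1` [set~ 0]); last first.
  by apply/seteqP; split => a /= /eqP.
rewrite -[X in measurable X]setTI.
by apply: (meas_absp (@measurable_id _ _ setT)) => //; apply: measurableC; exact: measurable_set1.
Qed.

(** Admissibility bounds the Calderon constant, because the analysed function may be the wavelet
    itself. *)
Lemma wavelet_wgt psi Psi : wavelet alpha psi -> is_ft psi Psi -> L2 leb (wgt Psi).
Proof.
move=> [lp nz fin] hP; split; first by apply: cmeas_wgt; case: hP => /L2_meas.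
have [Gam hG] := ex_ft (L2_unchirp lp).
have r0 : 0 < L2sq psi.
  rewrite lt_neqAle L2sq_ge0 andbT eq_sym; apply/eqP => r0; apply: nz.
  exact: L2sq_eq0_ae r0.
have := cwt_plancherel lp (L2_unchirp lp) hP hG.
rewrite L2sq_unchirp; under [in RHS]eq_integral do rewrite -normc2_wgt.
set C := (\int[leb]_u (normc (wgt Psi u) ^+ 2)%:E)%E => E.
have : (C * (L2sq psi)%:E < +oo)%E.
  rewrite -E; apply: le_lt_trans fin; rewrite [leRHS]integral_mkcond le_eqVlt; apply/orP; left.
  apply/eqP; apply: eq_integral => a _; rewrite /restrict; case: ifPn => a0.
    apply: eq_integral => b _; rewrite normc_L2dot_daughter//.
    by rewrite inE in a0.
  rewrite (eq_integral (cst 0%E)) ?integral0// => b _.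
  have -> : absp a = 0 by move: a0; rewrite notin_setE /R0/= => /negP; rewrite negbK => /eqP.
  by rewrite expr0n invr0 mulr0.
have C0 : (0 <= C)%E by apply: integral_ge0 => u _; rewrite lee_fin sqr_ge0.
case: C C0 E => [r||]//= _ _; first by move=> _; rewrite ltry.
by rewrite gt0_mulye// lte_fin.
Qed.

End fractional.

(** * The fractional Fourier transform of a chirped function *)

Section sine.
Variable R : realType.

Lemma sin_natpi (k : nat) : sin (k%:R * pi) = 0 :> R.
Proof.
elim: k => [|k IH]; first by rewrite mul0r sin0.
by rewrite -natr1 mulrDl mul1r sinDpi IH oppr0.
Qed.

Lemma sin_intpi (k : int) : sin (k%:~R * pi) = 0 :> R.
Proof.
case: k => k; first exact: sin_natpi.
by rewrite NegzE mulrNz mulNr sinN -[X in sin X]/(k.+1%:R * pi) sin_natpi oppr0.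
Qed.

(** Subtracting the multiple of [pi] below [x] leaves a point of the open interval from 0 to [pi],
    where the sine is positive. *)
Lemma sin_neq0 (x : R) : (forall k : int, x != k%:~R * pi) -> sin x != 0.
Proof.
move=> H; apply/eqP => sx.
have p0 : 0 < (pi : R) by exact: pi_gt0.
pose k : int := Num.floor (x / pi).
have k1 : k%:~R * pi <= x by rewrite -ler_pdivlMr// Num.Theory.floor_le_tmp.
have k2 : x < (k + 1)%:~R * pi by rewrite -ltr_pdivrMr// Num.Theory.floorD1_gt.
pose y := x - k%:~R * pi.
have sy : sin y = 0 by rewrite /y sinB sx sin_intpi mul0r mulr0 subr0.
have y0 : 0 < y.
  by rewrite subr_gt0 lt_neqAle k1 andbT eq_sym; exact: H.
have y1 : y < pi.
  by rewrite /y ltrBlDr; apply: lt_le_trans k2 _; rewrite intrD mulrDl mul1r addrC.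
have := @sin_gt0_pi R y; rewrite y0 y1 sy ltxx => /(_ isT).
by [].
Qed.

End sine.

Section fractional_fourier.
Variable R : realType.
Context (n : nat) (alpha : R).
Hypothesis sin0 : sin alpha != 0.
Local Notation leb := (lebn R n).
Local Notation Rn := (n.-tuple R).
Local Notation L2sq := (L2sq leb).
Local Notation cdot := (cdot leb).
Implicit Types (f g h psi phi Psi Phi : Rn -> R[i]) (a b t : Rn).

Definition cscv : Rn := [tuple csc alpha | i < n].

Lemma R0_cscv : R0 cscv.
Proof. by apply/R0P => i; rewrite tnth_mktuple invr_eq0. Qed.

Lemma inner_cscv t xi : inner t (tmul cscv xi) = inner t xi * csc alpha.
Proof.
rewrite /inner mulr_suml; apply: eq_bigr => i _; rewrite !tnth_mktuple; ring.
Qed.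

(** The exponent of the kernel is a sum of three terms: the chirp in [t] is absorbed into the
    function, the chirp in [xi] factors out, and what remains is the Fourier kernel at [xi csc
    alpha]. *)
Lemma frft1E f xi : L1 leb f ->
  frft1 alpha f xi =
  Calpha n alpha * cis (phase alpha xi) * ft (unchirp alpha f) (tmul cscv xi).
Proof.
move=> lf; rewrite /frft1 /ft -cintZl; last by apply: L1_ft; exact: L1_unchirp.
apply: eq_cint => t; rewrite /Kalpha inner_cscv.
rewrite (_ : _ - _ = phase alpha xi + (phase alpha t + - (inner t xi * csc alpha))); last first.
  by rewrite /phase; ring.
by rewrite !cisD /unchirp; ring.
Qed.

Definition frft_of Phi xi : R[i] :=
  Calpha n alpha * cis (phase alpha xi) * Phi (tmul cscv xi).

Lemma frft_ofB Phi Psi xi :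
  frft_of Phi xi - frft_of Psi xi = frft_of (fun x => Phi x - Psi x) xi.
Proof. by rewrite /frft_of mulrBr. Qed.

Lemma normc_frft_of Phi xi :
  normc (frft_of Phi xi) = normc (Calpha n alpha) * normc (Phi (tmul cscv xi)).
Proof.
by rewrite /frft_of; move: (Calpha n alpha) => c; rewrite !normcM normc_cis mulr1.
Qed.

Lemma conj_frft_ofM Phi Psi xi :
  conjc (frft_of Phi xi) * frft_of Psi xi =
  (normc (Calpha n alpha) ^+ 2)%:C * (Psi (tmul cscv xi) * conjc (Phi (tmul cscv xi))).
Proof.
rewrite /frft_of; move: (Calpha n alpha) (Phi _) (Psi _) => c x y.
rewrite !conjcM conj_cis -mul_conjc -[RHS]mulr1 -(cisVK (phase alpha xi)); ring.
Qed.

Lemma cmeas_frft_of Phi : cmeasurable_fun setT Phi -> cmeasurable_fun setT (frft_of Phi).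
Proof.
move=> mP; apply: cmeasM; last by apply: (cmeas_comp _ mP); exact: meas_tmul1.
by apply: cmeasM; [exact: cmeas_cst|exact: (@cmeas_phase _ _ _ _ _ id)].
Qed.

Lemma L2_frft_of Phi : L2 leb Phi -> L2 leb (frft_of Phi).
Proof.
move=> lP; have lt := L2_tmul R0_cscv lP.
apply: (L2_eq_normc (cmeas_frft_of (L2_meas lP)) (L2Zl (Calpha n alpha) lt)) => xi.
by rewrite normc_frft_of normcM.
Qed.

Lemma L2sq_frft_of Phi : L2 leb Phi ->
  L2sq (frft_of Phi) = normc (Calpha n alpha) ^+ 2 * (absp cscv)^-1 * L2sq Phi.
Proof.
move=> lP; rewrite -mulrA -(L2sq_tmul R0_cscv (L2_meas lP)) -(L2sqZ _ (L2_tmul R0_cscv lP)).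
by apply: eq_Rintegral => xi _; rewrite normc_frft_of normcM.
Qed.

Lemma is_frft2_chirp phi Phi : L2 leb phi -> is_ft phi Phi ->
  is_frft2 alpha (chirp alpha phi) (frft_of Phi).
Proof.
move=> lp hP; have [lP _] := hP; split; first exact: L2_frft_of.
move=> f_ l12 fc; have l1 k := (l12 k).1; have l2 k := (l12 k).2.
have E k : frft1 alpha (f_ k) = frft_of (ft (unchirp alpha (f_ k))).
  by apply/funext => xi; rewrite frft1E.
have lu1 k := L1_unchirp alpha (l1 k); have lu2 k := L2_unchirp alpha (l2 k).
have lf k := L2_ft (lu1 k) (lu2 k).
apply/L2_cvgP; [by move=> k; rewrite E; exact: L2_frft_of|exact: L2_frft_of|].
have fc' : L2sq (fun t => unchirp alpha (f_ k) t - phi t) @[k --> \oo] --> 0.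
  move/(L2_cvgP l2 (L2_chirp alpha lp)) : fc.
  have -> : (fun k => L2sq (fun t => f_ k t - chirp alpha phi t)) =
     (fun k => L2sq (fun t => unchirp alpha (f_ k) t - phi t)).
    apply/funext => k; rewrite -[LHS](L2sq_unchirp alpha); congr L2sq; apply/funext => t.
    by rewrite /unchirp mulrBr -/(unchirp alpha (chirp alpha phi) t) chirpK.
  by [].
have c := is_ft_seq lp hP lu1 lu2 fc'.
have Ek k : L2sq (fun x => frft1 alpha (f_ k) x - frft_of Phi x) =
   normc (Calpha n alpha) ^+ 2 * (absp cscv)^-1 * L2sq (fun w => ft (unchirp alpha (f_ k)) w - Phi w).
  rewrite E -L2sq_frft_of; last exact: L2B.
  by congr L2sq; apply/funext => xi; rewrite frft_ofB.
under eq_fun do rewrite Ek.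
apply: (@cvgn_eq _ _ (normc (Calpha n alpha) ^+ 2 * (absp cscv)^-1 * 0)); first by rewrite mulr0.
by apply: cvgM => //; exact: cvg_cst.
Qed.

(** The chosen representative agrees almost everywhere with the explicit one because both are [L2]
    limits of the transforms of the same truncations. *)
Lemma frft2_chirp phi Phi : L2 leb phi -> is_ft phi Phi ->
  L2 leb (frft2 alpha (chirp alpha phi)) /\
  {ae leb, forall u, frft2 alpha (chirp alpha phi) u = frft_of Phi u}.
Proof.
move=> lp hP; have H1 := is_frft2_chirp lp hP.
have H2 : is_frft2 alpha (chirp alpha phi) (frft2 alpha (chirp alpha phi)).
  exact: (xgetI _ H1).
have [l1 c1] := H1; have [l2 c2] := H2; split => //.
pose f_ k := chirp alpha (trunc phi k).
have l12 k : L1 leb (f_ k) /\ L2 leb (f_ k).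
  by split; [apply: L1_chirp; exact: L1_trunc|apply: L2_chirp; exact: L2_trunc].
have fc : L2_cvg leb f_ (chirp alpha phi).
  apply/L2_cvgP; [by move=> k; case: (l12 k)|exact: L2_chirp|].
  have E k : L2sq (fun x => f_ k x - chirp alpha phi x) = L2sq (fun x => trunc phi k x - phi x).
    by apply: eq_Rintegral => x _; rewrite /f_ /chirp -mulrBr normcM normc_cis mul1r.
  by under eq_fun do rewrite E; exact: trunc_cvg.
apply: (L2_cvg_unique _ l2 l1 (c2 _ l12 fc) (c1 _ l12 fc)) => k.
rewrite (_ : frft1 alpha (f_ k) = frft_of (ft (trunc phi k))).
  by apply: L2_frft_of; exact: L2_ft_trunc.
apply/funext => xi; rewrite frft1E ?chirpK//; by case: (l12 k).
Qed.

Lemma wgt_mulc Psi Phi u :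
  wgt Psi u * conjc (wgt Phi u) = Psi u * conjc (Phi u) * ((absp u)^-1)%:C.
Proof.
rewrite /wgt conjcM mulrACA; congr (_ * _).
rewrite [conjc _%:C]/conjc/= oppr0 -realCM -expr2 exprVn sqr_sqrtr//.
exact: absp_ge0.
Qed.

Lemma cdot_wgt Psi Phi : cdot (wgt Psi) (wgt Phi) =
  cintegral leb setT (fun u => Psi u * conjc (Phi u) * ((absp u)^-1)%:C).
Proof.
by apply: eq_cint => u; exact: wgt_mulc.
Qed.

(** The substitution [u |-> u csc alpha] preserves [du / |u|], so the dilation in the fractional
    transform disappears from the pairing and only [|C_alpha|^2] is left. *)
Lemma CpairE phi psi Phi Psi : L2 leb phi -> L2 leb psi -> is_ft phi Phi -> is_ft psi Psi ->
  L2 leb (wgt Phi) -> L2 leb (wgt Psi) ->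
  Cpair alpha phi psi = (normc (Calpha n alpha) ^+ 2)%:C * cdot (wgt Psi) (wgt Phi).
Proof.
move=> lp lq hP hQ lwP lwQ.
have [lg1 e1] := frft2_chirp lp hP; have [lg2 e2] := frft2_chirp lq hQ.
have [lP _] := hP; have [lQ _] := hQ.
have mia := @meas_iabsp R n.
rewrite /Cpair cintegral_mkcond.
pose H (u : Rn) := Psi u * conjc (Phi u) * ((absp u)^-1)%:C.
have mH : cmeasurable_fun setT H.
  apply: cmeasM; last exact: cmeas_real.
  by apply: cmeasM; [exact: L2_meas lQ|apply: cmeas_conj; exact: L2_meas lP].
have mH2 : cmeasurable_fun setT (fun u => (normc (Calpha n alpha) ^+ 2 * absp cscv)%:C * H u).
  by apply: cmeasM => //; exact: cmeas_cst.
transitivity (cintegral leb setT (fun u => (normc (Calpha n alpha) ^+ 2 * absp cscv)%:C * H (tmul cscv u))).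
  apply: eq_cint_ae.
  - apply: cmeasM; last by apply: cmeas_real; apply: measurable_indic; exact: measurable_R0.
    apply: cmeasM; last exact: cmeas_real.
    by apply: cmeasM; [apply: cmeas_conj; exact: L2_meas lg1|exact: L2_meas lg2].
  - by apply: (cmeas_comp (meas_tmul1 cscv) mH2).
  apply: filterS3 e1 e2 (lebn_R0 R n) => u -> -> u0.
  rewrite indicE mem_set// mulr1 conj_frft_ofM /H absp_tmul.
  have : absp cscv != 0 by rewrite gt_eqF// absp_gt0//; exact: R0_cscv.
  move: (absp cscv) (absp u) (_ * conjc _) (normc _ ^+ 2) => k v A N k0.
  rewrite invfM (realCM N) (realCM k^-1).
  have c0 : k%:C * (k^-1)%:C = 1 :> R[i] by rewrite -realCM mulfV.
  by transitivity (N%:C * A * (v^-1)%:C * (k%:C * (k^-1)%:C)); [rewrite c0 mulr1|ring].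
have c0 : 0 < absp cscv by apply: absp_gt0; exact: R0_cscv.
have lH : L1 leb H.
  rewrite (_ : H = fun u => wgt Psi u * conjc (wgt Phi u)); first exact: L2_mulc.
  by apply/funext => u; rewrite wgt_mulc.
rewrite (cint_tmul R0_cscv mH2) (cintZl _ lH) -cdot_wgt mulrA -realCM; congr (_%:C * _).
by rewrite mulrC mulfK// gt_eqF.
Qed.

End fractional_fourier.

(** * The reproducing formula *)

Section reproducing.
Variable R : realType.
Context (n : nat) (alpha : R).
Local Notation leb := (lebn R n).
Local Notation Rn := (n.-tuple R).
Local Notation leb2 := (leb \x leb)%E.
Implicit Types (f g h psi phi Psi Phi : Rn -> R[i]) (a b t : Rn).
Implicit Types (F : Rn * Rn -> R[i]).

(** Division by [|a|] turns the weighted square integrability of the transform space into plain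
    square integrability on the product, and the indicator restricts to the domain on which [F] is
    measurable. *)
Definition weighted F (p : Rn * Rn) : R[i] :=
  F p * (\1_(setT `*` R0) p)%:C * ((absp p.2)^-1)%:C.

Lemma indic_R0 b a : \1_(setT `*` R0) (b, a) = \1_R0 a :> R.
Proof.
rewrite !indicE (_ : ((b, a) \in _) = (a \in R0))//.
by apply/idP/idP; rewrite !inE => // -[].
Qed.

Lemma L2_weighted F : L2_transform_space F -> L2 leb2 (weighted F).
Proof.
move=> [[F1 F2] fin].
have mD : measurable (setT `*` R0 : set (Rn * Rn)).
  by apply: measurableX => //; exact: measurable_R0.
have E p : normc (weighted F p) ^+ 2 = ((fun p => normc (F p) ^+ 2 / absp p.2 ^+ 2) \_ (setT `*` R0)) p.
  rewrite /weighted !normcM !exprMn !normc_real !real_normK ?num_real// exprVn.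
  rewrite /restrict indicE; case: ifP => _; first by rewrite expr1n mulr1.
  by rewrite expr0n /= mulr0 mul0r.
split.
  apply: cmeasM; last first.
    by apply: cmeas_real; apply: (measurableT_comp (@meas_iabsp R n)); exact: measurable_snd.
  have E1 : (fun p => F p * (\1_(setT `*` R0) p)%:C) =
     (fun p => ((fun p => complex.Re (F p)) \_ (setT `*` R0)) p +i* ((fun p => complex.Im (F p)) \_ (setT `*` R0)) p).
    apply/funext => p; rewrite /restrict indicE; case: ifP => _.
      by rewrite mulr1; case: (F p).
    by rewrite mulr0.
  by rewrite E1; split; apply/(measurable_restrictT _ mD).
rewrite (_ : \int[leb2]_p _ =
  \int[leb2]_(p in setT `*` R0) (normc (F p) ^+ 2 / absp p.2 ^+ 2)%:E)%E; first exact: fin.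
rewrite [RHS]integral_mkcond; apply: eq_integral => p _.
by rewrite E /restrict /=; rewrite /restrict; case: ifP.
Qed.

Section setting.
Context (phi psi Phi Psi : Rn -> R[i]) (F : Rn * Rn -> R[i]).
Hypothesis sin0 : sin alpha != 0.
Hypotheses (lphi : L2 leb phi) (lpsi : L2 leb psi).
Hypotheses (hphi : is_ft phi Phi) (hpsi : is_ft psi Psi).
Hypotheses (lwphi : L2 leb (wgt Phi)) (lwpsi : L2 leb (wgt Psi)).
Hypothesis FL : L2_transform_space F.

Let k0 : R[i] := (normc (Calpha n alpha) ^+ 2)%:C / conjc (Cpair alpha phi psi).

(** The integral over [t] in the kernel is the conjugate of [cfrwt phi h] at [(b, a)], and one
    factor [1/|a|] goes to each side of the inner product; Fubini turns the iterated integral into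
    one over the product. *)
Lemma reproducing_integral b0 a0 : R0 a0 ->
  cintegral leb R0 (fun a => cintegral leb setT (fun b =>
     F (b, a) * reproducing_kernel alpha phi psi b0 a0 b a * ((absp a ^+ 2)^-1)%:C)) =
  k0 * cdot leb2 (weighted F) (fcwt alpha phi (daughter alpha psi a0 b0)).
Proof.
move=> ra0; set h := daughter alpha psi a0 b0.
have lh : L2 leb h by exact: L2_daughter.
have lW := L2_fcwt alpha lphi hphi lwphi lh.
have lF := L2_weighted FL.
have lP := L2_mulc lF lW.
rewrite /cdot -(cintZl k0 lP) (cint_fubini2 (L1Zl k0 lP)) cintegral_mkcond.
apply: eq_cint => a; have [aR|aR] := boolP (a \in (@R0 R n)); last first.
  rewrite indicE (negbTE aR) mulr0; apply/esym.
  transitivity (cintegral leb setT (fun _ : Rn => (0:R)%:C)); last first.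
    by rewrite cint_real Rintegral_cst// mul0r.
  by apply: eq_cint => b; rewrite /weighted indic_R0 indicE (negbTE aR) mulr0 !mul0r mulr0.
have ra : R0 a by rewrite inE in aR.
rewrite indicE aR mulr1; apply: eq_cint => b.
rewrite /weighted indic_R0 indicE aR mulr1 /fcwt /reproducing_kernel.
have -> : cintegral leb setT (fun t => daughter alpha phi a b t * conjc (h t)) =
    conjc (cfrwt alpha phi h b a).
  rewrite /cfrwt -cint_conj; last by apply: L2_mulc => //; exact: L2_daughter.
  by apply: eq_cint => t; rewrite (conjcM (h t)) conjcK mulrC.
rewrite -/k0 -[(b, a).1]/b -[(b, a).2]/a.
rewrite (_ : (absp a ^+ 2)^-1 = (absp a)^-1 * (absp a)^-1); last by rewrite expr2 invfM.
rewrite realCM; move: (cfrwt alpha phi h b a) ((absp a)^-1) => c v; clearbody k0.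
rewrite (conjcM c) (_ : conjc v%:C = v%:C); last by rewrite /= oppr0.
ring.
Qed.
End setting.

End reproducing.

Theorem theorem3p4 (R : realType) (n : nat) (alpha : R)
    (phi psi : n.-tuple R -> R[i]) (F : n.-tuple R * n.-tuple R -> R[i]) :
  (1 <= n)%N ->
  (forall k : int, alpha != k%:~R * pi) ->
  wavelet alpha phi ->
  wavelet alpha psi ->
  (\int[lebn R n]_(u in R0)
     (normc (frft2 alpha (chirp alpha phi) u) *
      normc (frft2 alpha (chirp alpha psi) u) * (absp u)^-1)%:E < +oo)%E ->
  Cpair alpha phi psi != 0 ->
  L2_transform_space F ->
  (exists2 f : n.-tuple R -> R[i], L2 (lebn R n) f &
     forall b a, R0 a -> F (b, a) = cfrwt alpha psi f b a) <->
  (forall b0 a0, R0 a0 ->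
     F (b0, a0) =
     cintegral (lebn R n) R0 (fun a =>
       cintegral (lebn R n) setT (fun b =>
         F (b, a) * reproducing_kernel alpha phi psi b0 a0 b a *
         ((absp a ^+ 2)^-1)%:C))).
Proof.
move=> _ /sin_neq0 sin0 wphi wpsi _ C0 FL.
have [lphi _ _] := wphi; have [lpsi _ _] := wpsi.
have [Phi hphi] := ex_ft lphi; have [Psi hpsi] := ex_ft lpsi.
have lwphi := wavelet_wgt wphi hphi; have lwpsi := wavelet_wgt wpsi hpsi.
set k0 : R[i] := (normc (Calpha n alpha) ^+ 2)%:C / conjc (Cpair alpha phi psi).
have k1 : k0 * cdot (lebn R n) (wgt Phi) (wgt Psi) = 1.
  rewrite (cdotC lwpsi lwphi) /k0.
  have := C0; rewrite (CpairE sin0 lphi lpsi hphi hpsi lwphi lwpsi).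
  move: (normc (Calpha n alpha) ^+ 2) (cdot (lebn R n) (wgt Psi) (wgt Phi)) => N z.
  rewrite mulf_eq0 negb_or => /andP[N0 z0].
  rewrite (conjcM N%:C) (_ : conjc N%:C = N%:C); last by rewrite /= oppr0.
  have zc0 : conjc z != 0 by rewrite conjc_eq0.
  by rewrite invfM mulrA mulfV// mul1r mulVf.
have lF := L2_weighted FL.
have RI b0 a0 := @reproducing_integral R n alpha phi psi Phi F lphi lpsi hphi lwphi FL b0 a0.
(* For a transform, orthogonality evaluates the inner product. *)
split=> [[f lf Ff] b0 a0 a00|FK].
  rewrite RI// -/k0.
  have -> : weighted F = fcwt alpha psi f.
    apply/funext => -[b a]; rewrite /weighted /fcwt indic_R0 -[(b, a).1]/b -[(b, a).2]/a.
    have [a1|a1] := eqVneq (absp a) 0; first by rewrite a1 invr0 !mulr0.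
    by rewrite Ff// indicE mem_set// mulr1.
  have lh := L2_daughter alpha b0 a00 lpsi.
  rewrite (fcwt_orthogonality alpha lpsi lphi hpsi hphi lwpsi lwphi lf lh) mulrA k1 mul1r.
  by rewrite Ff.
(* Conversely, Riesz represents the pairing with the [phi]-transforms by a function. *)
pose ell h := cdot (lebn R n \x lebn R n)%E (weighted F) (fcwt alpha phi h).
have lW h (lh : L2 (lebn R n) h) := L2_fcwt alpha lphi hphi lwphi lh.
have [f lf fE] : exists2 f, L2 (lebn R n) f & forall h, L2 (lebn R n) h -> ell h = cdot (lebn R n) f h.
  apply: (@riesz_representation _ _ _ _ ell (L2sq (lebn R n \x lebn R n)%E (weighted F) * L2sq (lebn R n) (wgt Phi))).
  - move=> f h lf lh; rewrite /ell -(cdotDr lF (lW _ lf) (lW _ lh)); congr (cdot _ _ _).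
    by apply/funext => p; rewrite fcwtD.
  - move=> z f lf; rewrite /ell -(cdotZr _ lF (lW _ lf)); congr (cdot _ _ _).
    by apply/funext => p; rewrite fcwtZ.
  - move=> h lh; rewrite /ell -mulrA -(L2sq_fcwt alpha lphi hphi lwphi lh).
    exact: cauchy_schwarz lF (lW _ lh).
exists (fun t => k0 * f t); first exact: L2Zl.
move=> b a a0; rewrite FK// RI// -/k0.
have lh := L2_daughter alpha b a0 lpsi.
by rewrite -[X in _ * X]/(ell _) fE// -(cdotZl _ lf lh).
Qed.
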